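(* Let $v>1$ be an integer, let $F$ be an absolutely continuous distribution function of a non-negative random variable $X$ with $E(X)<\infty$, let $\bar F=1-F$, and let $X_1,X_2,\dots$ be i.i.d. with distribution function $F$; let $X_{1:n}\le\cdots\le X_{n:n}$ be the order statistics of $X_1,\dots,X_n$. Let $$N=E\big(\max(X_1,\dots,X_v)-\min(X_1,\dots,X_v)\big)=v\int_0^\infty x\big(F^{v-1}(x)-\bar F^{v-1}(x)\big)\,dF(x),$$ $$\widehat N=\frac{v}{n^v}\sum_{i=1}^n\big(i^{v-1}-(n-i)^{v-1}\big)X_{i:n}.$$ Then, as $n\to\infty$, $\sqrt n\,(\widehat N-N)/\sigma_3$ converges in distribution to a standard normal random variable, where $$\sigma_3^2=v^2\int_0^\infty\!\!\int_0^\infty\big[\min\{F(x),F(z)\}-F(x)F(z)\big]\big(F^{v-1}(x)-\bar F^{v-1}(x)\big)\big(F^{v-1}(z)-\bar F^{v-1}(z)\big)\,dx\,dz.$$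
   Context: $F^{v-1}(x)$ and $\bar F^{v-1}(x)$ denote the powers $(F(x))^{v-1}$ and $(1-F(x))^{v-1}$.
   Formalization: The convergence to the standard normal is stated under the additional assumption that σ_3^2 is finite; with only E(X)<∞ it can be infinite (e.g. a Pareto law with tail index 3/2), and then dividing by σ_3 is meaningless. *)

(* Defs.v *)
(* Library: MathComp-Analysis *)
From HB Require Import structures.
From mathcomp Require Import all_boot all_order all_algebra finmap.
From mathcomp Require Import all_classical all_reals all_analysis.
From mathcomp Require Import measurable_realfun.

Set Implicit Arguments.
Unset Strict Implicit.
Unset Printing Implicit Defensive.

Import Order.TTheory GRing.Theory Num.Theory.
Import numFieldNormedType.Exports.

Local Open Scope classical_set_scope.
Local Open Scope ring_scope.

Definition absolutely_continuous (R : realType) (F : R -> R) : Prop :=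
  forall e : R, 0 < e -> exists2 d : R, 0 < d &
    forall (n : nat) (a b : 'I_n -> R),
      (forall i, a i <= b i) ->
      trivIset [set: 'I_n] (fun i => `]a i, b i[%classic) ->
      \sum_(i < n) (b i - a i) < d ->
      \sum_(i < n) `|F (b i) - F (a i)| < e.

Section random_variables.
Context d (T : measurableType d) (R : realType) (P : probability T R).

Definition mutually_independent (X : nat -> {RV P >-> R}) : Prop :=
  forall (J : {fset nat}) (A : nat -> set R),
    (forall j, measurable (A j)) ->
    P (\bigcap_(j in [set` J]) X j @^-1` A j) =
    (\prod_(j <- J) P (X j @^-1` A j))%E.

Definition iid_with_df (F : R -> R) (X : nat -> {RV P >-> R}) : Prop :=
  mutually_independent X /\ forall j x, cdf (X j) x = (F x)%:E.

(* Convergence of the distribution functions at every continuity point of the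
   limiting one. *)
Definition cvg_in_distribution (Y : nat -> {RV P >-> R})
    (mu : probability (measurableTypeR R) R) : Prop :=
  forall x : R, {for x, continuous (fun y : R => mu `]-oo, y]%classic)} ->
    cdf (Y n) x @[n --> \oo] --> mu `]-oo, x]%classic.

(* The sample is indexed from 0 (X_j is X j.-1), but the rank i of
   an order statistic still starts at 1. *)
Definition order_statistic (X : nat -> {RV P >-> R}) (n i : nat) (t : T) : R :=
  nth 0 (sort <=%O [seq X j t | j <- iota 0 n]) i.-1.

(* X 0 is repeated as the default value of the (idempotent) operations. *)
Definition sample_range (X : nat -> {RV P >-> R}) (v : nat) (t : T) : R :=
  \big[Num.max/X 0%N t]_(j < v) X j t - \big[Num.min/X 0%N t]_(j < v) X j t.

Definition mean_range (X : nat -> {RV P >-> R}) (v : nat) : \bar R :=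
  'E_P[sample_range X v].

Definition N_hat (X : nat -> {RV P >-> R}) (v n : nat) (t : T) : R :=
  v%:R / n%:R ^+ v *
  \sum_(1 <= i < n.+1)
    (i%:R ^+ v.-1 - (n - i)%:R ^+ v.-1) * order_statistic X n i t.

Definition normalized_error (X : nat -> {RV P >-> R}) (v : nat) (s : R)
    (n : nat) (t : T) : R :=
  Num.sqrt n%:R * (N_hat X v n t - fine (mean_range X v)) / s.

Lemma nth_sort_le (s : seq R) (k : nat) (x : R) : (k < size s)%N ->
  (nth 0 (sort <=%O s) k <= x) = (k < count (fun y => (y <= x)%R) s)%N.
Proof.
move=> ks.
have sz : size (sort <=%O s) = size s by rewrite size_sort.
rewrite -(count_sort <=%O).
have : sorted <=%O (sort <=%O s) by exact: sort_le_sorted.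
rewrite -sz in ks; move: ks; move: (sort _ _) => u {s sz}.
elim: u k => [|y u IH] k //= ks yu.
case: (leP y x) => yx.
  by case: k ks => [|k] ks //=; rewrite IH// (path_sorted yu).
have all_gt : all (fun z => x < z) (y :: u).
  rewrite /= yx /=; apply/allP => z zu.
  by apply: (lt_le_trans yx); have /allP := order_path_min le_trans yu; apply.
have -> : count (fun y0 => (y0 <= x)%R) u = 0%N.
  apply/eqP; rewrite -leqn0 leqNgt -has_count -all_predC.
  by case/andP: all_gt => _; apply: sub_all => z /=; rewrite -ltNge.
rewrite addn0 ltn0; apply/negbTE; rewrite -ltNge.
by move/allP: all_gt; apply; exact: mem_nth.
Qed.

Lemma measurable_order_statistic (X : nat -> {RV P >-> R}) (n i : nat) :
  measurable_fun [set: T] (order_statistic X n i).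
Proof.
have [ni|ni] := leqP n i.-1.
  rewrite (_ : order_statistic X n i = cst 0); first exact: measurable_cst.
  by apply/funext => t; rewrite /order_statistic nth_default// size_sort size_map size_iota.
apply: (measurability _ (RGenOInfty.measurableE R)) => // _ [_ [x ->] <-].
rewrite setTI.
pose c (t : T) : R := \sum_(0 <= j < n) \1_([set u | X j u <= x]) t.
have mc : measurable_fun [set: T] c.
  apply: measurable_sum => j; apply: measurable_indic.
  rewrite (_ : [set u | _] = X j @^-1` `]-oo, x]); first exact: measurable_funPTI.
  by apply/seteqP; split => u /=; rewrite in_itv.
rewrite (_ : _ @^-1` _ = c @^-1` `]-oo, i.-1%:R]).
  by rewrite -[X in measurable X]setTI; exact: mc.
have cE t : c t = (count (fun y => (y <= x)%R) [seq X j t | j <- iota 0 n])%:R.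
  rewrite /c -sum1_count big_map natr_sum big_mkcond /= /index_iota subn0.
  rewrite [RHS]big_mkcond /=; apply: eq_bigr => j _; rewrite indicE.
  by case: ifPn => h; [rewrite mem_set | rewrite memNset//; exact/negP].
apply/seteqP; split => t /=; rewrite !in_itv /= ?andbT cE ler_nat.
  by rewrite ltNge nth_sort_le ?size_map ?size_iota// -leqNgt.
by rewrite ltNge nth_sort_le ?size_map ?size_iota// -leqNgt.
Qed.

Lemma measurable_N_hat (X : nat -> {RV P >-> R}) (v n : nat) :
  measurable_fun [set: T] (N_hat X v n).
Proof.
apply: measurable_funM; first exact: measurable_cst.
apply: measurable_sum => i; apply: measurable_funM; first exact: measurable_cst.
exact: measurable_order_statistic.
Qed.

Lemma measurable_normalized_error (X : nat -> {RV P >-> R}) (v : nat) (s : R)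
  (n : nat) : measurable_fun [set: T] (normalized_error X v s n).
Proof.
apply: measurable_funM; last exact: measurable_cst.
apply: measurable_funM; first exact: measurable_cst.
apply: measurable_funB; last exact: measurable_cst.
exact: measurable_N_hat.
Qed.

HB.instance Definition _ (X : nat -> {RV P >-> R}) (v : nat) (s : R) (n : nat)
  := isMeasurableFun.Build _ _ _ _ (normalized_error X v s n)
       (measurable_normalized_error X v s n).

End random_variables.

Section variance.
Context (R : realType).
Implicit Types (F : R -> R) (v : nat).
Local Notation mu := (@lebesgue_measure R).

Definition weight F v (x : R) : R := F x ^+ v.-1 - (1 - F x) ^+ v.-1.

Definition sigma3_sq F v : \bar R :=
  ((v%:R ^+ 2)%:E *
   \int[mu]_(z in `[0%R, +oo[) \int[mu]_(x in `[0%R, +oo[)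
     ((Num.min (F x) (F z) - F x * F z) * weight F v x * weight F v z)%:E)%E.

Definition sigma3 F v : R := Num.sqrt (fine (sigma3_sq F v)).

End variance.

(* Main.v *)
(** Put [H u = 1 - u^v - (1 - u)^v] and [w u = u^(v-1) - (1 - u)^(v-1)], so that
    [H' = - v w].  Since [X_{i:n}] is the integral over [x >= 0] of the indicator
    of [x < X_{i:n}], [N_hat] is, up to [O(1/n)] in mean, the integral of
    [H (F_n x)], where [F_n] is the empirical distribution function, while [N] is
    the integral of [H (F x)], the probability of [min <= x < max].  A second-order
    expansion of [H], together with [E (F_n x - F x)^2 = F x (1 - F x) / n], shows
    that [N_hat - N] differs from the mean of the [n] variables [psi (X_j)], where
    [psi s] is [v] times the integral of [w (F x) (1{x < s} - (1 - F x))], by a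
    remainder whose L1 norm is [O(1/n)], hence [o(n^(-1/2))].

    By Fubini, [psi (X_j)] is centered with variance [sigma3_sq].  Fubini needs a
    finite second moment: when [F x >= 3/4], [w (F x)] is bounded below by a
    positive constant, so the integrand of [sigma3_sq] dominates a multiple of
    [z (1 - F z)] for large [z].  The variance is positive because there [psi] is
    strictly increasing, whereas the law of [X_j] has no atom.

    The central limit theorem for the [psi (X_j)] is Trotter's: the averaging
    operators [f |-> E f (x + c Z)] of two standardized [Z] are [o(c^2)]-close on
    smooth [f], and the [n]-th power of the Gaussian one with [c = n^(-1/2)] is
    again Gaussian averaging.  Steep logistic functions serve as smooth substitutes
    for indicators of half-lines.

    The identity between [H (F y)] and [v E (1{y < X} w (F X))], behind the
    Stieltjes formula for [N], holds because the difference [g y] of its two sides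
    satisfies [|g y - g y'| <= K (F y' - F y)^2]; halving [F y' - F y] by the
    intermediate value theorem shows that [g] is constant, and it tends to [0]. *)
Require Import Defs.
From HB Require Import structures.
From mathcomp Require Import all_boot all_order all_algebra finmap.
From mathcomp Require Import all_classical all_reals all_analysis.
From mathcomp Require Import ring lra measurable_realfun.

Set Implicit Arguments.
Unset Strict Implicit.
Unset Printing Implicit Defensive.

Import Order.TTheory GRing.Theory Num.Theory.
Import numFieldNormedType.Exports.

Local Open Scope classical_set_scope.
Local Open Scope ring_scope.

(** * Smooth test functions *)

Section taylor.
Context {R : realType}.
Implicit Types (f : R -> R) (C x y : R).

(** The levels [x] range over a half-line of infinite length, so a pointwise error bound is useful
    only if it is integrable in [x]. Every error is therefore kept proportional to [1 - F x], or to
    a random quantity whose mean is at most [(1 - F x) / n]; the tail [1 - F] is integrable because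
    [X] is nonnegative with finite mean. The second moment has to be extracted from the finiteness
    of [sigma3_sq] alone. The obstacle is that [w (F x)] is negative where [F x < 1/2], so the
    integrand has no constant sign. The level 3/4 stands for any number strictly between 1/2 and 1:
    above it [w] stays away from 0, and the contribution of the levels below it is bounded by their
    finite length. Trotter's method uses only two moments of [psi (X_j)] and real-valued test
    functions. What it requires is a class of test functions that averaging preserves with unchanged
    constants, since the operators are iterated [n] times while [n] grows. *)

Lemma mean_value_bound f (f' : R -> R) x y C : (forall z : R, is_derive z 1 f (f' z)) ->
  (forall z, `|z - x| <= `|y - x| -> `|f' z| <= C) ->
  `|f y - f x| <= C * `|y - x|.
Proof.
move=> df bf.
have cf (a b : R) : {within `[a, b], continuous f}.
  apply: derivable_within_continuous => z _; exact: ex_derive.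
have [xy|yx|->] := ltgtP x y; last by rewrite !subrr normr0 mulr0.
- have [c] := MVT xy (fun z _ => df z) (cf _ _).
  rewrite in_itv /= => /andP[xc cy] ->; rewrite normrM ler_wpM2r// bf//.
  by rewrite !ger0_norm ?subr_ge0 ?(ltW xc) ?(ltW xy)// lerD2r ltW.
- have [c] := MVT yx (fun z _ => df z) (cf _ _).
  rewrite in_itv /= => /andP[yc cx]; rewrite (distrC (f y)) (distrC y) => ->.
  rewrite normrM ler_wpM2r// bf//.
  by rewrite !ler0_norm ?subr_le0 ?(ltW cx) ?(ltW yx)// lerN2 lerD2r ltW.
Qed.

Definition bounded_lipschitz C f :=
  (forall x, `|f x| <= C) /\ (forall x y, `|f y - f x| <= C * `|y - x|).

(** The cubic bound makes the remainder negligible pointwise as the increment shrinks; the quadratic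
    one dominates it using nothing beyond a second moment. *)
Definition taylor2 C f (f1 f2 : R -> R) := forall x y,
  `|f (x + y) - f x - y * f1 x - y ^+ 2 / 2 * f2 x| <=
    C * Num.min (y ^+ 2) (`|y| ^+ 3).

(** Derivatives enter only through the Taylor inequality, which is linear in [f], [f1], [f2].
    Averaging all three preserves it with the same [C], and nothing has to be differentiated under
    the integral sign. *)
Definition smooth C f := exists f1 f2,
  [/\ bounded_lipschitz C f, bounded_lipschitz C f1,
      bounded_lipschitz C f2 & taylor2 C f f1 f2].

Lemma smooth_of_derivatives C f (f1 f2 f3 : R -> R) :
  (forall x : R, is_derive x 1 f (f1 x)) -> (forall x : R, is_derive x 1 f1 (f2 x)) ->
  (forall x : R, is_derive x 1 f2 (f3 x)) ->
  (forall x, [/\ `|f x| <= C, `|f1 x| <= C, `|f2 x| <= C & `|f3 x| <= C]) ->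
  smooth (2 * C) f.
Proof.
move=> df df1 df2 bf.
have C0 : 0 <= C by have [+ _ _ _] := bf 0; apply: le_trans.
have C2 : C <= 2 * C by lra.
have lip (g g' : R -> R) : (forall x : R, is_derive x 1 g (g' x)) ->
    (forall x, `|g' x| <= C) -> forall x y, `|g y - g x| <= 2 * C * `|y - x|.
  move=> dg bg x y; apply: (@le_trans _ _ (C * `|y - x|)).
    by apply: (mean_value_bound dg) => z _.
  by rewrite ler_wpM2r.
exists f1, f2; split.
- by split; [move=> x; have [+ _ _ _] := bf x; lra|apply: (lip _ f1) => // x; have [] := bf x].
- by split; [move=> x; have [_ + _ _] := bf x; lra|apply: (lip _ f2) => // x; have [] := bf x].
- by split; [move=> x; have [_ _ + _] := bf x; lra|apply: (lip _ f3) => // x; have [] := bf x].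
move=> x y.
have first_order : `|f (x + y) - f x - y * f1 x| <= C * y ^+ 2.
  pose h z := f z - z * f1 x.
  have dh (z : R) : is_derive z 1 h (f1 z - f1 x).
    by rewrite /h; apply: is_derive_eq; rewrite /GRing.scale /=; ring.
  have := @mean_value_bound _ _ x (x + y) (C * `|y|) dh.
  rewrite /h (_ : x + y - x = y); last by ring.
  rewrite -mulrA -expr2 real_normK ?num_real//.
  rewrite (_ : f (x + y) - (x + y) * f1 x - (f x - x * f1 x) = f (x + y) - f x - y * f1 x); last by ring.
  apply => z zy; apply: (@le_trans _ _ (C * `|z - x|)); last by rewrite ler_wpM2l.
  by apply: (mean_value_bound df1) => w _; have [] := bf w.
have second_order : `|f (x + y) - f x - y * f1 x - y ^+ 2 / 2 * f2 x| <= C * `|y| ^+ 3.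
  (* The mean value theorem is applied to the remainder [h], then to its derivative [g]. The
     factorial of Taylor's formula is lost, which is harmless here. *)
  pose h z := f z - z * f1 x - (z - x) ^+ 2 / 2 * f2 x.
  have dh (z : R) : is_derive z 1 h (f1 z - f1 x - (z - x) * f2 x).
    by rewrite /h; apply: is_derive_eq; rewrite /GRing.scale /=; field.
  have := @mean_value_bound _ _ x (x + y) (C * `|y| ^+ 2) dh.
  rewrite /h (_ : x + y - x = y); last by ring.
  rewrite (_ : C * `|y| ^+ 2 * `|y| = C * `|y| ^+ 3); last by ring.
  rewrite (_ : f (x + y) - (x + y) * f1 x - y ^+ 2 / 2 * f2 x - _ =
    f (x + y) - f x - y * f1 x - y ^+ 2 / 2 * f2 x); last by field.
  apply => z zy; apply: (@le_trans _ _ (C * `|y| * `|z - x|)); last first.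
    by rewrite expr2 mulrA ler_wpM2l ?mulr_ge0.
  pose g w := f1 w - (w - x) * f2 x.
  have dg (w : R) : is_derive w 1 g (f2 w - f2 x).
    by rewrite /g; apply: is_derive_eq; rewrite /GRing.scale /=; ring.
  have := @mean_value_bound _ _ x z (C * `|y|) dg.
  rewrite /g subrr mul0r subr0.
  rewrite (_ : f1 z - _ - _ = f1 z - f1 x - (z - x) * f2 x); last by ring.
  apply => w wz; apply: (@le_trans _ _ (C * `|w - x|)); last first.
    by rewrite ler_wpM2l// (le_trans wz).
  by apply: (mean_value_bound df2) => u _; have [] := bf u.
have [_ _ bf2 _] := bf x.
(* The factor 2 comes from the quadratic regime: [C * y ^+ 2] for the first-order remainder plus
   half of it for the second-order term. *)
rewrite minEle; case: ifPn => _; last first.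
  by apply: (le_trans second_order); rewrite ler_wpM2r// exprn_ge0.
apply: (le_trans (ler_normB _ _)).
rewrite normrM (ger0_norm (_ : 0 <= y ^+ 2 / 2)) ?divr_ge0 ?sqr_ge0//.
have : y ^+ 2 / 2 * `|f2 x| <= y ^+ 2 / 2 * C.
  by rewrite ler_wpM2l// divr_ge0 ?sqr_ge0.
have : 0 <= C * y ^+ 2 by rewrite mulr_ge0 ?sqr_ge0.
move: first_order; set a := `|_|; set b := _ * `|f2 x|; set u := y ^+ 2.
move=> h1 h2 h3; have -> : 2 * C * u = C * u + u / 2 * C + C * u / 2 by field.
lra.
Qed.

Definition logistic (k a x : R) : R := (1 + expR (k * (x - a)))^-1.

Lemma logistic_gt0 k a x : 0 < logistic k a x.
Proof. by rewrite invr_gt0 addr_gt0 ?expR_gt0. Qed.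

Lemma logistic_lt1 k a x : logistic k a x < 1.
Proof. by rewrite invf_lt1 ?addr_gt0 ?expR_gt0// ltrDl expR_gt0. Qed.

Lemma is_derive_logistic k a x :
  is_derive x 1 (logistic k a) (- k * (logistic k a x * (1 - logistic k a x))).
Proof.
have d0 : 1 + expR (k * (x - a)) != 0 by rewrite gt_eqF// addr_gt0 ?expR_gt0.
have de : is_derive x 1 (fun x => expR (k * (x - a))) (expR (k * (x - a)) * k).
  have dl : is_derive x 1 (fun x => k * (x - a)) k.
    by apply: is_derive_eq; rewrite /GRing.scale /=; ring.
  exact: is_derive1_comp.
have d1 : is_derive x 1 ((cst 1 : R -> R) + (fun y => expR (k * (y - a))))
    (expR (k * (x - a)) * k) by apply: is_derive_eq; rewrite add0r.
have := @is_deriveV _ ((cst 1 : R -> R) + (fun y => expR (k * (y - a)))) x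
  (expR (k * (x - a)) * k) 1 d0 d1.
move/is_derive_eq; apply.
rewrite /logistic /GRing.scale /= !fctE; field; exact: d0.
Qed.

Lemma logistic_smooth k a : exists2 C, 0 <= C & smooth C (logistic k a).
Proof.
pose l := logistic k a.
(* Each derivative of [l] is, up to sign, a power of [k] times a polynomial in [l] bounded by 10 on
   the unit interval; the leading 1 bounds [l] itself. *)
pose C := 1 + 10 * (`|k| + `|k| ^+ 2 + `|k| ^+ 3).
have k1 : 0 <= `|k| by [].
have k2 : 0 <= `|k| ^+ 2 by apply: exprn_ge0.
have k3 : 0 <= `|k| ^+ 3 by apply: exprn_ge0.
exists (2 * C); first by rewrite /C; lra.
have dl x : is_derive x 1 l (- k * (l x * (1 - l x))) by exact: is_derive_logistic.
apply: (@smooth_of_derivatives C l (fun x => - k * (l x * (1 - l x)))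
  (fun x => k ^+ 2 * (l x * (1 - l x) * (1 - 2 * l x)))
  (fun x => - k ^+ 3 * (l x * (1 - l x) * (1 - 6 * l x + 6 * l x ^+ 2)))) => // x.
- by apply: is_derive_eq; rewrite /GRing.scale /=; ring.
- by apply: is_derive_eq; rewrite /GRing.scale /=; ring.
have l0 : 0 < l x by exact: logistic_gt0.
have l1 : l x < 1 by exact: logistic_lt1.
have bd (c p : R) : `|p| <= 10 -> `|c * p| <= 10 * `|c|.
  by move=> ?; rewrite normrM mulrC ler_wpM2r.
split.
- by rewrite gtr0_norm// /C; lra.
- apply: (le_trans (bd _ _ _)); last by rewrite normrN /C; lra.
  by rewrite ler_norml; apply/andP; split; nra.
- apply: (le_trans (bd _ _ _)); last by rewrite normrX /C; lra.
  rewrite normrM -[leRHS]mulr1 ler_pM// ler_norml; apply/andP; split; nra.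
- apply: (le_trans (bd _ _ _)); last by rewrite normrN normrX /C; lra.
  rewrite normrM (_ : 10 = 1 * 10) ?mul1r// -[leRHS]mul1r ler_pM// ler_norml;
    apply/andP; split; nra.
Qed.

Lemma logistic_indicator (e d : R) : 0 < e -> 0 < d -> exists k : R, forall a x : R,
  (x <= a - d)%R%:R - e <= logistic k a x <= (x <= a + d)%R%:R + e.
Proof.
(* At distance [d] from [a] the exponent has absolute value at least [e^-1], and [expR e^-1] is at
   least [e^-1], so what remains of the logistic function is at most [e]. The steepness does not
   depend on [a]. *)
move=> e0 d0; pose k := (e * d)^-1; exists k => a x.
have k0 : 0 < k by rewrite invr_gt0 mulr_gt0.
have kd : k * d = e^-1 by rewrite /k; field; rewrite !gt_eqF.
have E : e^-1 <= expR (e^-1).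
  by apply: le_trans (expR_ge1Dx _); rewrite lerDr.
have l0 := logistic_gt0 k a x; have l1 := logistic_lt1 k a x.
apply/andP; split.
  have [xa|_] := leP x (a - d); last by rewrite sub0r (le_trans _ (ltW l0))// oppr_le0 ltW.
  have : k * (x - a) <= - e^-1 by rewrite -kd -mulrN ler_pM2l//; lra.
  rewrite -ler_expR expRN => h.
  have h2 : expR (k * (x - a)) <= e.
    by apply: (le_trans h); rewrite invf_ple ?posrE ?expR_gt0.
  have h3 := expR_gt0 (k * (x - a)).
  rewrite /logistic mulr1n -[leLHS]mul1r -(mul1r (1 + _)^-1) ler_pdivlMr; last lra.
  by rewrite mul1r; nra.
have [xa|xa] := leP x (a + d); first by rewrite (le_trans (ltW l1))// mulr1n; lra.
rewrite mulr0n add0r.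
have : e^-1 <= k * (x - a) by rewrite -kd ler_pM2l//; lra.
rewrite -ler_expR => h.
rewrite /logistic invf_ple ?posrE// ?addr_gt0 ?expR_gt0//.
by rewrite (le_trans E)// (le_trans h)// lerDr.
Qed.

End taylor.

(** * Trotter's averaging operators *)

Section probability_integrals.
Context d (T : measurableType d) (R : realType) (P : probability T R).
Implicit Types (f g : T -> R) (C : R).

Lemma integrable_bounded f C : measurable_fun setT f -> (forall t, `|f t| <= C) ->
  P.-integrable setT (EFin \o f).
Proof.
move=> mf bf; apply: measurable_bounded_integrable => //.
  by rewrite (le_lt_trans (probability_le1 P _)) ?ltry.
exists C; split; first exact: num_real.
by move=> M CM t _ /=; rewrite (le_trans (bf t))// ltW.
Qed.

Lemma Rintegral_prob_cst (r : R) : \int[P]_t r = r.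
Proof. have e := probability_setT P.
transitivity (r * fine (P [set: T])); [exact: Rintegral_cst|by rewrite e mulr1]. Qed.

Lemma norm_Rintegral_le f C : measurable_fun setT f -> (forall t, `|f t| <= C) ->
  `|\int[P]_t f t| <= C.
Proof.
move=> mf bf; have If := integrable_bounded mf bf.
apply: (le_trans (le_normr_Rintegral _ If)) => //.
rewrite -[leRHS](Rintegral_prob_cst C); apply: le_Rintegral => //.
- apply: (@integrable_bounded _ C); first exact: measurableT_comp.
  by move=> t; rewrite normr_id.
- by apply: (@integrable_bounded _ `|C|) => //.
Qed.

End probability_integrals.

Section bounded_lipschitz_measurability.
Context (R : realType).
Implicit Types (f : R -> R) (C : R).

Lemma bounded_lipschitz_continuous C f : bounded_lipschitz C f -> continuous f.
Proof.
move=> [bf lf] x; apply/cvgrPdist_le => e e0.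
have C0 : 0 <= C by apply: le_trans (bf 0).
have eC : 0 < e / (C + 1) by rewrite divr_gt0// ltr_wpDl.
apply/nbhs_normP; exists (e / (C + 1)) => //= y xy.
rewrite distrC (le_trans (lf x y))//.
apply: (@le_trans _ _ ((C + 1) * `|y - x|)); first by rewrite ler_wpM2r// lerDl.
by rewrite mulrC -ler_pdivlMr ?ltr_wpDl// distrC ltW.
Qed.

Lemma bounded_lipschitz_measurable C f : bounded_lipschitz C f ->
  measurable_fun [set: R] f.
Proof.
by move=> /bounded_lipschitz_continuous cf; exact: continuous_measurable_fun.
Qed.

End bounded_lipschitz_measurability.

Lemma integrable_of_square d (T : measurableType d) (R : realType)
    (P : probability T R) (Y : T -> R) :
  measurable_fun setT Y -> P.-integrable setT (fun y => (Y y ^+ 2)%:E) ->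
  P.-integrable setT (EFin \o Y).
Proof.
move=> mY I2; have I0 : P.-integrable setT (EFin \o (fun _ : T => 1 : R)).
  by apply: (@integrable_bounded _ _ _ _ _ 1) => // _; rewrite normr1.
have I1 : P.-integrable setT (EFin \o (fun y => Y y ^+ 2 + 1)).
  exact: (integrableD measurableT I2 I0).
apply: le_integrable I1 => //; first exact/measurable_EFinP.
move=> y _ /=; rewrite lee_fin [leRHS]ger0_norm ?addr_ge0 ?sqr_ge0//.
rewrite -(real_normK (num_real (Y y))); have := sqr_ge0 (`|Y y| - 1).
have := normr_ge0 (Y y); set a := `|_|; nra.
Qed.

Section averaging.
Context d (T : measurableType d) (R : realType) (P : probability T R).
Variable Z : {RV P >-> R}.
Implicit Types (f : R -> R) (C c x : R).

Lemma measurable_affine_comp f c x : measurable_fun [set: R] f ->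
  measurable_fun setT (fun t => f (x + c * Z t)).
Proof.
move=> mf; apply: (measurableT_comp mf).
by apply: measurable_funD => //; exact: measurable_funM.
Qed.

Definition avg c f x : R := \int[P]_t f (x + c * Z t).

Lemma avg_integrable c C f x : bounded_lipschitz C f ->
  P.-integrable setT (EFin \o (fun t => f (x + c * Z t))).
Proof.
move=> bf; apply: (@integrable_bounded _ _ _ _ _ C); last by move=> t; exact: bf.1.
exact: measurable_affine_comp (bounded_lipschitz_measurable bf).
Qed.

Lemma avg_bounded_lipschitz c C f :
  bounded_lipschitz C f -> bounded_lipschitz C (avg c f).
Proof.
move=> bf; have mf := bounded_lipschitz_measurable bf; split=> [x|x y].
  apply: norm_Rintegral_le => [|t]; last exact: bf.1.
  exact: measurable_affine_comp.
rewrite /avg -RintegralB//; try exact: (avg_integrable _ _ bf).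
apply: norm_Rintegral_le => [|t].
  by apply: measurable_funB; exact: measurable_affine_comp.
apply: (le_trans (bf.2 _ _)).
by rewrite (_ : y + c * Z t - _ = y - x)//; ring.
Qed.

Lemma iter_avg_bounded_lipschitz c C f n :
  bounded_lipschitz C f -> bounded_lipschitz C (iter n (avg c) f).
Proof. by move=> bf; elim: n => //= n; exact: avg_bounded_lipschitz. Qed.

Lemma avg_smooth c C f : smooth C f -> smooth C (avg c f).
Proof.
move=> [f1 [f2 [bf bf1 bf2 tf]]].
exists (avg c f1), (avg c f2); split; try exact: avg_bounded_lipschitz.
move=> x y; have I := avg_integrable c _ bf.
have I1 := avg_integrable c x bf1; have I2 := avg_integrable c x bf2.
rewrite /avg -(RintegralZl y)// -(RintegralZl (y ^+ 2 / 2))//.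
have IZ1 : P.-integrable setT (EFin \o (fun t => y * f1 (x + c * Z t))).
  exact: (integrableZl measurableT y I1).
have IZ2 : P.-integrable setT (EFin \o (fun t => y ^+ 2 / 2 * f2 (x + c * Z t))).
  exact: (integrableZl measurableT (y ^+ 2 / 2) I2).
have IB : P.-integrable setT (EFin \o (fun t => f (x + y + c * Z t) - f (x + c * Z t))).
  exact: (integrableB measurableT (I _) (I _)).
have IC : P.-integrable setT
    (EFin \o (fun t => f (x + y + c * Z t) - f (x + c * Z t) - y * f1 (x + c * Z t))).
  exact: (integrableB measurableT IB IZ1).
rewrite -!RintegralB//.
apply: norm_Rintegral_le => [|t].
  by apply/measurable_EFinP; apply: measurable_int (integrableB measurableT IC IZ2).
by rewrite (_ : x + y + c * Z t = x + c * Z t + y); [exact: tf|ring].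
Qed.

Lemma iter_avg_smooth c C f n : smooth C f -> smooth C (iter n (avg c) f).
Proof. by move=> sf; elim: n => //= n; exact: avg_smooth. Qed.

Definition standardized := [/\ P.-integrable setT (fun t => (Z t ^+ 2)%:E),
  \int[P]_t Z t = 0 & \int[P]_t (Z t ^+ 2) = 1].

(** The mean of the Taylor bound at increment [c * Z], with [c ^+ 2] factored out. It tends to 0
    with [c] by dominated convergence, [Z ^+ 2] being the dominating function. *)
Definition taylor_error c : R :=
  \int[P]_t Num.min (Z t ^+ 2) (`|c| * `|Z t| ^+ 3).

Lemma measurable_taylor_error c :
  measurable_fun setT (fun t => Num.min (Z t ^+ 2) (`|c| * `|Z t| ^+ 3)).
Proof.
apply: measurable_minr; first exact: measurable_funX.
apply: measurable_funM => //.
by apply: measurable_funX; exact: measurableT_comp.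
Qed.

Lemma taylor_error_bound c (y : R) :
  `|Num.min (y ^+ 2) (`|c| * `|y| ^+ 3)| <= y ^+ 2.
Proof. by rewrite ger0_norm ?ge_min ?lexx// le_min sqr_ge0 mulr_ge0 ?exprn_ge0. Qed.

Lemma integrable_taylor_error c : P.-integrable setT (fun t => (Z t ^+ 2)%:E) ->
  P.-integrable setT (EFin \o (fun t => Num.min (Z t ^+ 2) (`|c| * `|Z t| ^+ 3))).
Proof.
apply: le_integrable => //.
  by apply/measurable_EFinP; exact: measurable_taylor_error.
move=> y _ /=; rewrite lee_fin (le_trans (taylor_error_bound _ _))//.
exact: ler_norm.
Qed.

(** Mean 0 removes the first-order term and variance 1 fixes the second-order one, so the main part
    is the same for every standardized law and cancels when two of them are compared. *)
Lemma avg_expansion c C f f1 f2 x : bounded_lipschitz C f -> bounded_lipschitz C f1 ->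
  bounded_lipschitz C f2 -> taylor2 C f f1 f2 -> standardized ->
  `|avg c f x - f x - c ^+ 2 / 2 * f2 x| <= C * c ^+ 2 * taylor_error c.
Proof.
move=> bf bf1 bf2 tf [I2 m0 v1].
have I1 : P.-integrable setT (EFin \o Z) by apply: integrable_of_square.
have If := avg_integrable c x bf.
have Ic (r : R) : P.-integrable setT (EFin \o (fun _ : T => r)).
  exact: (@integrable_bounded _ _ _ _ _ `|r|).
have IZ1 : P.-integrable setT (EFin \o (fun t => (c * f1 x) * Z t)).
  exact: (integrableZl measurableT (c * f1 x) I1).
have IZ2 : P.-integrable setT (EFin \o (fun t => (c ^+ 2 / 2 * f2 x) * Z t ^+ 2)).
  exact: (integrableZl measurableT (c ^+ 2 / 2 * f2 x) I2).
have IB : P.-integrable setT (EFin \o (fun t => f (x + c * Z t) - f x)).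
  exact: (integrableB measurableT If (Ic _)).
have IC : P.-integrable setT
    (EFin \o (fun t => f (x + c * Z t) - f x - (c * f1 x) * Z t)).
  exact: (integrableB measurableT IB IZ1).
have -> : avg c f x - f x - c ^+ 2 / 2 * f2 x = \int[P]_t
    (f (x + c * Z t) - f x - (c * f1 x) * Z t - (c ^+ 2 / 2 * f2 x) * Z t ^+ 2).
  rewrite RintegralB// RintegralB// RintegralB// RintegralZl// RintegralZl//.
  by rewrite m0 v1 Rintegral_prob_cst mulr0 subr0 mulr1.
have ID : P.-integrable setT (EFin \o (fun t =>
    f (x + c * Z t) - f x - (c * f1 x) * Z t - (c ^+ 2 / 2 * f2 x) * Z t ^+ 2)).
  exact: (integrableB measurableT IC IZ2).
apply: (le_trans (le_normr_Rintegral _ ID)) => //.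
have IE := integrable_taylor_error c I2.
rewrite /taylor_error -RintegralZl//; apply: le_Rintegral => //.
- exact: integrable_abse ID.
- exact: (integrableZl measurableT (C * c ^+ 2) IE).
move=> t _; have C0 : 0 <= C by apply: le_trans (bf.1 0).
have := tf x (c * Z t).
rewrite (_ : c * Z t * f1 x = c * f1 x * Z t); last by ring.
rewrite (_ : (c * Z t) ^+ 2 / 2 * f2 x = c ^+ 2 / 2 * f2 x * Z t ^+ 2); last by ring.
move=> /le_trans; apply.
rewrite normrM -mulrA ler_wpM2l// minr_pMr ?sqr_ge0// exprMn.
rewrite (_ : (`|c| * `|Z t|) ^+ 3 = c ^+ 2 * (`|c| * `|Z t| ^+ 3))//.
by rewrite -(real_normK (num_real c)); ring.
Qed.

Lemma taylor_error_cvg0 (c : R^nat) : c n @[n --> \oo] --> 0 ->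
  P.-integrable setT (fun t => (Z t ^+ 2)%:E) ->
  taylor_error (c n) @[n --> \oo] --> 0.
Proof.
move=> c0 I2.
pose g n (t : T) := (Num.min (Z t ^+ 2) (`|c n| * `|Z t| ^+ 3))%:E.
have mg n : measurable_fun setT (g n).
  by apply/measurable_EFinP; exact: measurable_taylor_error.
have g0 t : g n t @[n --> \oo] --> 0%E.
  apply: cvg_EFin; first by apply: nearW.
  apply: (@squeeze_cvgr _ _ _ _ (cst 0) (fun n => `|c n| * `|Z t| ^+ 3)).
  - by apply: nearW => n; rewrite /= le_min sqr_ge0 mulr_ge0 ?exprn_ge0//= ge_min lexx orbT.
  - exact: cvg_cst.
  - rewrite -[X in _ --> X](mul0r (`|Z t| ^+ 3)); apply: cvgMl.
    by rewrite -[X in _ --> X](@normr0 _ R); exact: cvg_norm.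
have gI n t : (`|g n t| <= (Z t ^+ 2)%:E)%E.
  by rewrite lee_fin taylor_error_bound.
have [_ _] := @dominated_convergence _ _ _ P setT measurableT g (cst 0%E) _ mg
  (measurable_cst _) (aeW _ (fun y _ => g0 y)) I2 (aeW _ (fun y n _ => gI n y)).
by rewrite integral0 => /fine_cvg.
Qed.

End averaging.

Section averaging_comparison.
Context d1 d2 (T1 : measurableType d1) (T2 : measurableType d2) (R : realType).
Context (P1 : probability T1 R) (P2 : probability T2 R).
Variables (Z1 : {RV P1 >-> R}) (Z2 : {RV P2 >-> R}).
Implicit Types (f : R -> R) (C c x : R).

(** The operators are exchanged one at a time. Averaging does not increase uniform distances, so
    earlier errors are carried along unamplified; each exchange costs [e] because the iterates stay
    smooth with the same [C]. *)
Lemma iter_avg_close c C e f n x :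
  (forall g y, smooth C g -> `|avg Z1 c g y - avg Z2 c g y| <= e) ->
  smooth C f ->
  `|iter n (avg Z1 c) f x - iter n (avg Z2 c) f x| <= n%:R * e.
Proof.
move=> H sf; have bf : bounded_lipschitz C f by case: sf => ? [? []].
elim: n x => [|n IH] x /=; first by rewrite subrr normr0 mul0r.
set g1 := iter n (avg Z1 c) f; set g2 := iter n (avg Z2 c) f.
have b1 : bounded_lipschitz C g1 by exact: iter_avg_bounded_lipschitz.
have b2 : bounded_lipschitz C g2 by exact: iter_avg_bounded_lipschitz.
rewrite -(subrKA (avg Z1 c g2 x)) (le_trans (ler_normD _ _))//.
rewrite -natr1 mulrDl mul1r lerD//; last first.
  by apply: H; exact: iter_avg_smooth.
rewrite /avg -RintegralB//; try exact: avg_integrable b1; try exact: avg_integrable b2.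
apply: norm_Rintegral_le => [|t]; last exact: IH.
apply: measurable_funB; apply: measurable_affine_comp.
- exact: bounded_lipschitz_measurable b1.
- exact: bounded_lipschitz_measurable b2.
Qed.

Lemma avg_close c C f x : standardized Z1 -> standardized Z2 ->
  smooth C f -> `|avg Z1 c f x - avg Z2 c f x| <=
  C * c ^+ 2 * (taylor_error Z1 c + taylor_error Z2 c).
Proof.
move=> s1 s2 [f1 [f2 [bf bf1 bf2 tf]]].
have := avg_expansion c x bf bf1 bf2 tf s1; have := avg_expansion c x bf bf1 bf2 tf s2; set u := _ * f2 x.
rewrite mulrDr => h2 h1.
rewrite (_ : _ - _ = (avg Z1 c f x - f x - u) - (avg Z2 c f x - f x - u)).
  by rewrite (le_trans (ler_normB _ _))// lerD.
by ring.
Qed.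

End averaging_comparison.

(** * Gaussian averaging *)

Section lebesgue_half_line.
Context {R : realType}.
Local Notation mu := (@lebesgue_measure R).

Lemma measurable_indicator_lt d (T : measurableType d) (f g : T -> R) :
  measurable_fun setT f -> measurable_fun setT g ->
  measurable_fun setT (fun t => (f t < g t)%R%:R : R).
Proof.
move=> mf mg; apply: (measurableT_comp (f := fun b : bool => b%:R : R)) => //.
exact: measurable_fun_ltr.
Qed.

Lemma measurable_indicator_le d (T : measurableType d) (f g : T -> R) :
  measurable_fun setT f -> measurable_fun setT g ->
  measurable_fun setT (fun t => (f t <= g t)%R%:R : R).
Proof.
move=> mf mg; apply: (measurableT_comp (f := fun b : bool => b%:R : R)) => //.
exact: measurable_fun_ler.
Qed.

Lemma integral_lt_indicator (z : R) : 0 <= z ->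
  (\int[mu]_(y in `[0%R, +oo[) ((y < z)%R%:R)%:E = z%:E)%E.
Proof.
move=> z0; transitivity (\int[mu]_(y in `[0%R, +oo[) (\1_(`[0%R, z[%classic) y)%:E)%E.
  apply: eq_integral => y; rewrite inE /= in_itv /= andbT => y0.
  by rewrite indicE mem_setE in_itv /= y0.
rewrite integral_indic// setIidl; last first.
  by move=> y /=; rewrite !in_itv /= => /andP[-> _].
rewrite /= lebesgue_measure_itv/= lte_fin; case: ltP => [|z0']; first by rewrite sube0.
by rewrite (@le_anti _ _ z 0)// z0 z0'.
Qed.

End lebesgue_half_line.

(** * Iterated integrals over subsets *)

Section fubini_on.
Local Open Scope ereal_scope.
Context d1 d2 (T1 : measurableType d1) (T2 : measurableType d2) (R : realType).
Variables (m1 : {sigma_finite_measure set T1 -> \bar R}).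
Variables (m2 : {sigma_finite_measure set T2 -> \bar R}).
Variables (D1 : set T1) (D2 : set T2).
Hypotheses (mD1 : measurable D1) (mD2 : measurable D2).
Implicit Types f : T1 * T2 -> \bar R.

(** Extension by zero off the rectangle, which reduces exchanges over [D1] and [D2] to the theorems
    on the whole product space. *)
Let cut f z := f z * (\1_(D1 `*` D2) z)%:E.

Let measurable_cut f : measurable_fun setT f -> measurable_fun setT (cut f).
Proof.
move=> mf; apply: emeasurable_funM => //; apply/measurable_EFinP.
by apply: measurable_indic; exact: measurableX.
Qed.

Let cutE f x y : cut f (x, y) = (((fun y => f (x, y)) \_ D2) y) * (\1_D1 x)%:E.
Proof.
rewrite /cut patchE !indicE; have -> : ((x, y) \in D1 `*` D2) = (x \in D1) && (y \in D2).
  by apply/idP/andP => [|[]]; rewrite !inE.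
by case: (y \in D2); [rewrite andbT|rewrite andbF mule0 mul0e].
Qed.

Let cut12 f : \int[m1]_x \int[m2]_y cut f (x, y) =
  \int[m1]_(x in D1) \int[m2]_(y in D2) f (x, y).
Proof.
rewrite [RHS]integral_mkcond; apply: eq_integral => x _.
under eq_integral do rewrite cutE.
rewrite patchE indicE; case: (x \in D1).
  by rewrite [RHS]integral_mkcond; apply: eq_integral => y _; rewrite mule1.
by under eq_integral do rewrite mule0; rewrite integral0.
Qed.

Let cut21 f : \int[m2]_y \int[m1]_x cut f (x, y) =
  \int[m2]_(y in D2) \int[m1]_(x in D1) f (x, y).
Proof.
rewrite [RHS]integral_mkcond; apply: eq_integral => y _.
under eq_integral do rewrite cutE.
rewrite patchE; case: ifPn => yD.
  rewrite [RHS]integral_mkcond; apply: eq_integral => x _.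
  by rewrite !patchE yD indicE; case: (x \in D1); rewrite ?mule1 ?mule0.
by under eq_integral do rewrite patchE (negbTE yD) mul0e; rewrite integral0.
Qed.

Lemma tonelli_on f : measurable_fun setT f -> (forall z, 0 <= f z) ->
  \int[m1]_(x in D1) \int[m2]_(y in D2) f (x, y) =
  \int[m2]_(y in D2) \int[m1]_(x in D1) f (x, y).
Proof.
move=> mf f0; rewrite -cut12 -cut21; apply: fubini_tonelli; first exact: measurable_cut.
by move=> z; rewrite mule_ge0.
Qed.

Lemma fubini_on f : measurable_fun setT f ->
  \int[m1]_(x in D1) \int[m2]_(y in D2) `|f (x, y)| < +oo ->
  \int[m1]_(x in D1) \int[m2]_(y in D2) f (x, y) =
  \int[m2]_(y in D2) \int[m1]_(x in D1) f (x, y).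
Proof.
move=> mf foo; rewrite -cut12 -cut21; apply: Fubini.
apply/integrable12ltyP; first exact: measurable_cut.
rewrite (_ : \int[m1]_x _ = \int[m1]_x \int[m2]_y cut (abse \o f) (x, y)).
  by rewrite cut12.
apply: eq_integral => x _; apply: eq_integral => y _.
by rewrite /cut abseM; congr (_ * _); rewrite gee0_abs.
Qed.

End fubini_on.

Section gaussian.
Context {R : realType}.
Local Notation mu := (@lebesgue_measure R).
Local Notation gamma := (normal_prob (0 : R) 1).

(* Gaussian and Stieltjes measures live on [measurableTypeR R], whereas the random
   variables of the statement take values in [R] itself. *)
Definition real_id (x : measurableTypeR R) : R := x.

Lemma measurable_real_id : measurable_fun setT real_id.
Proof. exact: measurable_id. Qed.

HB.instance Definition _ := isMeasurableFun.Build _ _ _ _ real_id measurable_real_id.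

Definition gaussian_id : {RV gamma >-> R} := real_id.

Implicit Types (f : R -> R) (a b c m s x y w : R).

(** The Radon-Nikodym derivative of the normal law agrees almost everywhere with [normal_pdf], since
    both have the same integral over every measurable set. *)
Lemma ge0_integral_normal_prob m s (f : R -> \bar R) : measurable_fun [set: R] f ->
  (forall x, 0 <= f x)%E ->
  (\int[normal_prob m s]_x f x = \int[mu]_x (f x * (normal_pdf m s x)%:E))%E.
Proof.
move=> mf f0.
have dom := normal_prob_dominates m s.
rewrite -(Radon_Nikodym_SigmaFinite.change_of_variables dom)//.
apply: ae_eq_integral => //.
- apply: emeasurable_funM => //; apply: (measurable_int mu).
  exact: Radon_Nikodym_SigmaFinite.f_integrable.
- apply: emeasurable_funM => //.
  by apply/measurable_EFinP; exact: measurable_normal_pdf.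
- apply: ae_eqe_mul2l; apply: integral_ae_eq => //.
  + exact: Radon_Nikodym_SigmaFinite.f_integrable.
  + by apply/measurable_EFinP; exact: measurable_normal_pdf.
  + by move=> E _ mE; rewrite -Radon_Nikodym_SigmaFinite.f_integral.
Qed.

Lemma normal_pdf_center x s y : s != 0 -> normal_pdf x s y = normal_pdf 0 s (y - x).
Proof. by move=> s0; rewrite !normal_pdfE// /normal_fun subr0. Qed.

(** The substitution [w = x + s * z] moves [x] from the test function to the density, where two
    successive averagings can be merged. *)
Lemma avg_gaussian f C s x : bounded_lipschitz C f -> (forall x, 0 <= f x) -> 0 < s ->
  (avg gaussian_id s f x)%:E = (\int[mu]_w (f w * normal_pdf x s w)%:E)%E.
Proof.
move=> bf f0 s0.
have mf := bounded_lipschitz_measurable bf.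
have cf := bounded_lipschitz_continuous bf.
rewrite /avg /Rintegral fineK; last first.
  by apply: integrable_fin_num => //; exact: avg_integrable bf.
have ma : measurable_fun [set: R] (fun z => f (x + s * z)).
  by apply: (measurableT_comp mf); apply: measurable_funD => //; exact: measurable_funM.
rewrite (@ge0_integral_normal_prob _ _ (fun z => (f (x + s * z))%:E)); last 2 first.
- exact/measurable_EFinP.
- by move=> z; rewrite lee_fin.
pose F (z : R) := x + s * z.
have dF (z : R) : is_derive z 1 F s.
  by apply: is_derive_eq; rewrite /GRing.scale /=; ring.
have F'E : F^`()%classic = cst s by apply/funext => z; rewrite derive1E derive_val.
rewrite (@increasing_ge0_integration_by_substitutionT _ F (fun w => f w * normal_pdf x s w)).
- apply: eq_integral => z _; rewrite -EFinM F'E /= !fctE /=; congr EFin.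
  rewrite -mulrA; congr (_ * _).
  rewrite !normal_pdfE ?gt_eqF// /normal_peak /normal_fun /F !subr0.
  rewrite (_ : x + s * z - x = s * z); last by ring.
  rewrite (_ : s ^+ 2 * pi *+ 2 = s ^+ 2 * (1 ^+ 2 * pi *+ 2)); last by rewrite expr1n mul1r mulrnAr.
  rewrite sqrtrM ?sqr_ge0// sqrtr_sqr gtr0_norm// invfM.
  rewrite (_ : - (s * z) ^+ 2 / (s ^+ 2 *+ 2) = - z ^+ 2 / (1 ^+ 2 *+ 2)); last first.
    by field; rewrite gt_eqF.
  by move: (Num.sqrt _)^-1 (expR _) => p e; field; rewrite gt_eqF.
- by move=> y z yz; rewrite /F ltrD2l ltr_pM2l.
- by rewrite F'E => ?; exact: cvg_cst.
- by rewrite F'E; exact: is_cvg_cst.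
- by rewrite F'E; exact: is_cvg_cst.
- by move=> z; exact: ex_derive.
- apply/cvgrNyPle => M; exists ((M - x) / s); split; first exact: num_real.
  by move=> z; rewrite ltr_pdivlMr// /F => h; nra.
- apply/cvgryPge => M; exists ((M - x) / s); split; first exact: num_real.
  by move=> z; rewrite ltr_pdivrMr// /F => h; nra.
- by move=> z; apply: cvgM; [exact: cf|apply: continuous_normal_pdf; rewrite gt_eqF].
- by move=> z; rewrite mulr_ge0// normal_pdf_ge0.
Qed.

(* Completing the square. *)
Lemma normal_pdf_mul a b c x y w : 0 < a -> 0 < b -> 0 < c ->
  c ^+ 2 = a ^+ 2 + b ^+ 2 ->
  normal_pdf x a y * normal_pdf y b w = normal_pdf x c w *
    normal_pdf ((b ^+ 2 * x + a ^+ 2 * w) / c ^+ 2) (a * b / c) y.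
Proof.
move=> a0 b0 c0 cE.
have [an bn cn] : [/\ a != 0, b != 0 & c != 0] by rewrite !gt_eqF.
have abc0 : a * b / c != 0 by rewrite gt_eqF// divr_gt0// mulr_gt0.
rewrite !normal_pdfE// /normal_peak /normal_fun.
rewrite mulrACA [RHS]mulrACA -!expRD -!invfM -!sqrtrM ?mulrn_wge0 ?mulr_ge0 ?sqr_ge0 ?pi_ge0 ?ltW//.
congr (_ * _).
  by congr (Num.sqrt _)^-1; field.
congr expR.
have D0 : a ^+ 2 + b ^+ 2 != 0 by rewrite -cE expf_neq0.
rewrite !expr_div_n exprMn cE.
by field; rewrite an bn D0.
Qed.

Lemma measurable_normal_pdf2 s : 0 < s ->
  measurable_fun [set: R * R] (fun z => normal_pdf z.1 s z.2).
Proof.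
move=> s0; under eq_fun do rewrite normal_pdf_center ?gt_eqF//.
apply: (measurableT_comp (measurable_normal_pdf 0 s)).
exact: measurable_funB.
Qed.

(** After Tonelli and [normal_pdf_mul], the intermediate variable occurs only in a normal density,
    which integrates to 1. *)
Lemma avg_gaussian_semigroup_ge0 f C a b c x : bounded_lipschitz C f ->
  (forall x, 0 <= f x) -> 0 < a -> 0 < b -> 0 < c -> c ^+ 2 = a ^+ 2 + b ^+ 2 ->
  avg gaussian_id a (avg gaussian_id b f) x = avg gaussian_id c f x.
Proof.
move=> bf f0 a0 b0 c0 cE; apply/EFin_inj.
have bb := avg_bounded_lipschitz gaussian_id b bf.
rewrite (avg_gaussian _ bb)//; last by move=> y; exact: Rintegral_ge0.
have -> := avg_gaussian x bf f0 c0.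
have mf := bounded_lipschitz_measurable bf.
transitivity (\int[mu]_y \int[mu]_w
    (f w * (normal_pdf x a y * normal_pdf y b w))%:E)%E.
  apply: eq_integral => y _; rewrite EFinM (avg_gaussian _ bf)// muleC.
  rewrite -ge0_integralZl//; first last.
  - by rewrite lee_fin normal_pdf_ge0.
  - by move=> w _; rewrite lee_fin mulr_ge0// normal_pdf_ge0.
  - by apply/measurable_EFinP; apply: measurable_funM => //; exact: measurable_normal_pdf.
  by apply: eq_integral => w _; rewrite -EFinM mulrCA.
rewrite (@fubini_tonelli _ _ (measurableTypeR R) (measurableTypeR R) R mu mu
  (fun z => (f z.2 * (normal_pdf x a z.1 * normal_pdf z.1 b z.2))%:E))/=; first last.
- by move=> z; rewrite lee_fin !mulr_ge0 ?normal_pdf_ge0.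
- apply/measurable_EFinP; apply: measurable_funM.
    exact: (measurableT_comp mf measurable_snd).
  apply: measurable_funM; last exact: measurable_normal_pdf2.
  exact: (measurableT_comp (measurable_normal_pdf x a) measurable_fst).
apply: eq_integral => w _.
under eq_integral do rewrite (normal_pdf_mul _ _ _ a0 b0 c0 cE) mulrA EFinM.
rewrite ge0_integralZl//; first last.
- by rewrite lee_fin mulr_ge0// normal_pdf_ge0.
- by move=> y _; rewrite lee_fin normal_pdf_ge0.
- by apply/measurable_EFinP; exact: measurable_normal_pdf.
by rewrite integral_normal_pdf mule1.
Qed.

Lemma avg_addr c C D f x : bounded_lipschitz C f ->
  avg gaussian_id c (fun y => f y + D) x = avg gaussian_id c f x + D.
Proof.
move=> bf; rewrite /avg RintegralD//; first by rewrite Rintegral_prob_cst.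
- exact: avg_integrable bf.
- exact: (@integrable_bounded _ _ _ _ _ `|D|).
Qed.

Lemma bounded_lipschitz_addr C D f : bounded_lipschitz C f ->
  bounded_lipschitz (C + `|D|) (fun y => f y + D).
Proof.
move=> [bf lf]; split=> [x|x y].
  by rewrite (le_trans (ler_normD _ _))// lerD2r.
rewrite (_ : f y + D - _ = f y - f x); last by ring.
by rewrite (le_trans (lf _ _))// ler_wpM2r// lerDl.
Qed.

Lemma avg_gaussian_semigroup f C a b c x : bounded_lipschitz C f ->
  0 < a -> 0 < b -> 0 < c -> c ^+ 2 = a ^+ 2 + b ^+ 2 ->
  avg gaussian_id a (avg gaussian_id b f) x = avg gaussian_id c f x.
Proof.
move=> bf a0 b0 c0 cE.
(* Adding the bound [C] makes [f] nonnegative, as the Tonelli argument requires; averaging commutes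
   with this shift. *)
have bg := bounded_lipschitz_addr C bf.
have g0 y : 0 <= f y + C.
  by have := bf.1 y; rewrite ler_norml => /andP[+ _]; rewrite -subr_ge0 opprK.
have := avg_gaussian_semigroup_ge0 x bg g0 a0 b0 c0 cE.
have E : avg gaussian_id b (fun y => f y + C) = (fun y => avg gaussian_id b f y + C).
  by apply/funext => y; exact: (avg_addr _ _ _ bf).
rewrite E (avg_addr _ _ _ bf).
rewrite (avg_addr _ _ _ (avg_bounded_lipschitz _ _ bf)).
by move/addIr.
Qed.

Lemma iter_avg_gaussian f C c n x : bounded_lipschitz C f -> 0 < c ->
  iter n.+1 (avg gaussian_id c) f x = avg gaussian_id (c * Num.sqrt n.+1%:R) f x.
Proof.
move=> bf c0; elim: n x => [|n IH] x; first by rewrite /= sqrtr1 mulr1.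
rewrite iterS (funext IH).
apply: (avg_gaussian_semigroup _ bf) => //; rewrite ?mulr_gt0// ?sqrtr_gt0//.
by rewrite !exprMn !sqr_sqrtr// -(natr1 n.+1); ring.
Qed.

Lemma cvg_normal_pdf0y : normal_pdf (0 : R) 1 x @[x --> +oo] --> (0 : R).
Proof.
apply: (@squeeze_cvgr _ _ _ _ (cst 0) (fun x => 2 * (normal_peak 1) / x)).
- near=> x; rewrite normal_pdf_ge0/=.
  have x0 : 0 < x by near: x; exact: nbhs_pinfty_gt.
  have x1 : 1 < x by near: x; exact: nbhs_pinfty_gt.
  rewrite normal_pdfE ?oner_neq0// mulrAC mulrC ler_wpM2r ?normal_peak_ge0//.
  rewrite /normal_fun subr0 expr1n mulNr expRN invf_ple ?posrE ?expR_gt0//; last by rewrite divr_gt0.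
  rewrite invf_div; apply: le_trans (expR_ge1Dx _).
  by rewrite expr2 -mulr_natr mul1r; nra.
- exact: cvg_cst.
- rewrite -[X in _ --> X](mulr0 (2 * normal_peak 1)); apply: cvgM; first exact: cvg_cst.
  by apply/gtr0_cvgV0; [exact: nbhs_pinfty_gt|exact: cvg_id].
Unshelve. all: by end_near. Qed.

Lemma is_derive_normal_pdf x :
  is_derive x 1 (fun y => - normal_pdf (0 : R) 1 y) (x * normal_pdf 0 1 x).
Proof.
rewrite normal_pdfE ?oner_neq0// /normal_fun.
have dg : is_derive x 1 (fun y : R => - (y - 0) ^+ 2 / (1 ^+ 2 *+ 2)) (- x).
  by apply: is_derive_eq; rewrite /GRing.scale /=; field.
have de : is_derive x 1 (fun y : R => expR (- (y - 0) ^+ 2 / (1 ^+ 2 *+ 2)))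
   (expR (- (x - 0) ^+ 2 / (1 ^+ 2 *+ 2)) * - x).
  exact: is_derive1_comp.
by apply: is_derive_eq; rewrite /GRing.scale /=; ring.
Qed.

Lemma integral_normal_pdf_tail y : 0 <= y ->
  (\int[mu]_(x in `[y, +oo[) (x * normal_pdf 0 1 x)%:E = (normal_pdf 0 1 y)%:E)%E.
Proof.
move=> y0; pose F (x : R) := - normal_pdf 0 1 x.
have cp : continuous (normal_pdf (0 : R) 1).
  by apply: continuous_normal_pdf; rewrite oner_neq0.
rewrite -(_ : \int[mu]_(x in `[y, +oo[) (Num.max x 0 * normal_pdf 0 1 x)%:E =
  \int[mu]_(x in `[y, +oo[) (x * normal_pdf 0 1 x)%:E)%E; last first.
  apply: eq_integral => x; rewrite inE /= in_itv /= andbT => yx.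
  by rewrite max_l// (le_trans y0).
rewrite (@ge0_continuous_FTC2y _ _ F y 0).
- by rewrite /F EFinN oppeK add0e.
- by move=> x xy; rewrite mulr_ge0 ?normal_pdf_ge0// le_max lexx orbT.
- apply: continuous_subspaceT => x; apply: cvgM; last exact: cp.
  by apply: (@continuous_max _ _ id (cst 0)); [exact: cvg_id|exact: cvg_cst].
- by rewrite -[X in _ --> X]oppr0; apply: cvgN; exact: cvg_normal_pdf0y.
- by move=> x _; have := is_derive_normal_pdf x => h; exact: ex_derive.
- by apply: cvg_at_right_filter; apply: cvgN; exact: cp.
- move=> x; rewrite in_itv /= andbT => yx; have := is_derive_normal_pdf x => h.
  by rewrite derive1E derive_val max_l// (le_trans y0 (ltW yx)).
Qed.

Lemma integral_half_normal_pdf :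
  (2%:E * \int[mu]_(x in `[0%R, +oo[) (normal_pdf (0 : R) 1 x)%:E = 1)%E.
Proof.
rewrite set_itvcy -ge0_symfun_integralT.
- exact: integral_normal_pdf.
- by move=> x; exact: normal_pdf_ge0.
- by apply: continuous_normal_pdf; rewrite oner_neq0.
- by move=> x; rewrite /= !normal_pdfE ?oner_neq0// /normal_fun !subr0 sqrrN.
Qed.

(** On the half-line [x ^+ 2] is [x] times the length of the interval from 0 to [x]. By Tonelli the
    half integral becomes that of the tails of [x * normal_pdf 0 1 x], and the tail beyond [y] is
    the density at [y]. *)
Lemma integral_sqr_normal_pdf :
  (\int[mu]_x (x ^+ 2 * normal_pdf (0 : R) 1 x)%:E = 1)%E.
Proof.
rewrite ge0_symfun_integralT; first last.
- by move=> x; rewrite /= !normal_pdfE ?oner_neq0// /normal_fun !subr0 !sqrrN.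
- move=> x; apply: cvgM; first exact: exprn_continuous.
  by apply: continuous_normal_pdf; rewrite oner_neq0.
- by move=> x; rewrite mulr_ge0 ?sqr_ge0 ?normal_pdf_ge0.
rewrite -integral_half_normal_pdf -set_itvcy; congr (_ * _)%E.
(* The maximum makes [h] nonnegative on the whole plane, as [tonelli_on] asks, and changes nothing
   on the quadrant. *)
pose h (z : R * R) : R := (z.2 < z.1)%R%:R * (Num.max z.1 0 * normal_pdf 0 1 z.1).
transitivity (\int[mu]_(x in `[0%R, +oo[) \int[mu]_(y in `[0%R, +oo[) (h (x, y))%:E)%E.
  apply: eq_integral => x; rewrite inE /= in_itv /= andbT => x0.
  have : 0 <= x * normal_pdf 0 1 x by rewrite mulr_ge0 ?normal_pdf_ge0.
  rewrite /h /= max_l//; under eq_integral do rewrite EFinM.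
  move=> h0; rewrite ge0_integralZr//.
  - by rewrite integral_lt_indicator// -EFinM mulrA -expr2.
  - by apply/measurable_EFinP/measurable_funTS; exact: measurable_indicator_lt.
have mh : measurable_fun setT h.
  apply: measurable_funM; first exact: measurable_indicator_lt.
  apply: (measurableT_comp (f := fun x => Num.max x 0 * normal_pdf 0 1 x)) => //.
  by apply: measurable_funM; [exact: measurable_maxr|exact: measurable_normal_pdf].
have h0 z : 0 <= h z.
  by rewrite !mulr_ge0 ?normal_pdf_ge0// le_max lexx orbT.
rewrite (@tonelli_on _ _ (measurableTypeR R) (measurableTypeR R) R mu mu _ _ _ _ (EFin \o h))//; last first.
  exact/measurable_EFinP.
apply: eq_integral => y; rewrite inE /= in_itv /= andbT => y0.
rewrite -(integral_normal_pdf_tail y0) -integral_itv_obnd_cbnd; last first.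
  apply/measurable_EFinP/measurable_funTS/measurable_funM => //.
  exact: measurable_normal_pdf.
rewrite [LHS]integral_mkcond [RHS]integral_mkcond; apply: eq_integral => x _.
rewrite !patchE !mem_setE !in_itv /= !andbT /h /=.
have [yx|xy] := ltP y x; last by rewrite mul0r; case: ifP.
have x0 : 0 <= x by rewrite (le_trans y0)// ltW.
by rewrite x0 mul1r max_l.
Qed.

Lemma integrable_gaussian_sqr : gamma.-integrable setT (fun y => (y ^+ 2)%:E).
Proof.
apply/integrableP; split; first by apply/measurable_EFinP; exact: measurable_funX.
rewrite ge0_integral_normal_prob//; last first.
  by apply/measurable_EFinP; apply: measurableT_comp => //; exact: measurable_funX.
under eq_integral do rewrite gee0_abs ?lee_fin ?sqr_ge0// -EFinM.
by rewrite integral_sqr_normal_pdf ltry.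
Qed.

(** The positive part integrates to the density at 0, and so does the negative part after a
    reflection. *)
Lemma gaussian_mean : \int[gamma]_y y = 0.
Proof.
rewrite /Rintegral integralE.
have mi : measurable_fun setT (EFin : R -> \bar R) by exact/measurable_EFinP.
rewrite !ge0_integral_normal_prob//; [|exact: measurable_funeneg|exact: measurable_funepos].
have pos : (\int[mu]_x ((EFin : R -> \bar R)^\+ x * (normal_pdf (0 : R) 1 x)%:E) = (normal_pdf (0 : R) 1 0)%:E)%E.
  rewrite -[RHS](integral_normal_pdf_tail (lexx 0)) [RHS]integral_mkcond.
  apply: eq_integral => x _; rewrite patchE mem_setE in_itv /= andbT funeposE.
  have [x0|x0] := leP 0 x; first by rewrite max_l.
  by rewrite max_r ?mul0e// lee_fin ltW.
have neg : (\int[mu]_x ((EFin : R -> \bar R)^\- x * (normal_pdf (0 : R) 1 x)%:E) = (normal_pdf (0 : R) 1 0)%:E)%E.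
  transitivity (\int[mu]_(x in `]-oo, (- 0)%R]) (Num.max (- x) 0 * normal_pdf (0 : R) 1 x)%:E)%E.
    rewrite [RHS]integral_mkcond.
    apply: eq_integral => x _; rewrite patchE mem_setE in_itv /= oppr0 funenegE.
    have [x0|x0] := leP x 0; first by rewrite !max_l// ?lee_fin oppr_ge0.
    by rewrite max_r ?mul0e// lee_fin oppr_le0 ltW.
  rewrite ge0_integration_by_substitutionNy.
  - rewrite -[RHS](integral_normal_pdf_tail (lexx 0)); apply: eq_integral => x.
    rewrite inE /= in_itv /= andbT => x0; rewrite opprK max_l// !normal_pdfE ?oner_neq0//.
    by rewrite /normal_fun !subr0 sqrrN.
  - apply: continuous_subspaceT => x; apply: cvgM; last first.
      by apply: continuous_normal_pdf; rewrite oner_neq0.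
    by apply: (@continuous_max _ _ -%R (cst 0)); [exact: opp_continuous|exact: cvg_cst].
  - by move=> x _; rewrite mulr_ge0 ?normal_pdf_ge0// le_max lexx orbT.
by rewrite pos neg subee.
Qed.

Lemma standardized_gaussian : standardized gaussian_id.
Proof.
split; [exact: integrable_gaussian_sqr|exact: gaussian_mean|].
rewrite /Rintegral ge0_integral_normal_prob//.
- by under eq_integral do rewrite -EFinM; rewrite integral_sqr_normal_pdf.
- by rewrite /gaussian_id /= /real_id; apply/measurable_EFinP; exact: measurable_funX.
- by move=> x; rewrite lee_fin sqr_ge0.
Qed.

End gaussian.

(** * Central limit theorem *)

Section independence.
Context d (T : measurableType d) (R : realType) (P : probability T R).
Variable X : nat -> {RV P >-> R}.
Hypothesis X_indep : mutually_independent X.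

(** The later variables appear factored as well, because the next step of the induction absorbs
    [X k] into [S] and still needs its independence from the rest. *)
Definition independent_of_tail (S : T -> R) (k : nat) :=
  forall (J : {fset nat}) (A : set R) (B : nat -> set R),
    (forall j, j \in J -> (k <= j)%N) -> measurable A -> (forall j, measurable (B j)) ->
    P (S @^-1` A `&` \bigcap_(j in [set` J]) X j @^-1` B j) =
    (P (S @^-1` A) * \prod_(j <- J) P (X j @^-1` B j))%E.

Lemma independent_of_tail_cst (r : R) : independent_of_tail (cst r) 0.
Proof.
move=> J A B _ mA mB; rewrite preimage_cst; case: ifPn => _.
  by rewrite setTI X_indep// (@probability_setT _ _ _ P) mul1e.
by rewrite set0I measure0 mul0e.
Qed.

(** For a fixed event [D] about the variables beyond [k], the law of [(S, X k)] restricted to [D]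
    and [P D] times that law are finite measures on the plane. They agree on rectangles, a
    generating class stable under intersection, hence on the preimage by [g] of any measurable
    set. *)
Lemma independent_of_tail_step (S : {RV P >-> R}) (k : nat) (g : R * R -> R) :
  measurable_fun setT g ->
  independent_of_tail S k -> independent_of_tail (fun t => g (S t, X k t)) k.+1.
Proof.
move=> mg Sk J A B Jk mA mB.
pose SX t := (S t, X k t).
have mSX : measurable_fun setT SX by exact: measurable_fun_pair.
pose f : {mfun T >-> (R * R)%type} := mfun_Sub (mem_set mSX).
have mf : measurable_fun setT f by exact: mSX.
pose D := \bigcap_(j in [set` J]) X j @^-1` B j.
have mD : measurable D.
  apply: fin_bigcap_measurable => [|j _]; first exact: finite_fset.
  by rewrite -[_ @^-1` _]setTI; exact: measurable_funP.
have PD : P D = (\prod_(j <- J) P (X j @^-1` B j))%E by exact: X_indep.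
have PD0 : 0 <= fine (P D) by exact: fine_ge0.
pose m1_ : {measure set (R * R) -> \bar R} := pushforward (mrestr P mD) f.
pose m1 : {measure set (R * R) -> \bar R} := m1_ mf.
pose m2 : {measure set (R * R) -> \bar R} := mscale (NngNum PD0) (distribution P f).
have m1E E : m1 E = P (f @^-1` E `&` D) by [].
have m2E E : m2 E = (P D * P (f @^-1` E))%E.
  by rewrite -[P D]fineK ?fin_num_measure.
have kJ : k \notin J by apply/negP => /Jk; rewrite ltnn.
have rect A' B' : measurable A' -> measurable B' -> m1 (A' `*` B') = m2 (A' `*` B').
  move=> mA' mB'.
  rewrite m1E m2E.
  have E : f @^-1` (A' `*` B') = S @^-1` A' `&` X k @^-1` B' by [].
  pose B'' j := if j == k then B' else B j.
  have mB'' j : measurable (B'' j) by rewrite /B''; case: ifP.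
  have BJ : \bigcap_(j in [set` J]) X j @^-1` B'' j = D.
    apply: eq_bigcapr => j jJ; rewrite /B''; case: eqP => // jk.
    by move: kJ; rewrite -jk; move: jJ => /= ->.
  have h1 : P (f @^-1` (A' `*` B') `&` D) = (P (S @^-1` A') * (P (X k @^-1` B') * P D))%E.
    have := Sk (k |` J)%fset A' B'' _ mA' mB''.
    rewrite set_fsetU1 bigcap_setU1 {1}/B'' eqxx BJ setIA -E => -> //.
      rewrite big_fsetU1//= {1}/B'' eqxx PD; congr (_ * (_ * _))%E.
      rewrite big_seq [RHS]big_seq; apply: eq_bigr => j jJ.
      by rewrite /B''; case: eqP => // jk; move: kJ; rewrite -jk jJ.
    by move=> j; rewrite in_fset1U => /orP[/eqP->//|/Jk/ltnW].
  have h2 : P (f @^-1` (A' `*` B')) = (P (S @^-1` A') * P (X k @^-1` B'))%E.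
    have := Sk [fset k]%fset A' B'' _ mA' mB''.
    rewrite set_fset1 bigcap_set1 {1}/B'' eqxx -E => -> //.
      by rewrite big_seq_fset1 {1}/B'' eqxx.
    by move=> j; rewrite in_fset1 => /eqP->.
  by rewrite h1 h2 muleA muleC.
have eqm E : measurable E -> m1 E = m2 E.
  apply: (measure_unique [set A1 `*` A2 | A1 in measurable & A2 in measurable]
      (fun=> setT)) => //.
  - exact: measurable_prod_measurableType.
  - move=> _ _ [A1 mA1 [A2 mA2 <-]] [B1 mB1 [B2 mB2 <-]].
    rewrite -setXI; exists (A1 `&` B1); first exact: measurableI.
    by exists (A2 `&` B2) => //; exact: measurableI.
  - by move=> i; exists setT => //; exists setT => //; rewrite setXTT.
  - by rewrite bigcup_const//; exists 0%N.
  - by move=> _ [A1 mA1 [A2 mA2 <-]]; exact: rect.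
  - move=> _; rewrite m1E preimage_setT setTI.
    by rewrite (le_lt_trans (probability_le1 P _)) ?ltry.
have mgA : measurable (g @^-1` A) by rewrite -[_ @^-1` _]setTI; exact: mg.
have := eqm _ mgA.
rewrite m1E m2E => ->.
by rewrite PD muleC.
Qed.

End independence.

Section iid_sums.
Context d (T : measurableType d) (R : realType) (P : probability T R).
Variables (X : nat -> {RV P >-> R}) (psi : {mfun R >-> R}).
Hypothesis X_indep : mutually_independent X.
Hypothesis X_law : forall j A, measurable A -> P (X j @^-1` A) = P (X 0%N @^-1` A).

Definition psi_of j : {RV P >-> R} := mfun_Sub (mem_set (measurableT_comp (measurable_funP psi) (measurable_funP (X j)))).

Definition psi_sum k t : R := \sum_(j < k) psi (X j t).

Lemma measurable_psi_sum k : measurable_fun setT (psi_sum k).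
Proof. by rewrite /psi_sum; apply: measurable_sum => j; exact: measurable_funP (psi_of j). Qed.

Lemma psi_sumS k t : psi_sum k.+1 t = psi_sum k t + psi (X k t).
Proof. by rewrite /psi_sum big_ord_recr. Qed.

Lemma psi_sum_independent k : independent_of_tail X (psi_sum k) k.
Proof.
elim: k => [|k IH].
  rewrite (_ : psi_sum 0 = cst 0); first exact: independent_of_tail_cst.
  by apply/funext => t; rewrite /psi_sum big_ord0.
pose S : {RV P >-> R} := mfun_Sub (mem_set (measurable_psi_sum k)).
pose g (z : R * R) : R := z.1 + psi z.2.
have mg : measurable_fun setT g.
  by apply: measurable_funD => //; exact: measurableT_comp measurable_snd.
have := @independent_of_tail_step _ _ _ P X X_indep S k g mg IH.
by rewrite (_ : psi_sum k.+1 = (fun t => g (S t, X k t)))//; apply/funext => t; exact: psi_sumS.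
Qed.

(** By independence the joint law of the partial sum and [X k] is a product. Integrating over the
    last summand first yields the averaging operator, for [X 0] since all laws coincide. *)
Lemma integral_psi_sumS k C c x (f : R -> R) : bounded_lipschitz C f ->
  \int[P]_t f (x + c * psi_sum k.+1 t) = \int[P]_t avg (psi_of 0) c f (x + c * psi_sum k t).
Proof.
move=> bf; have mf := bounded_lipschitz_measurable bf.
pose S : {mfun T >-> R} := mfun_Sub (mem_set (measurable_psi_sum k)).
have mSX : measurable_fun setT (fun t => (S t, X k t)) by exact: measurable_fun_pair.
pose SX : {mfun T >-> (R * R)%type} := mfun_Sub (mem_set mSX).
pose h (z : R * R) : R := f (x + c * (z.1 + psi z.2)).
have mh : measurable_fun setT h.
  apply: (measurableT_comp mf); apply: measurable_funD => //.
  apply: measurable_funM => //; apply: measurable_funD => //.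
  exact: measurableT_comp measurable_snd.
have bh z : `|h z| <= C by exact: bf.1.
pose lS : probability R R := distribution P S.
pose lX : probability R R := distribution P (X 0%N).
have prod E : measurable E -> (lS \x lX)%E E = distribution P SX E.
  apply: product_measure_unique => A B mA mB /=.
  have := @psi_sum_independent k [fset k]%fset A (fun=> B) _ mA (fun=> mB).
  rewrite set_fset1 bigcap_set1 big_seq_fset1 X_law// => <- //.
  by move=> j; rewrite in_fset1 => /eqP->.
rewrite /Rintegral; congr fine.
transitivity (\int[distribution P SX]_z (h z)%:E)%E.
  rewrite integral_distribution//.
  - by apply: eq_integral => t _ /=; rewrite psi_sumS.
  - exact/measurable_EFinP.
  - by apply: (@integrable_bounded _ _ _ P _ C) => //; exact: measurableT_comp.
transitivity (\int[(lS \x lX)%E]_z (h z)%:E)%E.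
  by apply: eq_measure_integral => A mA _; exact: esym (prod A mA).
rewrite -integral12_prod_meas1; last first.
  apply: measurable_bounded_integrable => //.
    have l1 : ((lS \x lX)%E setT <= 1)%E by rewrite prod//; exact: probability_le1.
    exact: le_lt_trans l1 (ltry _).
  exists C; split; first exact: num_real.
  by move=> M CM z _ /=; rewrite (le_trans (bh z))// ltW.
have Ek s : (\int[lX]_y (h (s, y))%:E)%E = (avg (psi_of 0) c f (x + c * s))%:E.
  rewrite /avg /Rintegral fineK; last by apply: integrable_fin_num => //; exact: avg_integrable bf.
  have mhs : measurable_fun setT (fun y => h (s, y)).
    exact: measurableT_comp mh (pair1_measurable _).
  rewrite integral_distribution//.
  - by apply: eq_integral => y _; rewrite /= /h /= mulrDr addrA.
  - exact/measurable_EFinP.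
  - apply: (@integrable_bounded _ _ _ P _ C) => [|y]; last exact: bf.1.
    exact: (measurableT_comp mhs).
transitivity (\int[lS]_s (avg (psi_of 0) c f (x + c * s))%:E)%E.
  by apply: eq_integral => s _; exact: Ek.
have ba := avg_bounded_lipschitz (psi_of 0) c bf.
have ma := bounded_lipschitz_measurable ba.
have mas : measurable_fun [set: R] (fun s => avg (psi_of 0) c f (x + c * s)).
  by apply: (measurableT_comp ma); apply: measurable_funD => //; exact: measurable_funM.
rewrite integral_distribution//; first exact/measurable_EFinP.
apply: (@integrable_bounded _ _ _ P (fun t => avg (psi_of 0) c f (x + c * S t)) C).
  exact: (measurableT_comp mas (measurable_funP S)).
by move=> t; exact: ba.1.
Qed.

Lemma integral_psi_sum k C c x (f : R -> R) : bounded_lipschitz C f ->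
  \int[P]_t f (x + c * psi_sum k t) = iter k (avg (psi_of 0) c) f x.
Proof.
elim: k f => [|k IH] f bf.
  transitivity (\int[P]_t f x); last exact: Rintegral_prob_cst.
  by apply: eq_Rintegral => t _; rewrite /psi_sum big_ord0 mulr0 addr0.
rewrite (integral_psi_sumS _ _ _ bf) IH ?iterSr//.
exact: avg_bounded_lipschitz.
Qed.

Local Notation gamma := (normal_prob (0 : R) 1).

Lemma cvg_sqrt_invr : (Num.sqrt n%:R)^-1 @[n --> \oo] --> (0 : R).
Proof.
apply/gtr0_cvgV0; first by exists 1%N => // n /= n0; rewrite sqrtr_gt0 ltr0n.
apply/cvgryPge => M; exists (Num.trunc (`|M| ^+ 2)).+1 => // n /= Mn.
rewrite (le_trans (ler_norm M))// -(ger0_norm (normr_ge0 M)) -sqrtr_sqr ler_sqrt//.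
by rewrite (le_trans (ltW (truncnS_gt _)))// ler_nat.
Qed.

Lemma smooth_central_limit C (f : R -> R) : standardized (psi_of 0) -> smooth C f ->
  \int[P]_t f ((Num.sqrt n%:R)^-1 * psi_sum n t) @[n --> \oo] --> \int[gamma]_y f y.
Proof.
move=> srho sf; have bf : bounded_lipschitz C f by case: sf => ? [? []].
have sgam := @standardized_gaussian R.
pose c n : R := (Num.sqrt n%:R)^-1.
have c0 : c n @[n --> \oo] --> 0 by exact: cvg_sqrt_invr.
(* This is the total cost of exchanging [n] operators: each exchange costs this quantity times
   [c n ^+ 2], and [n%:R * c n ^+ 2 = 1] for positive [n]. *)
have e0 : C * (taylor_error (psi_of 0) (c n) + taylor_error gaussian_id (c n)) @[n --> \oo] --> 0.
  rewrite -[X in _ --> X](mulr0 C) -[X in _ --> C * X]addr0.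
  apply: cvgM; first exact: cvg_cst.
  by apply: cvgD; apply: taylor_error_cvg0 => //; [case: srho|case: sgam].
apply/cvgrPdist_le => e e_gt0.
move/cvgrPdist_le : e0 => /(_ e e_gt0) [N _ HN].
exists (maxn N 1) => // -[|n]; first by rewrite /= geq_max andbF.
rewrite /= geq_max => /andP[/HN /= Hn _].
have cn : 0 < c n.+1 by rewrite invr_gt0 sqrtr_gt0.
have ncn : n.+1%:R * c n.+1 ^+ 2 = 1.
  by rewrite exprVn sqr_sqrtr// divff.
rewrite distrC; move: Hn; rewrite sub0r normrN => /(le_trans (ler_norm _)); apply: le_trans.
have -> : \int[P]_t f (c n.+1 * psi_sum n.+1 t) = iter n.+1 (avg (psi_of 0) (c n.+1)) f 0.
  by rewrite -(integral_psi_sum _ _ _ bf); under [RHS]eq_Rintegral do rewrite add0r.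
have -> : \int[gamma]_y f y = iter n.+1 (avg gaussian_id (c n.+1)) f 0.
  rewrite (iter_avg_gaussian _ _ bf)// mulVf ?gt_eqF ?sqrtr_gt0//.
  by apply: eq_Rintegral => y _; rewrite add0r mul1r.
apply: le_trans (iter_avg_close n.+1 0 (fun g y sg => avg_close _ _ srho sgam sg) sf) _.
by rewrite mulrA mulrCA ncn mulr1.
Qed.

End iid_sums.

(** * From smooth test functions to distribution functions *)

Section convergence_in_distribution.
Context d (T : measurableType d) (R : realType) (P : probability T R).
Local Notation gamma := (normal_prob (0 : R) 1).

Lemma fine_cdf (Y : {RV P >-> R}) x : fine (cdf Y x) = \int[P]_t (Y t <= x)%R%:R.
Proof.
rewrite /Rintegral; congr fine.
transitivity (\int[P]_t (\1_(Y @^-1` `]-oo, x]%classic) t)%:E)%E.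
  rewrite integral_indic// ?setIT//.
  by rewrite -[_ @^-1` _]setTI; exact: measurable_funP.
by apply: eq_integral => t _; rewrite indicE preimage_itvNyc; case: (leP (Y t) x) => Yx;
  [rewrite mem_set|rewrite memNset//= => h; move: Yx; rewrite ltNge h].
Qed.

Lemma logistic_bounds (Y : {RV P >-> R}) (g : R -> R) a e dl C :
  bounded_lipschitz C g ->
  (forall x, (x <= a - dl)%R%:R - e <= g x <= (x <= a + dl)%R%:R + e) ->
  fine (cdf Y (a - dl)) - e <= \int[P]_t g (Y t) <= fine (cdf Y (a + dl)) + e.
Proof.
move=> bg H.
have mi x : measurable_fun setT (fun t => (Y t <= x)%R%:R : R) by exact: measurable_indicator_le.
have Ii x : P.-integrable setT (EFin \o (fun t => (Y t <= x)%R%:R : R)).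
  apply: (@integrable_bounded _ _ _ P _ 1) => // t.
  by rewrite ger0_norm// lern1 leq_b1.
have Ig : P.-integrable setT (EFin \o (fun t => g (Y t))).
  apply: (@integrable_bounded _ _ _ P _ C) => [|t]; last exact: bg.1.
  exact: measurableT_comp (bounded_lipschitz_measurable bg) _.
have Ie : P.-integrable setT (EFin \o (fun _ : T => e)).
  exact: (@integrable_bounded _ _ _ P _ `|e|).
rewrite !fine_cdf -{1}(Rintegral_prob_cst P e) -{2}(Rintegral_prob_cst P e).
rewrite -RintegralB// -RintegralD//; apply/andP; split; apply: le_Rintegral => //.
- exact: (integrableB measurableT (Ii _) Ie).
- by move=> t _; have /andP[] := H (Y t).
- exact: (integrableD measurableT (Ii _) Ie).
- by move=> t _; have /andP[] := H (Y t).
Qed.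

End convergence_in_distribution.

Section normal_limit.
Context d (T : measurableType d) (R : realType) (P : probability T R).
Local Notation gamma := (normal_prob (0 : R) 1).

(** A Lipschitz test function turns closeness in mean of the variables into closeness of its
    integrals. *)
Lemma smooth_cvg_slutsky (Y W : nat -> {RV P >-> R}) (r : R^nat) C f :
  (forall n, \int[P]_t `|Y n t - W n t|%:E <= (r n)%:E)%E ->
  r n @[n --> \oo] --> 0 -> smooth C f ->
  \int[P]_t f (W n t) @[n --> \oo] --> \int[gamma]_y f y ->
  \int[P]_t f (Y n t) @[n --> \oo] --> \int[gamma]_y f y.
Proof.
move=> Hr r0 sf; have bf : bounded_lipschitz C f by case: sf => ? [? []].
have C0 : 0 <= C by apply: le_trans (bf.1 0).
have mf := bounded_lipschitz_measurable bf.
have If (Z : {RV P >-> R}) : P.-integrable setT (EFin \o (fun t => f (Z t))).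
  by apply: (@integrable_bounded _ _ _ P _ C) => [|t]; [exact: measurableT_comp|exact: bf.1].
have diff n : `|\int[P]_t f (Y n t) - \int[P]_t f (W n t)| <= C * r n.
  rewrite -RintegralB//; have ID := integrableB measurableT (If (Y n)) (If (W n)).
  apply: (le_trans (le_normr_Rintegral _ ID)) => //.
  have IYW : P.-integrable setT (EFin \o (fun t => `|Y n t - W n t|)).
    apply/integrableP; split.
      by apply/measurable_EFinP; apply: measurableT_comp => //; exact: measurable_funB.
    under eq_integral do rewrite /= normr_id.
    by rewrite (le_lt_trans (Hr n)) ?ltry.
  apply: (@le_trans _ _ (C * \int[P]_t `|Y n t - W n t|)).
    rewrite -RintegralZl//; apply: le_Rintegral => //.
    - exact: integrable_abse ID.
    - exact: (integrableZl measurableT C IYW).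
    - by move=> t _; exact: bf.2.
  rewrite ler_wpM2l// -lee_fin /Rintegral fineK//.
  exact: integrable_fin_num.
move=> HW; have -> : (fun n => \int[P]_t f (Y n t)) =
    (fun n => (\int[P]_t f (Y n t) - \int[P]_t f (W n t)) + \int[P]_t f (W n t)).
  by apply/funext => n; rewrite subrK.
rewrite -[X in _ --> X]add0r; apply: cvgD => //.
apply: norm_cvg0; apply: (@squeeze_cvgr _ _ _ _ (cst 0) (fun n => C * r n)).
- by apply: nearW => n; rewrite normr_ge0 diff.
- exact: cvg_cst.
- by rewrite -[X in _ --> X](mulr0 C); apply: cvgM => //; exact: cvg_cst.
Qed.

Lemma smooth_cvg_in_distribution (Y : nat -> {RV P >-> R}) :
  (forall C f, smooth C f ->
    \int[P]_t f (Y n t) @[n --> \oo] --> \int[gamma]_y f y) ->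
  cvg_in_distribution Y gamma.
Proof.
move=> H x cx.
pose G y : R := fine (gamma `]-oo, y]%classic).
have GE y : fine (cdf (@gaussian_id R) y) = G y by rewrite /cdf /distribution /pushforward.
have fG y : gamma `]-oo, y]%classic \is a fin_num by exact: fin_num_measure.
have cG : {for x, continuous G}.
  apply: fine_cvg; rewrite fineK//; exact: cx.
suff K : fine (cdf (Y n) x) @[n --> \oo] --> G x.
  suff L : cdf (Y n) x @[n --> \oo] --> (G x)%:E.
    by move: L; rewrite /G (fineK (fG x)).
  apply/fine_cvgP; split => //.
  by apply: nearW => n; exact: fin_num_measure.
apply/cvgrPdist_le => e e0.
(* Four errors add up on each side: two from comparing a logistic function with indicators, one from
   the convergence of its integral, one from the continuity of [G]. The logistic functions are
   centered at distance [d1] from [x], so [G] is evaluated at distance [2 * d1], less than [dl]. *)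
pose e' := e / 4.
have e'0 : 0 < e' by rewrite divr_gt0.
move/cvgrPdist_le : (cG) => /(_ e' e'0) /nbhs_normP [dl dl0 Hdl].
pose d1 : R := dl / 4.
have d10 : 0 < d1 by rewrite divr_gt0.
have [k Hk] := logistic_indicator e'0 d10.
have near_G y : `|y - x| <= 2 * d1 -> `|G x - G y| <= e'.
  move=> yx; apply: Hdl => /=; rewrite distrC (le_lt_trans yx)// /d1.
  by move: dl0 => /=; lra.
have lim a : exists N, forall n, (N <= n)%N ->
    `|\int[gamma]_y logistic k a y - \int[P]_t logistic k a (Y n t)| <= e'.
  have [C C0 sf] := logistic_smooth k a.
  by move/cvgrPdist_le : (H C _ sf) => /(_ e' e'0) [N _ HN]; exists N.
have [N1 HN1] := lim (x + d1); have [N2 HN2] := lim (x - d1).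
exists (maxn N1 N2) => // n /=; rewrite geq_max => /andP[/HN1 h1 /HN2 h2].
have [C1 _ [? [? [b1 _ _ _]]]] := logistic_smooth k (x + d1).
have [C2 _ [? [? [b2 _ _ _]]]] := logistic_smooth k (x - d1).
have /andP[u1 _] := logistic_bounds (Y n) b1 (Hk (x + d1)).
have /andP[_ u2] := logistic_bounds (@gaussian_id R) b1 (Hk (x + d1)).
have /andP[_ l1] := logistic_bounds (Y n) b2 (Hk (x - d1)).
have /andP[l2 _] := logistic_bounds (@gaussian_id R) b2 (Hk (x - d1)).
have g1 := near_G (x + d1 + d1); have g2 := near_G (x - d1 - d1).
rewrite GE in u2; rewrite GE in l2; rewrite addrK in u1; rewrite subrK in l1.
have {}g1 : `|G x - G (x + d1 + d1)| <= e'.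
  by apply: g1; rewrite (_ : _ - x = 2 * d1) ?gtr0_norm//; [rewrite mulr_gt0|ring].
have {}g2 : `|G x - G (x - d1 - d1)| <= e'.
  by apply: g2; rewrite (_ : _ - x = - (2 * d1)) ?normrN ?gtr0_norm//; [rewrite mulr_gt0|ring].
move: h1 h2 g1 g2 u1 u2 l1 l2; rewrite !ler_norml /e' /=.
set a1 := Rintegral _ _ _; set a2 := Rintegral _ _ _; set a3 := Rintegral _ _ _.
set a4 := Rintegral _ _ _; set p := fine _.
move: a1 a2 a3 a4 p (G x) (G _) (G _) => a1 a2 a3 a4 p y y1 y2; clear.
move=> /andP[? ?] /andP[? ?] /andP[? ?] /andP[? ?] ? ? ? ?.
apply/andP; split; lra.
Qed.

End normal_limit.

(** * Second-order expansion of the range weights *)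

Section range_weights.
Context {R : realType}.
Implicit Types (a b u : R) (v n c k i : nat).

(** [score] and [range_tail] are [w] and [H] of the overview; [weight F v x] is [score v (F x)]. *)
Definition score v u : R := u ^+ v.-1 - (1 - u) ^+ v.-1.

Definition range_tail v u : R := 1 - u ^+ v - (1 - u) ^+ v.

Lemma exprn_second_order k a b : 0 <= a <= 1 -> 0 <= b <= 1 ->
  `|b ^+ k - a ^+ k - k%:R * a ^+ k.-1 * (b - a)| <= k%:R ^+ 2 * (b - a) ^+ 2.
Proof.
move=> /andP[a0 a1] /andP[b0 b1]; elim: k => [|k IH].
  by rewrite !expr0 subrr !mul0r subrr normr0 expr0n /= mul0r.
(* The remainder of order [k.+1] is [b] times the one of order [k] plus a term of size at most
   [k * (b - a) ^+ 2]. The constant [k ^+ 2] survives the induction since [k ^+ 2 + k] is at most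
   the square of [k + 1]. *)
have -> : b ^+ k.+1 - a ^+ k.+1 - k.+1%:R * a ^+ k.+1.-1 * (b - a) =
    b * (b ^+ k - a ^+ k - k%:R * a ^+ k.-1 * (b - a)) + k%:R * a ^+ k.-1 * (b - a) ^+ 2.
  by case: k {IH} => [|k] /=; rewrite ?exprS ?expr0 -?(natr1 k.+1); ring.
apply: (le_trans (ler_normD _ _)); rewrite normrM (ger0_norm b0).
have h1 : b * `|b ^+ k - a ^+ k - k%:R * a ^+ k.-1 * (b - a)| <= k%:R ^+ 2 * (b - a) ^+ 2.
  by rewrite (le_trans _ IH)// ler_piMl.
have h2 : `|k%:R * a ^+ k.-1 * (b - a) ^+ 2| <= k%:R * (b - a) ^+ 2.
  rewrite ger0_norm; last by rewrite mulr_ge0 ?sqr_ge0// mulr_ge0 ?exprn_ge0.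
  by rewrite ler_wpM2r ?sqr_ge0// ler_piMr// exprn_ile1.
apply: (le_trans (lerD h1 h2)); rewrite -mulrDl ler_wpM2r ?sqr_ge0//.
by rewrite -(natr1 k); have := ler0n R k; set x := k%:R; nra.
Qed.

Lemma range_tail_second_order v a b : 0 <= a <= 1 -> 0 <= b <= 1 ->
  `|range_tail v b - range_tail v a + v%:R * score v a * (b - a)| <=
  2 * v%:R ^+ 2 * (b - a) ^+ 2.
Proof.
move=> a01 b01; have h1 := exprn_second_order v a01 b01.
have a01' : 0 <= 1 - a <= 1 by move: a01; lra.
have b01' : 0 <= 1 - b <= 1 by move: b01; lra.
have := exprn_second_order v a01' b01'.
rewrite (_ : 1 - b - (1 - a) = - (b - a)); last by ring.
rewrite sqrrN => h2; rewrite /range_tail /score.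
rewrite (_ : _ + _ = - (b ^+ v - a ^+ v - v%:R * a ^+ v.-1 * (b - a)) -
   ((1 - b) ^+ v - (1 - a) ^+ v - v%:R * (1 - a) ^+ v.-1 * - (b - a))); last by ring.
rewrite (le_trans (ler_normB _ _))// normrN (le_trans (lerD h1 h2))//.
by rewrite le_eqVlt; apply/orP; left; apply/eqP; ring.
Qed.

Lemma range_tail1 v : (0 < v)%N -> range_tail v 1 = 0.
Proof. by move=> v0; rewrite /range_tail expr1n subrr expr0n eqn0Ngt v0 subr0. Qed.

Lemma score_le1 v u : 0 <= u <= 1 -> `|score v u| <= 1.
Proof.
move=> u01; have u01' : 0 <= 1 - u <= 1 by move: u01; lra.
move/andP: u01 => [u0 u1]; move/andP: u01' => [u0' u1'].
have h1 := exprn_ge0 v.-1 u0; have h2 := exprn_ge0 v.-1 u0'.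
have h3 := exprn_ile1 v.-1 u0 u1; have h4 := exprn_ile1 v.-1 u0' u1'.
by rewrite /score ler_norml; apply/andP; split; lra.
Qed.

Lemma score_lipschitz v a b : 0 <= a <= 1 -> 0 <= b <= 1 ->
  `|score v b - score v a| <= 4 * v%:R ^+ 2 * `|b - a|.
Proof.
move=> a01 b01.
have pow_lip (x y : R) : 0 <= x <= 1 -> 0 <= y <= 1 ->
    `|y ^+ v.-1 - x ^+ v.-1| <= 2 * v%:R ^+ 2 * `|y - x|.
  move=> x01 y01; have := exprn_second_order v.-1 x01 y01.
  set r := _ - _ - _ => hr.
  have -> : y ^+ v.-1 - x ^+ v.-1 = r + v.-1%:R * x ^+ v.-1.-1 * (y - x) by rewrite /r; ring.
  have kv : v.-1%:R <= v%:R :> R by rewrite ler_nat leq_pred.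
  have k0 := ler0n R v.-1.
  have yx1 : `|y - x| <= 1 by rewrite ler_norml; move: x01 y01; lra.
  have d0 := normr_ge0 (y - x).
  have e1 : `|r| <= v%:R ^+ 2 * `|y - x|.
    apply: (le_trans hr); rewrite -(real_normK (num_real (y - x))).
    apply: ler_pM; rewrite ?sqr_ge0 ?exprn_ge0//; first by rewrite ler_sqr ?nnegrE.
    by rewrite expr2 ler_piMl.
  have e2 : `|v.-1%:R * x ^+ v.-1.-1 * (y - x)| <= v%:R ^+ 2 * `|y - x|.
    rewrite normrM ler_wpM2r// ger0_norm; last first.
      by rewrite mulr_ge0// exprn_ge0//; case/andP: x01.
    apply: (@le_trans _ _ v.-1%:R).
      by rewrite ler_piMr// exprn_ile1//; case/andP: x01.
    by rewrite -natrX ler_nat; case: (v) => //= v'; rewrite (leq_trans (leqnSn _))// leq_pmulr.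
  rewrite (le_trans (ler_normD _ _))// (le_trans (lerD e1 e2))//.
  by rewrite le_eqVlt; apply/orP; left; apply/eqP; ring.
have := pow_lip a b a01 b01.
have a01' : 0 <= 1 - a <= 1 by move: a01; lra.
have b01' : 0 <= 1 - b <= 1 by move: b01; lra.
have := pow_lip _ _ a01' b01'; rewrite (_ : 1 - b - (1 - a) = - (b - a)); last by ring.
rewrite normrN => h1 h2; rewrite /score.
rewrite (_ : _ - _ = (b ^+ v.-1 - a ^+ v.-1) - ((1 - b) ^+ v.-1 - (1 - a) ^+ v.-1)); last by ring.
rewrite (le_trans (ler_normB _ _))//.
rewrite (le_trans (lerD h2 h1))//.
by rewrite le_eqVlt; apply/orP; left; apply/eqP; ring.
Qed.

Lemma score_homo v a b : 0 <= a <= b -> b <= 1 -> score v a <= score v b.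
Proof.
move=> /andP[a0 ab] b1; rewrite /score lerB//.
  by rewrite lerXn2r// nnegrE// (le_trans a0).
by rewrite lerXn2r// ?nnegrE; lra.
Qed.

(** Expansion at 1, where [range_tail] vanishes. The factor [1 - u] gives integrability over the
    half-line; the quadratic term contributes [2 * v ^+ 2] to the constant and the linear one at
    most [v ^+ 2]. *)
Lemma range_tail_bound v u : (0 < v)%N -> 0 <= u <= 1 ->
  `|range_tail v u| <= 3 * v%:R ^+ 2 * (1 - u).
Proof.
move=> v0 u01; have := range_tail_second_order v (_ : 0 <= 1 <= 1) u01.
rewrite lexx ler01 => /(_ isT); rewrite range_tail1// subr0.
have : `|score v 1| <= 1 by apply: score_le1; rewrite lexx ler01.
have v1 : 1 <= v%:R :> R by rewrite ler1n.
move/andP: u01 => [u0 u1].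
set s := score v 1; set q := range_tail v u => hs.
have e1 : 2 * v%:R ^+ 2 * (u - 1) ^+ 2 <= 2 * v%:R ^+ 2 * (1 - u).
  by rewrite ler_wpM2l ?mulr_ge0 ?sqr_ge0//; nra.
have e2 : `|v%:R * s * (u - 1)| <= v%:R ^+ 2 * (1 - u).
  rewrite normrM distrC (ger0_norm (_ : 0 <= 1 - u)) ?subr_ge0// ler_wpM2r ?subr_ge0//.
  rewrite normrM ger0_norm// expr2 ler_wpM2l// (le_trans hs)//.
move=> /le_trans /(_ e1) e3.
have -> : q = (q + v%:R * s * (u - 1)) - v%:R * s * (u - 1) by ring.
rewrite (le_trans (ler_normB _ _))// (le_trans (lerD e3 e2))//.
by rewrite -mulrDl (_ : 2 * _ + _ = 3 * v%:R ^+ 2)//; ring.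
Qed.

(* The integrand of [N_hat] at a level [x] with exactly [c] of the [n] sample points
   at most [x]. *)
Definition empirical_tail v n c : R := v%:R / n%:R ^+ v *
  \sum_(1 <= i < n.+1) (i%:R ^+ v.-1 - (n - i)%:R ^+ v.-1) * (c < i)%N%:R.

(** The ranks above [c] form a Riemann sum of [v * score] over the cells from [c / n] to 1,
    evaluated at right endpoints, while [range_tail] telescopes over the same cells and vanishes at
    1. Each cell costs [2 * v ^+ 2 / n ^+ 2], and having only [n - c] cells produces the factor
    [1 - c / n]. *)
Lemma empirical_tail_approx v n c : (0 < v)%N -> (0 < n)%N -> (c <= n)%N ->
  `|empirical_tail v n c - range_tail v (c%:R / n%:R)| <=
  2 * v%:R ^+ 2 / n%:R * (1 - c%:R / n%:R).
Proof.
move=> v0 n0 cn.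
have n0' : 0 < n%:R :> R by rewrite ltr0n.
have nn0 : n%:R != 0 :> R by rewrite gt_eqF.
have -> : empirical_tail v n c =
    \sum_(c <= i < n) v%:R / n%:R * score v (i.+1%:R / n%:R).
  rewrite /empirical_tail (@big_cat_nat _ _ _ c.+1) ?ltnS//= big_nat big1 ?add0r; last first.
    by move=> i /andP[_ ic]; rewrite ltnNge -ltnS ic mulr0.
  rewrite big_add1 /= big_distrr /= big_nat [RHS]big_nat.
  apply: eq_bigr => i /andP[ci i_n]; rewrite ltnS ci mulr1 /score natrB// expr_div_n.
  rewrite (_ : 1 - i.+1%:R / n%:R = (n%:R - i.+1%:R) / n%:R); last by field.
  rewrite expr_div_n -(prednK v0) /= exprS; field.
  by rewrite expf_neq0.
have -> : range_tail v (c%:R / n%:R) =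
    \sum_(c <= i < n) (range_tail v (i%:R / n%:R) - range_tail v (i.+1%:R / n%:R)).
  have := telescope_sumr (fun i => - range_tail v (i%:R / n%:R)) cn.
  rewrite divff// range_tail1// oppr0 add0r opprK => <-.
  by apply: eq_bigr => i _; rewrite addrC opprK.
rewrite -sumrB; apply: (le_trans (ler_norm_sum _ _ _)).
apply: (@le_trans _ _ (\sum_(c <= i < n) 2 * v%:R ^+ 2 / n%:R ^+ 2)); last first.
  rewrite sumr_const_nat -[leLHS]mulr_natl natrB// le_eqVlt; apply/orP; left; apply/eqP.
  by field.
rewrite big_nat [leRHS]big_nat; apply: ler_sum => i /andP[_ i_n].
have i01 j : (j <= n)%N -> 0 <= (j%:R / n%:R : R) <= 1.
  by move=> jn; rewrite divr_ge0//= ler_pdivrMr// mul1r ler_nat.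
have := range_tail_second_order v (i01 _ i_n) (i01 _ (ltnW i_n)).
have -> : i%:R / n%:R - i.+1%:R / n%:R = - n%:R^-1 :> R by rewrite -natr1; field.
rewrite sqrrN exprVn distrC => h; apply: le_trans h.
by rewrite le_eqVlt; apply/orP; left; apply/eqP; congr `|_|; field.
Qed.

Lemma empirical_tail_expansion v n c u : (0 < v)%N -> (0 < n)%N -> (c <= n)%N ->
  0 <= u <= 1 ->
  `|empirical_tail v n c - range_tail v u + v%:R * score v u * (c%:R / n%:R - u)| <=
  2 * v%:R ^+ 2 * ((1 - c%:R / n%:R) / n%:R + (c%:R / n%:R - u) ^+ 2).
Proof.
move=> v0 n0 cn u01.
have n0' : 0 < n%:R :> R by rewrite ltr0n.
have c01 : 0 <= (c%:R / n%:R : R) <= 1.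
  by rewrite divr_ge0//= ler_pdivrMr// mul1r ler_nat.
have h1 := empirical_tail_approx v0 n0 cn.
have h2 := range_tail_second_order v u01 c01.
move: h1 h2; set p := c%:R / n%:R; set g := empirical_tail _ _ _ => h1 h2.
rewrite (_ : _ + _ = (g - range_tail v p) +
  (range_tail v p - range_tail v u + v%:R * score v u * (p - u))); last by ring.
rewrite (le_trans (ler_normD _ _))// (le_trans (lerD h1 h2))//.
by rewrite le_eqVlt; apply/orP; left; apply/eqP; ring.
Qed.

(** A positive lower bound of [score] on the upper quarter: [score v] is nondecreasing, vanishes at
    1/2, and is positive beyond when [v] exceeds 1. *)
Definition score_gap v : R := score v (3 / 4).

Lemma score_gap_gt0 v : (1 < v)%N -> 0 < score_gap v.
Proof.
by move=> v1; rewrite subr_gt0 ltrXn2r// ?nnegrE; [case: v v1 => [|[]]|lra..].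
Qed.

Lemma score_gap_le v u : 3 / 4 <= u -> u <= 1 -> score_gap v <= score v u.
Proof. by move=> u34 u1; apply: score_homo => //; rewrite u34 andbT; lra. Qed.

End range_weights.

(** * Distribution and influence functions *)

Section half_line_integrals.
Context {R : realType}.
Local Notation mu := (@lebesgue_measure R).
Local Notation D := (`[0%R, +oo[%classic : set R).
Implicit Types (f g : R -> R) (s : R).

Lemma Rintegral_sum d (T : measurableType d) (m : {measure set T -> \bar R})
    (A : set T) (I : Type) (r : seq I) (f : I -> T -> R) : measurable A ->
  (forall i, m.-integrable A (EFin \o f i)) ->
  m.-integrable A (EFin \o (fun x => \sum_(i <- r) f i x)) /\
  \int[m]_(x in A) (\sum_(i <- r) f i x) = \sum_(i <- r) \int[m]_(x in A) f i x.
Proof.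
move=> mA If; elim: r => [|i r [IH1 IH2]].
  rewrite (_ : (fun x => _) = cst 0); last by apply/funext => x; rewrite big_nil.
  split; first exact: integrable0.
  by rewrite big_nil /Rintegral (eq_integral (cst 0%E)) ?integral0.
rewrite (_ : (fun x => _) = (fun x => f i x + \sum_(j <- r) f j x)); last first.
  by apply/funext => x; rewrite big_cons.
split; first exact: (integrableD mA (If i) IH1).
by rewrite big_cons -IH2 -RintegralD//; apply: eq_Rintegral => x _; rewrite big_cons.
Qed.

Lemma integral_lt_indicator_max s :
  (\int[mu]_(x in D) ((x < s)%R%:R)%:E = (Num.max s 0)%:E)%E.
Proof.
have [s0|s0] := leP 0 s; first by rewrite integral_lt_indicator.
rewrite integral0_eq// => x /=; rewrite in_itv /= andbT => x0.
by rewrite ltNge (le_trans (ltW s0)).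
Qed.

Lemma integrable_lt_indicator s : mu.-integrable D (EFin \o (fun x => (x < s)%R%:R)).
Proof.
apply/integrableP; split.
  by apply/measurable_EFinP/measurable_funTS; exact: measurable_indicator_lt.
under eq_integral do rewrite /= ger0_norm//.
by rewrite integral_lt_indicator_max ltry.
Qed.

Lemma Rintegral_lt_indicator s : \int[mu]_(x in D) (x < s)%R%:R = Num.max s 0.
Proof. by rewrite /Rintegral integral_lt_indicator_max. Qed.

Lemma integrable_bounded_mul f g : measurable_fun [set: R] g ->
  (forall x, `|g x| <= 1) -> mu.-integrable D (EFin \o f) ->
  mu.-integrable D (EFin \o (fun x => g x * f x)).
Proof.
move=> mg g1 If; apply: le_integrable (If) => //.
  apply/measurable_EFinP; apply: measurable_funM; first exact: measurable_funTS.
  by apply/measurable_EFinP; exact: measurable_int If.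
by move=> x _; rewrite /= lee_fin normrM ler_piMl.
Qed.

End half_line_integrals.

Section distribution_function.
Context d (T : measurableType d) (R : realType) (P : probability T R).
Variables (X : {RV P >-> R}) (F : R -> R).
Hypothesis cdfX : forall x, cdf X x = (F x)%:E.
Local Notation mu := (@lebesgue_measure R).
Local Notation D := (`[0%R, +oo[%classic : set R).

Lemma df_ge0 x : 0 <= F x.
Proof. by rewrite -lee_fin -cdfX. Qed.

Lemma df_le1 x : F x <= 1.
Proof. by rewrite -lee_fin -cdfX cdf_le1. Qed.

Lemma df_homo x y : x <= y -> F x <= F y.
Proof. by move=> xy; rewrite -lee_fin -!cdfX cdf_nondecreasing. Qed.

Lemma df_measurable : measurable_fun [set: R] F.
Proof.
apply/measurable_EFinP; apply: (eq_measurable_fun (cdf X)) => [x _|]; first exact: cdfX.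
exact: cdf_measurable.
Qed.

Lemma Rintegral_le_indicator x : \int[P]_t (X t <= x)%R%:R = F x.
Proof. by rewrite -fine_cdf cdfX. Qed.

Lemma integrable_le_indicator x : P.-integrable setT (EFin \o (fun t => (X t <= x)%R%:R)).
Proof.
apply: (@integrable_bounded _ _ _ P _ 1); first exact: measurable_indicator_le.
by move=> t; rewrite ger0_norm// lern1 leq_b1.
Qed.

Lemma integral_gt_indicator x : (\int[P]_t ((x < X t)%R%:R)%:E = (1 - F x)%:E)%E.
Proof.
transitivity (\int[P]_t (1 - (X t <= x)%R%:R)%:E)%E.
  by apply: eq_integral => t _; rewrite ltNge; case: leP; rewrite ?subrr ?subr0.
have I1 : P.-integrable setT (EFin \o (fun _ : T => 1 : R)).
  by apply: (@integrable_bounded _ _ _ P _ 1) => // t; rewrite normr1.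
rewrite -[LHS]fineK; last first.
  apply: integrable_fin_num => //.
  exact: (integrableB measurableT I1 (integrable_le_indicator x)).
congr EFin; have := RintegralB measurableT I1 (integrable_le_indicator x).
by rewrite /= Rintegral_prob_cst Rintegral_le_indicator.
Qed.

Lemma integral_df_tail :
  (\int[mu]_(x in D) (1 - F x)%:E = \int[P]_t (Num.max (X t) 0)%:E)%E.
Proof.
transitivity (\int[P]_(t in setT) \int[mu]_(x in D) ((x < X t)%R%:R)%:E)%E; last first.
  by apply: eq_integral => t _; rewrite integral_lt_indicator_max.
rewrite (@tonelli_on _ _ T (measurableTypeR R) R P mu setT D _ _
  (fun z => ((z.2 < X z.1)%R%:R)%:E))//.
  by apply: eq_integral => x _; rewrite integral_gt_indicator.
apply/measurable_EFinP; apply: measurable_indicator_lt => //.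
exact: measurableT_comp measurable_fst.
Qed.

End distribution_function.

Section influence.
Context {R : realType}.
Variables (F : R -> R) (v : nat).
Hypotheses (F0 : forall x, 0 <= F x) (F1 : forall x, F x <= 1).
Hypothesis mF : measurable_fun [set: R] F.
Local Notation mu := (@lebesgue_measure R).
Local Notation D := (`[0%R, +oo[%classic : set R).
Hypothesis IF : mu.-integrable D (EFin \o (fun x => 1 - F x)).
Implicit Types s : R.

(** The function [psi] of the overview; [1 - F x] is the probability that an observation exceeds
    [x], so the kernel is centered level by level. *)
Definition influence s : R :=
  v%:R * \int[mu]_(x in D) (score v (F x) * ((x < s)%R%:R - (1 - F x))).

Lemma measurable_score : measurable_fun [set: R] (fun x => score v (F x)).
Proof.
apply: measurable_funB; apply: measurable_funX => //.
exact: measurable_funB.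
Qed.

Lemma score_df_le1 x : `|score v (F x)| <= 1.
Proof. by apply: score_le1; rewrite F0 F1. Qed.

Lemma integrable_centered_indicator s :
  mu.-integrable D (EFin \o (fun x => (x < s)%R%:R - (1 - F x))).
Proof. exact: (integrableB _ (integrable_lt_indicator s) IF). Qed.

Lemma integrable_influence s : mu.-integrable D
  (EFin \o (fun x => score v (F x) * ((x < s)%R%:R - (1 - F x)))).
Proof.
apply: integrable_bounded_mul; [exact: measurable_score|exact: score_df_le1|].
exact: integrable_centered_indicator.
Qed.

Lemma influenceB s s' : influence s' - influence s =
  v%:R * \int[mu]_(x in D) (score v (F x) * ((x < s')%R%:R - (x < s)%R%:R)).
Proof.
rewrite /influence -mulrBr -RintegralB//; try exact: integrable_influence.
by congr (_ * _); apply: eq_Rintegral => x _; ring.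
Qed.

Lemma integrable_indicatorB s s' :
  mu.-integrable D (EFin \o (fun x => (x < s')%R%:R - (x < s)%R%:R)).
Proof. exact: (integrableB _ (integrable_lt_indicator s') (integrable_lt_indicator s)). Qed.

(** The increment is [v] times an integral of [score], of absolute value at most 1, over the levels
    between [s] and [s']. The resulting continuity provides measurability. *)
Lemma influence_lipschitz s s' : `|influence s' - influence s| <= v%:R * `|s' - s|.
Proof.
wlog ss' : s s' / s <= s'.
  by move=> H; have [/H//|/ltW/H] := leP s s'; rewrite distrC (distrC s).
have I1 := integrable_indicatorB s s'.
have I2 : mu.-integrable D
    (EFin \o (fun x => score v (F x) * ((x < s')%R%:R - (x < s)%R%:R))).
  by apply: integrable_bounded_mul => //; [exact: measurable_score|exact: score_df_le1].
rewrite influenceB normrM ger0_norm// ler_wpM2l//.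
apply: (le_trans (le_normr_Rintegral _ I2)) => //.
apply: (@le_trans _ _ (\int[mu]_(x in D) ((x < s')%R%:R - (x < s)%R%:R))).
  apply: le_Rintegral => //; first exact: integrable_abse I2.
  move=> x _; have p0 : 0 <= (x < s')%R%:R - (x < s)%R%:R :> R.
    by rewrite subr_ge0 ler_nat; case: (ltP x s) => // xs; rewrite (lt_le_trans xs).
  by rewrite normrM (ger0_norm p0) ler_piMl ?score_df_le1.
rewrite RintegralB//; try exact: integrable_lt_indicator.
rewrite !Rintegral_lt_indicator ger0_norm ?subr_ge0//.
by rewrite !maxEle; do 2 case: ifP => ?; lra.
Qed.

Lemma measurable_influence : measurable_fun [set: R] influence.
Proof.
apply: continuous_measurable_fun => x; apply/cvgrPdist_le => e e0.
have v1 : 0 < v%:R + 1 :> R by rewrite ltr_wpDl.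
apply/nbhs_normP; exists (e / (v%:R + 1)); first by rewrite /= divr_gt0.
move=> y /= xy; rewrite distrC (le_trans (influence_lipschitz _ _))//.
apply: (@le_trans _ _ ((v%:R + 1) * `|y - x|)); first by rewrite ler_wpM2r// lerDl.
by rewrite mulrC -ler_pdivlMr// distrC ltW.
Qed.

End influence.

(** * Linearization of the estimator *)

Section linearization.
Context d (T : measurableType d) (R : realType) (P : probability T R).
Variables (X : nat -> {RV P >-> R}) (F : R -> R) (v : nat).
Hypothesis X_indep : mutually_independent X.
Hypothesis cdfX : forall j x, cdf (X j) x = (F x)%:E.
Hypothesis v_gt0 : (0 < v)%N.
Local Notation mu := (@lebesgue_measure R).
Local Notation D := (`[0%R, +oo[%classic : set R).
Hypothesis IF : mu.-integrable D (EFin \o (fun x => 1 - F x)).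

Let F0 x : 0 <= F x. Proof. exact: df_ge0 (cdfX 0) x. Qed.
Let F1 x : F x <= 1. Proof. exact: df_le1 (cdfX 0) x. Qed.
Let mF : measurable_fun [set: R] F. Proof. exact: df_measurable (cdfX 0). Qed.
Let mD : measurable (D : set (measurableTypeR R)). Proof. exact: measurable_itv. Qed.

Definition sample_count n t x : nat :=
  count (fun y => (y <= x)%R) [seq X j t | j <- iota 0 n].

Lemma sample_countE n t x :
  (sample_count n t x)%:R = \sum_(j < n) (X j t <= x)%R%:R :> R.
Proof.
rewrite /sample_count -sum1_count big_map natr_sum big_mkcond /=.
rewrite -(big_mkord xpredT (fun j => (X j t <= x)%R%:R)) /index_iota subn0.
by apply: eq_bigr => j _; case: ifP.
Qed.

Lemma sample_count_le n t x : (sample_count n t x <= n)%N.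
Proof. by rewrite (leq_trans (count_size _ _))// size_map size_iota. Qed.

Lemma lt_order_statistic n i t x : (0 < i <= n)%N ->
  (x < order_statistic X n i t) = (sample_count n t x < i)%N.
Proof.
move=> /andP[i0 i_n]; rewrite ltNge nth_sort_le ?size_map ?size_iota ?prednK//.
by rewrite -ltnNge.
Qed.

Lemma order_statistic_ge0 n i t : (0 < i <= n)%N ->
  (forall j, (j < n)%N -> 0 <= X j t) -> 0 <= order_statistic X n i t.
Proof.
move=> /andP[i0 i_n] X0; rewrite /order_statistic.
have : nth 0 (sort <=%O [seq X j t | j <- iota 0 n]) i.-1 \in [seq X j t | j <- iota 0 n].
  by rewrite -(mem_sort <=%O); apply: mem_nth; rewrite size_sort size_map size_iota prednK.
by move/mapP => [j]; rewrite mem_iota add0n => /andP[_ /X0] + ->.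
Qed.

Lemma N_hat_integral n t : (forall j, (j < n)%N -> 0 <= X j t) ->
  mu.-integrable D (EFin \o (fun x => empirical_tail v n (sample_count n t x))) /\
  N_hat X v n t = \int[mu]_(x in D) empirical_tail v n (sample_count n t x).
Proof.
move=> X0.
pose U i : R := i%:R ^+ v.-1 - (n - i)%:R ^+ v.-1.
pose f i x : R := U i * (x < order_statistic X n i t)%R%:R.
have If i : mu.-integrable D (EFin \o f i).
  exact: (integrableZl _ (U i) (integrable_lt_indicator (order_statistic X n i t))).
have [IS SE] := Rintegral_sum (index_iota 1 n.+1) mD If.
have eE x : empirical_tail v n (sample_count n t x) =
    v%:R / n%:R ^+ v * \sum_(1 <= i < n.+1) f i x.
  rewrite /empirical_tail big_nat [in RHS]big_nat; congr (_ * _).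
  by apply: eq_bigr => i i_n; rewrite /f lt_order_statistic.
have eEF : (EFin \o (fun x => empirical_tail v n (sample_count n t x))) =
    (EFin \o (fun x => v%:R / n%:R ^+ v * \sum_(1 <= i < n.+1) f i x)).
  by apply/funext => x; rewrite /= eE.
split; first by rewrite eEF; exact: (integrableZl _ (v%:R / n%:R ^+ v) IS).
transitivity (\int[mu]_(x in D) (v%:R / n%:R ^+ v * \sum_(1 <= i < n.+1) f i x)); last first.
  by apply: eq_Rintegral => x _; rewrite eE.
rewrite RintegralZl// SE /N_hat; congr (_ * _); rewrite big_nat [RHS]big_nat.
apply: eq_bigr => i i_n; rewrite RintegralZl//; last exact: integrable_lt_indicator.
by rewrite Rintegral_lt_indicator max_l// order_statistic_ge0.
Qed.

Definition range_mean : R := \int[mu]_(x in D) range_tail v (F x).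

Lemma measurable_range_tail : measurable_fun [set: R] (fun x => range_tail v (F x)).
Proof.
apply: measurable_funB; last by apply: measurable_funX; exact: measurable_funB.
by apply: measurable_funB => //; exact: measurable_funX.
Qed.

Lemma integrable_range_tail : mu.-integrable D (EFin \o (fun x => range_tail v (F x))).
Proof.
apply: le_integrable (integrableZl _ (3 * v%:R ^+ 2) IF) => //.
  by apply/measurable_EFinP/measurable_funTS; exact: measurable_range_tail.
move=> x _ /=; rewrite lee_fin (le_trans (range_tail_bound v_gt0 _)) ?F0 ?F1//.
exact: ler_norm.
Qed.

Definition linear_part n t : R := n%:R^-1 * \sum_(j < n) influence F v (X j t).

(** The linear term carries a plus sign because the derivative of [range_tail] is minus [v * score];
    [influence] is written with [x < s] instead of [s <= x], which reverses that sign. *)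
Definition remainder_density n t x : R := empirical_tail v n (sample_count n t x) -
  range_tail v (F x) + v%:R * score v (F x) * ((sample_count n t x)%:R / n%:R - F x).

Lemma linearization n t : (0 < n)%N -> (forall j, (j < n)%N -> 0 <= X j t) ->
  N_hat X v n t - range_mean - linear_part n t =
  \int[mu]_(x in D) remainder_density n t x.
Proof.
move=> n0 X0; have [I1 ->] := N_hat_integral X0.
have nn : n%:R != 0 :> R by rewrite pnatr_eq0 -lt0n.
have I2 := integrable_range_tail.
have I12 : mu.-integrable D
    (EFin \o (fun x => empirical_tail v n (sample_count n t x) - range_tail v (F x))).
  exact: (integrableB _ I1 I2).
pose f (j : 'I_n) x : R := score v (F x) * ((x < X j t)%R%:R - (1 - F x)).
have If j : mu.-integrable D (EFin \o f j) by exact: integrable_influence.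
have [IS SE] := Rintegral_sum (index_enum 'I_n) mD If.
have IZ : mu.-integrable D (EFin \o (fun x => (v%:R / n%:R) * \sum_(j < n) f j x)).
  exact: (integrableZl _ (v%:R / n%:R) IS).
have -> : linear_part n t = \int[mu]_(x in D) ((v%:R / n%:R) * \sum_(j < n) f j x).
  rewrite RintegralZl// SE /linear_part /influence -mulr_sumr; ring.
rewrite /range_mean -RintegralB// -RintegralB//.
apply: eq_Rintegral => x _; rewrite /remainder_density sample_countE /f -mulr_sumr.
have -> : \sum_(j < n) ((x < X j t)%R%:R - (1 - F x)) =
    - (\sum_(j < n) (X j t <= x)%R%:R - n%:R * F x) :> R.
  have -> : n%:R * F x = \sum_(j < n) F x by rewrite sumr_const card_ord mulr_natl.
  rewrite -sumrB -sumrN.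
  by apply: eq_bigr => j _; rewrite ltNge; case: leP => _ /=; ring.
by field.
Qed.

Lemma Rintegral_indicatorM i j x :
  \int[P]_t ((X i t <= x)%R%:R * (X j t <= x)%R%:R) = if i == j then F x else F x ^+ 2.
Proof.
pose A := `]-oo, x]%classic : set R.
have mA : measurable A by exact: measurable_itv.
case: eqVneq => [->|ij].
  rewrite -(Rintegral_le_indicator (cdfX j)); apply: eq_Rintegral => t _.
  by case: leP; rewrite ?mulr0 ?mulr1.
have := @X_indep [fset i; j]%fset (fun=> A) (fun=> mA).
rewrite set_fsetU !set_fset1 bigcap_setU !bigcap_set1.
rewrite big_fsetU1 ?inE//= big_seq_fset1.
have cA k : P (X k @^-1` A) = (F x)%:E by rewrite -(cdfX k).
rewrite !cA => PA.
have mX k : measurable (X k @^-1` A) by rewrite -[_ @^-1` _]setTI; exact: measurable_funP.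
transitivity (fine (P (X i @^-1` A `&` X j @^-1` A))); last by rewrite PA.
rewrite /Rintegral; congr fine.
transitivity (\int[P]_t (\1_(X i @^-1` A `&` X j @^-1` A) t)%:E)%E; last first.
  by rewrite integral_indic// ?setIT//; exact: measurableI.
apply: eq_integral => t _; rewrite indicE in_setI -natrM mulnb; congr (_%:R%:E).
have inA k : (X k t <= x) = (t \in X k @^-1` A).
  by apply/idP/idP; rewrite inE /A /= in_itv.
by rewrite !inA.
Qed.

Definition empirical_df n t x : R := (sample_count n t x)%:R / n%:R.

Lemma empirical_dfE n t x :
  empirical_df n t x = \sum_(j < n) n%:R^-1 * (X j t <= x)%R%:R.
Proof. by rewrite /empirical_df sample_countE mulrC mulr_sumr. Qed.

Lemma measurable_empirical_df n x : measurable_fun setT (empirical_df n ^~ x).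
Proof.
under eq_fun do rewrite empirical_dfE; apply: measurable_sum => j.
by apply: measurable_funM => //; exact: measurable_indicator_le.
Qed.

Lemma empirical_df_01 n t x : 0 <= empirical_df n t x <= 1.
Proof.
rewrite /empirical_df divr_ge0//=; case: n => [|n]; first by rewrite invr0 mulr0.
by rewrite ler_pdivrMr// mul1r ler_nat sample_count_le.
Qed.

Lemma empirical_df_mean n x : (0 < n)%N -> \int[P]_t empirical_df n t x = F x.
Proof.
move=> n0; under eq_Rintegral do rewrite empirical_dfE.
have I1 (j : 'I_n) : P.-integrable setT
    (EFin \o (fun t => n%:R^-1 * (X j t <= x)%R%:R)).
  exact: (integrableZl measurableT n%:R^-1 (integrable_le_indicator (X j) x)).
have [_ ->] := Rintegral_sum (index_enum 'I_n) measurableT I1.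
rewrite (eq_bigr (fun=> n%:R^-1 * F x)) => [|j _]; last first.
  rewrite RintegralZl//; last exact: integrable_le_indicator.
  by rewrite (Rintegral_le_indicator (cdfX j)).
by rewrite sumr_const card_ord -[_ * F x *+ n]mulr_natl mulrA divff ?mul1r// pnatr_eq0 -lt0n.
Qed.

(** In the double sum for the square, distinct indices are uncorrelated, and each of the [n]
    diagonal pairs contributes [F x * (1 - F x) / n ^+ 2]. *)
Lemma empirical_df_variance n x : (0 < n)%N ->
  \int[P]_t (empirical_df n t x - F x) ^+ 2 = F x * (1 - F x) / n%:R.
Proof.
move=> n0; have nn : n%:R != 0 :> R by rewrite pnatr_eq0 -lt0n.
pose e (j : 'I_n) t : R := (X j t <= x)%R%:R.
pose f (p : 'I_n * 'I_n) t : R := n%:R^-1 ^+ 2 *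
  (e p.1 t * e p.2 t - F x * e p.1 t - F x * e p.2 t + F x ^+ 2).
have Ie j : P.-integrable setT (EFin \o e j) by exact: integrable_le_indicator.
have Iee p : P.-integrable setT (EFin \o (fun t => e p.1 t * e p.2 t)).
  apply: (@integrable_bounded _ _ _ P _ 1).
    by apply: measurable_funM; exact: measurable_indicator_le.
  by move=> t; rewrite ger0_norm ?mulr_ge0// -natrM lern1 mulnb leq_b1.
have IFe j : P.-integrable setT (EFin \o (fun t => F x * e j t)).
  exact: (integrableZl measurableT (F x) (Ie j)).
have Ic : P.-integrable setT (EFin \o (fun _ : T => F x ^+ 2)).
  exact: (@integrable_bounded _ _ _ P _ `|F x ^+ 2|).
have Ia p : P.-integrable setT (EFin \o (fun t => e p.1 t * e p.2 t - F x * e p.1 t)).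
  exact: (integrableB measurableT (Iee p) (IFe _)).
have Ib p : P.-integrable setT
    (EFin \o (fun t => e p.1 t * e p.2 t - F x * e p.1 t - F x * e p.2 t)).
  exact: (integrableB measurableT (Ia p) (IFe _)).
have Id p : P.-integrable setT (EFin \o
    (fun t => e p.1 t * e p.2 t - F x * e p.1 t - F x * e p.2 t + F x ^+ 2)).
  exact: (integrableD measurableT (Ib p) Ic).
have If p : P.-integrable setT (EFin \o f p).
  exact: (integrableZl measurableT (n%:R^-1 ^+ 2) (Id p)).
have EF (j : 'I_n) : \int[P]_t (F x * e j t) = F x * F x.
  by rewrite RintegralZl// (Rintegral_le_indicator (cdfX j)).
have fE p : \int[P]_t f p t = n%:R^-1 ^+ 2 * (if p.1 == p.2 then F x * (1 - F x) else 0).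
  rewrite RintegralZl// RintegralD// RintegralB// RintegralB// !EF.
  rewrite Rintegral_prob_cst Rintegral_indicatorM.
  by rewrite (inj_eq val_inj); case: eqP => _; congr (_ * _); ring.
have [_ SE] := Rintegral_sum (index_enum ('I_n * 'I_n)%type) measurableT If.
transitivity (\int[P]_t \sum_p f p t).
  apply: eq_Rintegral => t _; rewrite empirical_dfE.
  have -> : \sum_(j < n) n%:R^-1 * (X j t <= x)%R%:R - F x =
      \sum_(j < n) n%:R^-1 * (e j t - F x).
    rewrite -[RHS]mulr_sumr sumrB sumr_const card_ord -[F x *+ n]mulr_natl.
    by rewrite mulrBr mulKf// -mulr_sumr.
  rewrite expr2 big_distrlr /= pair_bigA /=; apply: eq_bigr => p _.
  by rewrite /f; ring.
rewrite SE; under eq_bigr do rewrite fE.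
rewrite -(pair_bigA _ (fun i j : 'I_n => n%:R^-1 ^+ 2 * (if i == j then F x * (1 - F x) else 0))) /=.
rewrite (eq_bigr (fun=> n%:R^-1 ^+ 2 * (F x * (1 - F x)))) => [|i _]; last first.
  rewrite (bigD1 i)//= eqxx big1 ?addr0// => j /negbTE ji.
  by rewrite eq_sym ji mulr0.
rewrite sumr_const card_ord -mulr_natl; field.
by [].
Qed.

Lemma measurable_sample_count_pair n : measurable_fun [set: T * measurableTypeR R]
  (fun z => empirical_df n z.1 z.2).
Proof.
under eq_fun do rewrite empirical_dfE; apply: measurable_sum => j.
apply: measurable_funM => //; apply: measurable_indicator_le => //.
exact: measurableT_comp measurable_fst.
Qed.

(** Tonelli takes the mean at each level first. The discretization error has mean [(1 - F x) / n],
    the squared deviation [F x * (1 - F x) / n], which is no larger; with the prefactor [2 * v ^+ 2]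
    this gives 4. *)
Lemma remainder_expectation n : (0 < n)%N ->
  {ae P, forall t, forall j, 0 <= X j t} ->
  (\int[P]_t `|N_hat X v n t - range_mean - linear_part n t|%:E <=
   (4 * v%:R ^+ 2 / n%:R * \int[mu]_(x in D) (1 - F x))%:E)%E.
Proof.
move=> n0 X0; have n0' : 0 < n%:R :> R by rewrite ltr0n.
have n1 : 0 <= n%:R^-1 :> R by rewrite invr_ge0.
pose b t x : R := 2 * v%:R ^+ 2 *
  ((1 - empirical_df n t x) / n%:R + (empirical_df n t x - F x) ^+ 2).
have v2 : 0 <= 2 * v%:R ^+ 2 :> R by rewrite mulr_ge0 ?sqr_ge0.
have b0 t x : 0 <= b t x.
  have /andP[e0 e1] := empirical_df_01 n t x.
  by rewrite mulr_ge0// addr_ge0 ?sqr_ge0// divr_ge0// subr_ge0.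
have mb : measurable_fun [set: T * measurableTypeR R] (fun z => b z.1 z.2).
  have me := measurable_sample_count_pair n.
  apply: measurable_funM => //; apply: measurable_funD.
    by apply: measurable_funM => //; exact: measurable_funB.
  apply: measurable_funX; apply: measurable_funB => //.
  exact: (measurableT_comp mF measurable_snd).
have mlin : measurable_fun setT (linear_part n).
  apply: measurable_funM => //; apply: measurable_sum => j.
  have mi := measurable_influence v F0 F1 mF IF.
  exact: (measurableT_comp mi (measurable_funP (X j))).
apply: (@le_trans _ _ (\int[P]_t \int[mu]_(x in D) (b t x)%:E)%E).
  apply: ae_ge0_le_integral => //.
  - apply/measurable_EFinP; apply: measurableT_comp => //; apply: measurable_funB => //.
    by apply: measurable_funB => //; exact: measurable_N_hat.
  - by move=> t _; apply: integral_ge0 => x _; rewrite lee_fin.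
  - pose bD (z : T * measurableTypeR R) := ((b z.1 z.2)%:E * (\1_D z.2)%:E)%E.
    rewrite (_ : (fun t => _) = (fun t => \int[mu]_x bD (t, x))%E).
      apply: (measurable_fun_fubini_tonelli_F bD) => //.
        apply: emeasurable_funM; first exact/measurable_EFinP.
        apply/measurable_EFinP; apply: (measurableT_comp (f := \1_D : R -> R)) => //.
      by move=> z; rewrite mule_ge0// lee_fin.
    apply/funext => t; rewrite integral_mkcond; apply: eq_integral => x _.
    by rewrite patchE /bD /= indicE; case: ifP; rewrite ?mule1 ?mule0.
  - apply: filterS X0 => t X0 _.
    rewrite linearization//.
    have mr : measurable_fun D (remainder_density n t).
      have [I1 _] := @N_hat_integral n t (fun j _ => X0 j).
      apply: measurable_funD.
        apply: measurable_funB; last by apply: measurable_funTS; exact: measurable_range_tail.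
        by apply/measurable_EFinP; exact: measurable_int I1.
      apply: measurable_funTS; apply: measurable_funM.
        by apply: measurable_funM => //; exact: measurable_score.
      apply: measurable_funB => //.
      under eq_fun do rewrite -/(empirical_df n t _) empirical_dfE.
      apply: measurable_sum => j; apply: measurable_funM => //.
      exact: measurable_indicator_le.
    have le_b x : `|remainder_density n t x| <= b t x.
      apply: empirical_tail_expansion => //; first exact: sample_count_le.
      by rewrite F0 F1.
    (* [fine] sends infinite values to 0, so the real integral is dominated by the extended one in
       every case. *)
    apply: (@le_trans _ _ (`|\int[mu]_(x in D) (remainder_density n t x)%:E|)%E).
      rewrite /Rintegral; case: (\int[mu]_(x in D) _)%E => [r||] //=.
      + by rewrite normr0 leey.
      + by rewrite normr0 leey.
    apply: (le_trans (le_abse_integral _ _ _)) => //; first exact/measurable_EFinP.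
    apply: ge0_le_integral => //.
    + by apply/measurable_EFinP; apply: measurableT_comp.
    + apply/measurable_EFinP/measurable_funTS.
      exact: (measurableT_comp mb (pair1_measurable t)).
    + by move=> x _; rewrite /= lee_fin.
rewrite (@tonelli_on _ _ T (measurableTypeR R) R P mu setT D _ _
  (fun z => (b z.1 z.2)%:E))//; [|exact/measurable_EFinP|by move=> z; rewrite lee_fin].
have bE x : (\int[P]_t (b t x)%:E <= (4 * v%:R ^+ 2 / n%:R * (1 - F x))%:E)%E.
  have me := measurable_empirical_df n x.
  have I1 : P.-integrable setT (EFin \o (fun t => (1 - empirical_df n t x) / n%:R)).
    apply: (@integrable_bounded _ _ _ P _ n%:R^-1).
      by apply: measurable_funM => //; exact: measurable_funB.
    move=> t; have /andP[e0 e1] := empirical_df_01 n t x.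
    by rewrite normrM (ger0_norm n1) ler_piMl// ger0_norm; lra.
  have I2 : P.-integrable setT (EFin \o (fun t => (empirical_df n t x - F x) ^+ 2)).
    apply: (@integrable_bounded _ _ _ P _ 1).
      by apply: measurable_funX; exact: measurable_funB.
    move=> t; have /andP[e0 e1] := empirical_df_01 n t x; have := F0 x; have := F1 x => f1 f0.
    by rewrite normrX exprn_ile1// ler_norml; apply/andP; split; lra.
  have I12 : P.-integrable setT (EFin \o
      (fun t => (1 - empirical_df n t x) / n%:R + (empirical_df n t x - F x) ^+ 2)).
    exact: (integrableD measurableT I1 I2).
  have Ib : P.-integrable setT (EFin \o (fun t => b t x)).
    exact: (integrableZl measurableT (2 * v%:R ^+ 2) I12).
  have Ie : P.-integrable setT (EFin \o (fun t => empirical_df n t x)).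
    apply: (@integrable_bounded _ _ _ P _ 1) => // t.
    by have /andP[e0 e1] := empirical_df_01 n t x; rewrite ger0_norm.
  have Ic : P.-integrable setT (EFin \o (fun _ : T => 1 : R)).
    by apply: (@integrable_bounded _ _ _ P _ 1) => // t; rewrite normr1.
  rewrite -[leLHS]fineK; last by apply: integrable_fin_num.
  rewrite lee_fin -/(Rintegral P setT (fun t => b t x)) RintegralZl// RintegralD//.
  rewrite empirical_df_variance//.
  rewrite RintegralZr//; last exact: (integrableB measurableT Ic Ie).
  rewrite RintegralB// Rintegral_prob_cst empirical_df_mean//.
  have := F0 x; have := F1 x => f1 f0.
  have -> : 4 * v%:R ^+ 2 / n%:R * (1 - F x) =
    2 * v%:R ^+ 2 * (2 * (1 - F x) / n%:R) by ring.
  rewrite ler_wpM2l// -mulrDl ler_wpM2r//; nra.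
apply: (@le_trans _ _ (\int[mu]_(x in D) (4 * v%:R ^+ 2 / n%:R * (1 - F x))%:E)%E).
  apply: ge0_le_integral => //.
  - by move=> x _; apply: integral_ge0 => t _; rewrite lee_fin.
  - apply: measurable_funTS.
    apply: (measurable_fun_fubini_tonelli_G (fun z : T * measurableTypeR R => (b z.1 z.2)%:E)) => //.
      exact/measurable_EFinP.
    by move=> z; rewrite lee_fin.
  - apply/measurable_EFinP/measurable_funTS; apply: measurable_funM => //.
    exact: measurable_funB.
  - by move=> x _; exact: bE.
have IZ : mu.-integrable D (EFin \o (fun x => 4 * v%:R ^+ 2 / n%:R * (1 - F x))).
  exact: (integrableZl _ (4 * v%:R ^+ 2 / n%:R) IF).
rewrite -RintegralZl// /Rintegral fineK//; exact: integrable_fin_num.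
Qed.

End linearization.

(** * Variance of the influence function *)

Section parametric_integral.
Context d (T : measurableType d) (R : realType).
Local Notation mu := (@lebesgue_measure R).
Local Notation D := (`[0%R, +oo[%classic : set R).

Lemma ge0_measurable_parametric (f : T * measurableTypeR R -> \bar R) :
  measurable_fun setT f -> (forall z, 0 <= f z)%E ->
  measurable_fun setT (fun t => \int[mu]_(x in D) f (t, x))%E.
Proof.
move=> mf f0.
pose fD (z : T * measurableTypeR R) := (f z * (\1_D z.2)%:E)%E.
rewrite (_ : (fun t => _) = (fun t => \int[mu]_x fD (t, x))%E).
  apply: (measurable_fun_fubini_tonelli_F fD) => [|z]; last by rewrite mule_ge0.
  apply: emeasurable_funM => //; apply/measurable_EFinP.
  exact: (measurableT_comp (f := \1_D : R -> R)).
apply/funext => t; rewrite integral_mkcond; apply: eq_integral => x _.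
by rewrite patchE /fD /= indicE; case: ifP; rewrite ?mule1 ?mule0.
Qed.

Lemma measurable_parametric (f : T * measurableTypeR R -> R) :
  measurable_fun setT f ->
  measurable_fun setT (fun t => \int[mu]_(x in D) f (t, x)).
Proof.
move=> mf; have mEf : measurable_fun setT (EFin \o f) by exact/measurable_EFinP.
apply: (measurableT_comp (f := @fine R)) => //.
rewrite (_ : (fun t => _) = (fun t => \int[mu]_(x in D) (EFin \o f)^\+ (t, x) -
    \int[mu]_(x in D) (EFin \o f)^\- (t, x))%E).
  apply: emeasurable_funB; apply: ge0_measurable_parametric => //.
  - exact: measurable_funepos.
  - exact: measurable_funeneg.
apply/funext => t; rewrite integralE; congr (_ - _)%E; apply: eq_integral => x _.
- by rewrite !funeposE.
- by rewrite !funenegE.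
Qed.

End parametric_integral.

Section variance_of_influence.
Context d (T : measurableType d) (R : realType) (P : probability T R).
Variables (X : {RV P >-> R}) (F : R -> R) (v : nat).
Hypothesis cdfX : forall x, cdf X x = (F x)%:E.
Hypothesis F_cont : continuous F.
Hypothesis v_gt1 : (1 < v)%N.
Local Notation mu := (@lebesgue_measure R).
Local Notation D := (`[0%R, +oo[%classic : set R).
Hypothesis IF : mu.-integrable D (EFin \o (fun x => 1 - F x)).
Variable m : R.
Hypotheses (m0 : 0 <= m) (Fm : F m = 3 / 4).

Let F0 x : 0 <= F x. Proof. exact: df_ge0 cdfX x. Qed.
Let F1 x : F x <= 1. Proof. exact: df_le1 cdfX x. Qed.
Let mF : measurable_fun [set: R] F. Proof. exact: df_measurable cdfX. Qed.
Let mD : measurable (D : set (measurableTypeR R)). Proof. exact: measurable_itv. Qed.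
Let w x : R := score v (F x).
Let w1 x : `|w x| <= 1. Proof. exact: score_df_le1 F0 F1 x. Qed.
Let mw : measurable_fun [set: R] w. Proof. exact: measurable_score mF. Qed.
Let m1 : R := \int[mu]_(x in D) (1 - F x).

Definition df_cov x z : R := Num.min (F x) (F z) - F x * F z.

Lemma df_covC x z : df_cov x z = df_cov z x.
Proof. by rewrite /df_cov minC mulrC. Qed.

Lemma df_cov_le x z : x <= z -> df_cov x z = F x * (1 - F z).
Proof.
by move=> xz; rewrite /df_cov min_l ?(df_homo cdfX xz)//; ring.
Qed.

Lemma df_cov_ge0 x z : 0 <= df_cov x z.
Proof.
wlog xz : x z / x <= z.
  by move=> H; have [/H//|/ltW/H] := leP x z; rewrite df_covC.
by rewrite df_cov_le// mulr_ge0// subr_ge0.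
Qed.

(** A bound free of [z], so the inner integral of [sigma3_sq] converges and stays bounded uniformly
    in [z]. *)
Lemma df_cov_bound x z : df_cov x z <= 1 - F x.
Proof.
have := F0 x; have := F1 x; have := F0 z; have := F1 z => ? ? ? ?.
have [xz|zx] := leP x z.
  rewrite df_cov_le//; have := df_homo cdfX xz => ?; nra.
by rewrite df_covC df_cov_le ?(ltW zx)//; nra.
Qed.

Lemma measurable_df_cov : measurable_fun [set: R * measurableTypeR R]
  (fun y => df_cov y.2 y.1).
Proof.
have mF1 : measurable_fun [set: R * measurableTypeR R] (fun y => F y.1).
  exact: (measurableT_comp mF measurable_fst).
have mF2 : measurable_fun [set: R * measurableTypeR R] (fun y => F y.2).
  exact: (measurableT_comp mF measurable_snd).
by apply: measurable_funB; [exact: measurable_minr|exact: measurable_funM].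
Qed.

Definition cov_integral z : R := \int[mu]_(x in D) (df_cov x z * w x).

Lemma integrable_cov z : mu.-integrable D (EFin \o (fun x => df_cov x z * w x)).
Proof.
have mc : measurable_fun [set: measurableTypeR R] (fun x => df_cov x z).
  by apply: measurable_funB; [exact: measurable_minr|exact: measurable_funM].
apply: le_integrable IF => //.
  by apply/measurable_EFinP/measurable_funTS; exact: measurable_funM.
move=> x _; rewrite /= lee_fin normrM (ger0_norm (df_cov_ge0 _ _)).
rewrite (le_trans (ler_piMr (df_cov_ge0 _ _) (w1 x)))//.
by rewrite (le_trans (df_cov_bound _ _))// ler_norm.
Qed.

Lemma measurable_cov_integral : measurable_fun [set: R] cov_integral.
Proof.
apply: (measurable_parametric (f := fun y : R * measurableTypeR R => df_cov y.2 y.1 * w y.2)).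
apply: measurable_funM; first exact: measurable_df_cov.
exact: (measurableT_comp mw measurable_snd).
Qed.

Lemma cov_integral_bound z : `|cov_integral z| <= m1.
Proof.
have I := integrable_cov z.
apply: (le_trans (le_normr_Rintegral _ I)) => //; apply: le_Rintegral => //.
  exact: integrable_abse I.
move=> x _; rewrite normrM (ger0_norm (df_cov_ge0 _ _)).
by rewrite (le_trans (ler_piMr (df_cov_ge0 _ _) (w1 x)))// df_cov_bound.
Qed.

Lemma sigma3_sqE : sigma3_sq F v =
  ((v%:R ^+ 2)%:E * \int[mu]_(z in D) (cov_integral z * w z)%:E)%E.
Proof.
rewrite /sigma3_sq; congr (_ * _)%E; apply: eq_integral => z _.
have I := integrable_cov z.
rewrite EFinM /cov_integral /Rintegral fineK; last exact: integrable_fin_num.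
rewrite muleC -integralZl//; apply: eq_integral => x _.
by rewrite -EFinM; congr EFin; rewrite /df_cov /w /weight /score; ring.
Qed.

Let k : R := score_gap v.
Let k0 : 0 < k. Proof. exact: score_gap_gt0. Qed.

Let w_ge x : m <= x -> k <= w x.
Proof. by move=> mx; apply: score_gap_le => //; rewrite -Fm (df_homo cdfX). Qed.

(** Between [m] and [z] the covariance is at least [3 / 4 * (1 - F z)] and [w] at least [k], which
    leaves room for [k / 2]. Below [m] the integrand is at least [- (1 - F z)], at a total cost of
    [m]; beyond [z] it is nonnegative and is discarded. *)
Lemma cov_integral_lower z : m <= z ->
  (1 - F z) * (k / 2 * (z - m) - m) <= cov_integral z.
Proof.
move=> mz; have z0 : 0 <= z by exact: le_trans mz.
have I1 := integrable_lt_indicator z; have I2 := integrable_lt_indicator m.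
have I12 := integrable_indicatorB m z.
have I3 : mu.-integrable D (EFin \o (fun x => k / 2 * ((x < z)%R%:R - (x < m)%R%:R))).
  exact: (integrableZl _ (k / 2) I12).
have I4 : mu.-integrable D (EFin \o
    (fun x => k / 2 * ((x < z)%R%:R - (x < m)%R%:R) - (x < m)%R%:R)).
  exact: (integrableB _ I3 I2).
have -> : (1 - F z) * (k / 2 * (z - m) - m) = \int[mu]_(x in D)
    ((1 - F z) * (k / 2 * ((x < z)%R%:R - (x < m)%R%:R) - (x < m)%R%:R)).
  rewrite RintegralZl// RintegralB// RintegralZl// RintegralB//.
  by rewrite !Rintegral_lt_indicator !max_l.
apply: le_Rintegral => //.
- exact: (integrableZl _ (1 - F z) I4).
- exact: integrable_cov.
move=> x _; have fz : 0 <= 1 - F z by rewrite subr_ge0.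
have c0 := df_cov_ge0 x z.
have [xm|mx] := ltP x m.
  have xz : x < z by exact: lt_le_trans mz.
  rewrite xz subrr mulr0 sub0r mulrN1.
  have cz : df_cov x z <= 1 - F z by rewrite df_covC df_cov_bound.
  have := w1 x; rewrite ler_norml => /andP[wx _]; nra.
have kw := w_ge mx.
have [xz|zx] := ltP x z; last first.
  by rewrite subrr mulr0 subr0 mulr0 mulr_ge0// (le_trans (ltW k0)).
rewrite subr0 subr0 mulr1 df_cov_le ?(ltW xz)//.
have fx : 3 / 4 <= F x by rewrite -Fm (df_homo cdfX).
rewrite [F x * _]mulrC -mulrA ler_wpM2l//.
have : 3 / 4 * k <= F x * w x by rewrite ler_pM// ?(ltW k0)//; lra.
by apply: le_trans; move: k0; lra.
Qed.

Lemma tail_moment_le : exists C z1 : R, forall z, 0 <= z ->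
  k ^+ 2 / 4 * (z * (1 - F z)) <= cov_integral z * w z + C * (z < z1)%R%:R.
Proof.
(* Beyond this point [k / 2 * (z - m) - m] is at least [k / 4 * z]; multiplying by [w z >= k] gives
   the constant [k ^+ 2 / 4]. Below it everything is bounded. *)
pose z1 := m * (4 + 2 * k) / k.
have kk : 0 <= k ^+ 2 / 4 by rewrite divr_ge0// sqr_ge0.
exists (m1 + k ^+ 2 / 4 * z1), z1 => z z0.
have fz : 0 <= 1 - F z by rewrite subr_ge0.
have [zz1|z1z] := ltP z z1.
  have : `|cov_integral z * w z| <= m1.
    rewrite normrM (le_trans _ (cov_integral_bound z))// ler_piMr// w1.
  rewrite ler_norml => /andP[h _]; rewrite mulr1.
  have h2 : k ^+ 2 / 4 * (z * (1 - F z)) <= k ^+ 2 / 4 * z1.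
    rewrite ler_wpM2l// (le_trans _ (ltW zz1))// ler_piMr// gerBl; exact: F0.
  by rewrite addrA; lra.
rewrite mulr0 addr0.
have e1 : m * (4 + 2 * k) <= z * k by rewrite -ler_pdivrMr.
have mz : m <= z.
  rewrite -(ler_pM2r k0) (le_trans _ e1)// ler_wpM2l//; move: k0; lra.
have h1 := cov_integral_lower mz.
have h2 := w_ge mz.
have h3 : (1 - F z) * (k / 4 * z) <= cov_integral z.
  by apply: le_trans h1; rewrite ler_wpM2l//; lra.
have h4 : 0 <= (1 - F z) * (k / 4 * z).
  by rewrite mulr_ge0// mulr_ge0// divr_ge0// ltW.
have := ler_pM h4 (ltW k0) h3 h2; apply: le_trans.
by rewrite le_eqVlt; apply/orP; left; apply/eqP; ring.
Qed.

Lemma tail_moment_finite : (sigma3_sq F v < +oo)%E ->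
  (\int[mu]_(z in D) (z * (1 - F z))%:E < +oo)%E.
Proof.
rewrite sigma3_sqE => hs.
pose h z : R := cov_integral z * w z.
have mh : measurable_fun [set: R] h.
  by apply: measurable_funM => //; exact: measurable_cov_integral.
have v0 : 0 < v%:R ^+ 2 :> R by rewrite exprn_gt0// ltr0n ltnW.
have h_lt : (\int[mu]_(z in D) (h z)%:E < +oo)%E.
  move: hs; rewrite ltey -/(h _) => /eqP hs; rewrite ltey; apply/eqP => h2.
  apply: hs; have -> : (\int[mu]_(z in D) (cov_integral z * w z)%:E = +oo)%E by exact: h2.
  by rewrite gt0_muley// lte_fin.
have [C [z1 HC]] := tail_moment_le.
pose C' := `|C|.
have C'0 : 0 <= C' by exact: normr_ge0.
have kk : 0 < k ^+ 2 / 4 by rewrite divr_gt0// exprn_gt0.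
have IC : mu.-integrable D (EFin \o (fun z => C' * (z < z1)%R%:R)).
  exact: (integrableZl _ C' (integrable_lt_indicator z1)).
have HC' z : 0 <= z -> k ^+ 2 / 4 * (z * (1 - F z)) <= h z + C' * (z < z1)%R%:R.
  by move=> z0; rewrite (le_trans (HC z z0))// lerD2l ler_wpM2r// ler_norm.
have zF z : 0 <= z -> 0 <= z * (1 - F z) by move=> z0; rewrite mulr_ge0// subr_ge0.
have mEh : measurable_fun D (EFin \o h) by apply/measurable_EFinP/measurable_funTS.
(* The integral of [h] is that of its positive part minus that of its negative part, so an upper
   bound on it controls the positive part only once the negative part is known to be finite. The
   negative part lives on [z < z1], by [tail_moment_le]. *)
have neg_fin : (\int[mu]_(z in D) (EFin \o h)^\- z < +oo)%E.
  apply: (@le_lt_trans _ _ (\int[mu]_(z in D) (C' * (z < z1)%R%:R)%:E)%E).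
    apply: ge0_le_integral => //.
    - exact: measurable_funeneg.
    - by apply/measurable_EFinP; apply/measurable_EFinP; exact: measurable_int IC.
    - move=> z; rewrite /= in_itv /= andbT => z0.
      rewrite funenegE ge_max; apply/andP; split; last by rewrite lee_fin mulr_ge0.
      rewrite /= lee_fin.
      have := HC' z z0; have := mulr_ge0 (ltW kk) (zF z z0); lra.
  by have := integrable_fin_num mD IC; rewrite fin_numElt => /andP[].
have pos_fin : (\int[mu]_(z in D) (EFin \o h)^\+ z < +oo)%E.
  have : (\int[mu]_(z in D) (EFin \o h)^\+ z - \int[mu]_(z in D) (EFin \o h)^\- z < +oo)%E.
    by rewrite -integralE; exact: h_lt.
  move: neg_fin.
  have : (0 <= \int[mu]_(z in D) (EFin \o h)^\- z)%E by apply: integral_ge0.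
  case: (\int[mu]_(z in D) (EFin \o h)^\- z)%E => [r| |]//.
  by move=> _ _; rewrite lteBlDr// addye.
have : (\int[mu]_(z in D) ((k ^+ 2 / 4)%:E * (z * (1 - F z))%:E) < +oo)%E.
  apply: (@le_lt_trans _ _ (\int[mu]_(z in D) ((EFin \o h)^\+ z + (C' * (z < z1)%R%:R)%:E))%E).
    apply: ge0_le_integral => //.
    - move=> z; rewrite /= in_itv /= andbT => z0.
      by rewrite -EFinM lee_fin mulr_ge0 ?zF// ltW.
    - apply: emeasurable_funM => //; apply/measurable_EFinP/measurable_funTS.
      by apply: measurable_funM => //; exact: measurable_funB.
    - apply: emeasurable_funD; first exact: measurable_funepos.
      exact: measurable_int IC.
    - move=> z; rewrite /= in_itv /= andbT => z0.
      rewrite -EFinM (@le_trans _ _ (h z + C' * (z < z1)%R%:R)%:E)//.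
        by rewrite lee_fin HC'.
      by rewrite EFinD leeD2r// funeposE le_max lexx.
  rewrite ge0_integralD//.
  - rewrite lte_add_pinfty//.
    by have := integrable_fin_num mD IC; rewrite fin_numElt => /andP[].
  - exact: measurable_funepos.
  - by move=> z _; rewrite lee_fin mulr_ge0.
  - exact: measurable_int IC.
rewrite ge0_integralZl//.
- apply: contraTT; rewrite -!leNgt !leye_eq => /eqP ->.
  by rewrite gt0_muley// lte_fin.
- apply/measurable_EFinP/measurable_funTS.
  by apply: measurable_funM => //; exact: measurable_funB.
- by move=> z; rewrite /= in_itv /= andbT => z0; rewrite lee_fin zF.
- by rewrite lee_fin ltW.
Qed.

Lemma second_moment_finite : (sigma3_sq F v < +oo)%E ->
  (\int[P]_t (Num.max (X t) 0 ^+ 2)%:E < +oo)%E.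
Proof.
move=> /tail_moment_finite fin.
pose f (y : T * measurableTypeR R) : R := 4 * (Num.max y.2 0 * (y.2 < X y.1)%R%:R).
have f0 y : 0 <= f y by rewrite !mulr_ge0// le_max lexx orbT.
have mf : measurable_fun setT f.
  apply: measurable_funM => //; apply: measurable_funM.
    by apply: measurable_maxr => //; exact: measurable_snd.
  apply: measurable_indicator_lt => //; exact: (measurableT_comp _ measurable_fst).
apply: (@le_lt_trans _ _ (\int[P]_(t in setT) \int[mu]_(x in D) (f (t, x))%:E)%E).
  apply: ge0_le_integral => //.
  - by move=> t _; rewrite lee_fin sqr_ge0.
  - by apply/measurable_EFinP; apply: measurable_funX; exact: measurable_maxr.
  - by apply: (ge0_measurable_parametric (f := EFin \o f)) => //; exact/measurable_EFinP.
  move=> t _; set s := Num.max (X t) 0.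
  have s0 : 0 <= s by rewrite le_max lexx orbT.
  have I := integrable_indicatorB (s / 2) s.
  (* Only the levels between [s / 2] and [s] are kept: there [2 * s] is at most [4 * x], which
     bounds the square by an integral of [f] without computing the latter exactly. *)
  have -> : s ^+ 2 = \int[mu]_(x in D) (2 * s * ((x < s)%R%:R - (x < s / 2)%R%:R)).
    rewrite RintegralZl// RintegralB//; try exact: integrable_lt_indicator.
    by rewrite !Rintegral_lt_indicator !max_l ?divr_ge0//; field.
  rewrite /Rintegral fineK; last first.
    by apply: integrable_fin_num => //; exact: (integrableZl _ (2 * s) I).
  apply: ge0_le_integral => //.
  - move=> x _; rewrite lee_fin mulr_ge0 ?mulr_ge0// subr_ge0 ler_nat.
    by case: (ltP x (s / 2)) => // xs; rewrite (lt_le_trans xs)// ler_pdivrMr//; lra.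
  - apply/measurable_EFinP/measurable_funTS; apply: measurable_funM => //.
    by apply: measurable_funB; exact: measurable_indicator_lt.
  - apply/measurable_EFinP/measurable_funTS.
    exact: (measurableT_comp mf (pair1_measurable t)).
  move=> x; rewrite /= in_itv /= andbT => x0; rewrite lee_fin /f /= max_l//.
  have [xs|sx] := ltP x (s / 2).
    have -> : (x < s)%R by rewrite (lt_le_trans xs)// ler_pdivrMr//; lra.
    by rewrite subrr mulr0 !mulr_ge0.
  rewrite subr0; have [xs|//] := ltP x s; last by rewrite mulr0 !mulr_ge0.
  have -> : (x < X t)%R by move: xs; rewrite /s lt_max => /orP[//|]; rewrite ltNge x0.
  by rewrite !mulr1; move: sx; rewrite ler_pdivrMr//; lra.
rewrite (@tonelli_on _ _ T (measurableTypeR R) R P mu setT D _ _ (EFin \o f))//; last first.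
  exact/measurable_EFinP.
apply: (@le_lt_trans _ _ (\int[mu]_(x in D) (4%:E * (x * (1 - F x))%:E))%E).
  rewrite le_eqVlt; apply/orP; left; apply/eqP.
  apply: eq_integral => x; rewrite inE /= in_itv /= andbT => x0.
  under eq_integral do rewrite /f /= mulrA EFinM.
  rewrite ge0_integralZl//.
  - by rewrite (integral_gt_indicator cdfX) max_l// -!EFinM mulrA.
  - by apply/measurable_EFinP; exact: measurable_indicator_lt.
  - by rewrite lee_fin mulr_ge0// le_max lexx orbT.
rewrite ge0_integralZl//.
- by rewrite lte_mul_pinfty.
- apply/measurable_EFinP/measurable_funTS.
  by apply: measurable_funM => //; exact: measurable_funB.
- by move=> x; rewrite /= in_itv /= andbT => x0; rewrite lee_fin mulr_ge0// subr_ge0.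
Qed.

Let b (t : T) (x : R) : R := w x * ((x < X t)%R%:R - (1 - F x)).

Let mb : measurable_fun [set: T * measurableTypeR R] (fun y => b y.1 y.2).
Proof.
apply: measurable_funM; first exact: (measurableT_comp mw measurable_snd).
apply: measurable_funB.
  apply: measurable_indicator_lt; first exact: measurable_snd.
  exact: (measurableT_comp _ measurable_fst).
by apply: measurable_funB => //; exact: (measurableT_comp mF measurable_snd).
Qed.

Let b_norm t x : `|b t x| <= (x < X t)%R%:R + (1 - F x).
Proof.
rewrite normrM (le_trans (ler_piMl _ (w1 x)))//.
by rewrite (le_trans (ler_normB _ _))// ger0_norm// ger0_norm// subr_ge0.
Qed.

Let b_le1 t x : `|b t x| <= 1.
Proof.
rewrite normrM -[leRHS]mulr1 ler_pM//; have := F0 x; have := F1 x => ? ?.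
by rewrite ler_norml; case: ltP => _ /=; lra.
Qed.

Let integral_norm_b t :
  (\int[mu]_(x in D) `|b t x|%:E <= (Num.max (X t) 0 + m1)%:E)%E.
Proof.
have I := integrableD mD (integrable_lt_indicator (X t)) IF.
rewrite -Rintegral_lt_indicator /m1 -RintegralD//; last exact: integrable_lt_indicator.
rewrite /Rintegral fineK; last exact: integrable_fin_num.
apply: ge0_le_integral => //.
- apply/measurable_EFinP/measurable_funTS; apply: measurableT_comp => //.
  exact: (measurableT_comp mb (pair1_measurable t)).
- exact: measurable_int I.
- by move=> x _; rewrite lee_fin.
Qed.

Let integrable_max : P.-integrable setT (EFin \o (fun t => Num.max (X t) 0)).
Proof.
apply/integrableP; split; first by apply/measurable_EFinP; exact: measurable_maxr.
under eq_integral do rewrite /= ger0_norm ?le_max ?lexx ?orbT//.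
rewrite -(integral_df_tail cdfX); have /integrableP[_] := IF.
apply: le_lt_trans; rewrite le_eqVlt; apply/orP; left; apply/eqP.
by apply: eq_integral => x _; rewrite /= ger0_norm// subr_ge0.
Qed.

Let integrable_b t : mu.-integrable D (EFin \o b t).
Proof. exact: integrable_influence. Qed.

Let influenceE t : influence F v (X t) = v%:R * \int[mu]_(x in D) b t x.
Proof. by []. Qed.

Let m10 : 0 <= m1.
Proof. by apply: Rintegral_ge0 => x _; rewrite subr_ge0. Qed.

Let beta t : R := \int[mu]_(x in D) b t x.

Let mbeta : measurable_fun setT beta.
Proof. exact: (measurable_parametric mb). Qed.

Let beta_norm t : `|beta t| <= Num.max (X t) 0 + m1.
Proof.
rewrite -lee_fin (le_trans _ (integral_norm_b t))//.
rewrite /beta EFin_normr_Rintegral//.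
apply: le_abse_integral => //; exact: measurable_int (integrable_b t).
Qed.

Let integral_b x : \int[P]_t b t x = 0.
Proof.
have Ii := integrable_le_indicator X x.
have Ic : P.-integrable setT (EFin \o (fun _ : T => F x)).
  exact: (@integrable_bounded _ _ _ P _ `|F x|).
transitivity (\int[P]_t (- w x * ((X t <= x)%R%:R - F x))).
  by apply: eq_Rintegral => t _; rewrite /b ltNge; case: leP => _ /=; ring.
rewrite RintegralZl//; last exact: (integrableB measurableT Ii Ic).
by rewrite RintegralB// Rintegral_prob_cst (Rintegral_le_indicator cdfX) subrr mulr0.
Qed.

Let integral_bb x z : \int[P]_t (b t z * b t x) = df_cov x z * w x * w z.
Proof.
have Ii y := integrable_le_indicator X y.
have Ic : P.-integrable setT (EFin \o (fun _ : T => F z * F x)).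
  exact: (@integrable_bounded _ _ _ P _ `|F z * F x|).
have IFx : P.-integrable setT (EFin \o (fun t => F z * (X t <= x)%R%:R)).
  exact: (integrableZl measurableT (F z) (Ii x)).
have IFz : P.-integrable setT (EFin \o (fun t => F x * (X t <= z)%R%:R)).
  exact: (integrableZl measurableT (F x) (Ii z)).
have I1 : P.-integrable setT (EFin \o (fun t => (X t <= Num.min x z)%R%:R - F z * (X t <= x)%R%:R)).
  exact: (integrableB measurableT (Ii _) IFx).
have I2 : P.-integrable setT (EFin \o
    (fun t => (X t <= Num.min x z)%R%:R - F z * (X t <= x)%R%:R - F x * (X t <= z)%R%:R)).
  exact: (integrableB measurableT I1 IFz).
have I3 : P.-integrable setT (EFin \o
    (fun t => (X t <= Num.min x z)%R%:R - F z * (X t <= x)%R%:R - F x * (X t <= z)%R%:R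
      + F z * F x)).
  exact: (integrableD measurableT I2 Ic).
transitivity (\int[P]_t (w x * w z * ((X t <= Num.min x z)%R%:R - F z * (X t <= x)%R%:R
   - F x * (X t <= z)%R%:R + F z * F x))).
  apply: eq_Rintegral => t _; rewrite /b le_min !ltNge.
  by case: leP => _; case: leP => _ /=; ring.
rewrite RintegralZl// RintegralD// RintegralB// RintegralB// Rintegral_prob_cst.
rewrite !RintegralZl// !(Rintegral_le_indicator cdfX) /df_cov.
have -> : F (Num.min x z) = Num.min (F x) (F z).
  have [xz|zx] := leP x z; first by rewrite min_l// (df_homo cdfX).
  by rewrite min_r// (df_homo cdfX)// ltW.
by ring.
Qed.

Let b_cross_finite z : (\int[P]_t \int[mu]_(x in D) `|(b t z * b t x)%:E| < +oo)%E.
Proof.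
apply: (@le_lt_trans _ _ (\int[P]_t (Num.max (X t) 0 + m1)%:E)%E).
  apply: ge0_le_integral => //.
  - by move=> t _; exact: integral_ge0.
  - apply: (ge0_measurable_parametric (f := fun y => `|(b y.1 z * b y.1 y.2)%:E|%E)) => //.
    apply/measurable_EFinP; apply: measurableT_comp => //; apply: measurable_funM => //.
    have mz : measurable_fun [set: T] (fun t => b t z).
      exact: (measurableT_comp mb (pair2_measurable z)).
    exact: (measurableT_comp mz measurable_fst).
  - by apply/measurable_EFinP; apply: measurable_funD => //; exact: measurable_maxr.
  - move=> t _; apply: le_trans (integral_norm_b t); apply: ge0_le_integral => //.
    + apply/measurable_EFinP/measurable_funTS; apply: measurableT_comp => //.
      apply: measurable_funM => //.
      exact: (measurableT_comp mb (pair1_measurable t)).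
    + apply/measurable_EFinP/measurable_funTS; apply: measurableT_comp => //.
      exact: (measurableT_comp mb (pair1_measurable t)).
    + by move=> x _; rewrite /= lee_fin normrM ler_piMl.
have Ic : P.-integrable setT (EFin \o (fun _ : T => m1)).
  exact: (@integrable_bounded _ _ _ P _ `|m1|).
have := integrable_fin_num measurableT (integrableD measurableT integrable_max Ic).
by rewrite ge0_fin_numE//; apply: integral_ge0 => t _; rewrite lee_fin addr_ge0// le_max lexx orbT.
Qed.

Lemma influence_mean : \int[P]_t influence F v (X t) = 0.
Proof.
have Ib : P.-integrable setT (EFin \o beta).
  have Ic : P.-integrable setT (EFin \o (fun _ : T => m1)).
    exact: (@integrable_bounded _ _ _ P _ `|m1|).
  apply: le_integrable (integrableD measurableT integrable_max Ic) => //.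
    exact/measurable_EFinP.
  by move=> t _; rewrite /= lee_fin (le_trans (beta_norm t))// ler_norm.
under eq_Rintegral do rewrite influenceE.
rewrite RintegralZl//; apply/eqP; rewrite mulf_eq0; apply/orP; right; apply/eqP.
rewrite /Rintegral.
transitivity (fine (\int[P]_(t in setT) \int[mu]_(x in D) (b t x)%:E)%E).
  congr fine; apply: eq_integral => t _.
  by rewrite /beta /Rintegral fineK//; exact: (integrable_fin_num mD (integrable_b t)).
rewrite (@fubini_on _ _ T (measurableTypeR R) R P mu setT D _ _
  (fun y => (b y.1 y.2)%:E))//.
- rewrite integral0_eq// => x _; have := integral_b x; rewrite /Rintegral /=.
  have Ibx : P.-integrable setT (EFin \o (fun t => b t x)).
    apply: (@integrable_bounded _ _ _ P _ 1) => //.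
    exact: (measurableT_comp mb (pair2_measurable x)).
  by move=> e; rewrite -[LHS]fineK ?e//; exact: integrable_fin_num.
- exact/measurable_EFinP.
- apply: (@le_lt_trans _ _ (\int[P]_t (Num.max (X t) 0 + m1)%:E)%E).
    apply: ge0_le_integral => //.
    + by move=> t _; exact: integral_ge0.
    + apply: (ge0_measurable_parametric (f := fun y => `|(b y.1 y.2)%:E|%E)) => //.
      by apply/measurable_EFinP; apply: measurableT_comp.
    + by apply/measurable_EFinP; apply: measurable_funD => //; exact: measurable_maxr.
    + by move=> t _; exact: (integral_norm_b t).
  have Ic : P.-integrable setT (EFin \o (fun _ : T => m1)).
    exact: (@integrable_bounded _ _ _ P _ `|m1|).
  have := integrable_fin_num measurableT (integrableD measurableT integrable_max Ic).
  by rewrite ge0_fin_numE//; apply: integral_ge0 => t _; rewrite lee_fin addr_ge0// le_max lexx orbT.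
Qed.

(** Two exchanges of integrals. The one in [z] involves the product of two integrals over levels, of
    size the square of [max X 0 + m1], and uses the second moment. The one in [x], at fixed [z], has
    a factor bounded by 1 and needs only the first. *)
Lemma influence_variance : (sigma3_sq F v < +oo)%E ->
  (\int[P]_t (influence F v (X t) ^+ 2)%:E = sigma3_sq F v)%E /\
  P.-integrable setT (fun t => (influence F v (X t) ^+ 2)%:E).
Proof.
move=> s_fin; have m2 := second_moment_finite s_fin.
have bound_fin : (\int[P]_t (2 * Num.max (X t) 0 ^+ 2 + 2 * m1 ^+ 2)%:E < +oo)%E.
  under eq_integral do rewrite EFinD.
  rewrite ge0_integralD//.
  - rewrite lte_add_pinfty//.
      under eq_integral do rewrite EFinM.
      rewrite ge0_integralZl//; first by rewrite lte_mul_pinfty.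
      + by apply/measurable_EFinP; apply: measurable_funX; exact: measurable_maxr.
      + by move=> t _; rewrite lee_fin sqr_ge0.
    have Ic : P.-integrable setT (EFin \o (fun _ : T => 2 * m1 ^+ 2)).
      exact: (@integrable_bounded _ _ _ P _ `|2 * m1 ^+ 2|).
    by have := integrable_fin_num measurableT Ic; rewrite fin_numElt => /andP[].
  - by move=> t _; rewrite lee_fin mulr_ge0// sqr_ge0.
  - apply/measurable_EFinP; apply: measurable_funM => //; apply: measurable_funX.
    exact: measurable_maxr.
  - by move=> t _; rewrite lee_fin mulr_ge0// sqr_ge0.
have sq_le (t : T) : (Num.max (X t) 0 + m1) ^+ 2 <= 2 * Num.max (X t) 0 ^+ 2 + 2 * m1 ^+ 2.
  by have := sqr_ge0 (Num.max (X t) 0 - m1); set q := Num.max _ _; nra.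
have beta2 t : `|beta t ^+ 2| <= 2 * Num.max (X t) 0 ^+ 2 + 2 * m1 ^+ 2.
  by rewrite normrX (le_trans _ (sq_le t))// lerXn2r ?nnegrE ?addr_ge0// le_max lexx orbT.
have Ib2 : P.-integrable setT (EFin \o (fun t => beta t ^+ 2)).
  apply/integrableP; split; first by apply/measurable_EFinP; exact: measurable_funX.
  apply: le_lt_trans bound_fin; apply: ge0_le_integral => //.
  - by apply/measurable_EFinP; apply: measurableT_comp => //; exact: measurable_funX.
  - apply/measurable_EFinP; apply: measurable_funD => //; apply: measurable_funM => //.
    by apply: measurable_funX; exact: measurable_maxr.
  - by move=> t _; rewrite /= lee_fin.
have inflE t : influence F v (X t) ^+ 2 = v%:R ^+ 2 * beta t ^+ 2 by rewrite influenceE exprMn.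
split; last first.
  under eq_fun do rewrite inflE EFinM.
  exact: (integrableZl measurableT (v%:R ^+ 2) Ib2).
under eq_integral do rewrite inflE EFinM.
rewrite integralZl// /sigma3_sq; congr (_ * _)%E.
transitivity (\int[P]_(t in setT) \int[mu]_(z in D) (b t z * beta t)%:E)%E.
  apply: eq_integral => t _.
  rewrite expr2 {1}/beta -RintegralZr// /Rintegral fineK//.
  apply: integrable_fin_num => //.
  exact: (integrableZr _ (beta t) (integrable_b t)).
rewrite (@fubini_on _ _ T (measurableTypeR R) R P mu setT D _ _
  (fun y => (b y.1 y.2 * beta y.1)%:E))//.
- apply: eq_integral => z _ /=.
  transitivity (\int[P]_(t in setT) \int[mu]_(x in D) (b t z * b t x)%:E)%E.
    apply: eq_integral => t _; rewrite /beta -RintegralZl// /Rintegral fineK//.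
    apply: integrable_fin_num => //.
    exact: (integrableZl _ (b t z) (integrable_b t)).
  rewrite (@fubini_on _ _ T (measurableTypeR R) R P mu setT D _ _
    (fun y => (b y.1 z * b y.1 y.2)%:E))//.
  + apply: eq_integral => x _ /=; have := integral_bb x z; rewrite /Rintegral => e.
    rewrite -[RHS]/((df_cov x z * w x * w z)%:E) -e fineK//; apply: integrable_fin_num => //.
    apply: (@integrable_bounded _ _ _ P (fun t => b t z * b t x) 1).
      apply: measurable_funM.
        exact: (measurableT_comp mb (pair2_measurable z)).
      exact: (measurableT_comp mb (pair2_measurable x)).
    by move=> t; rewrite normrM -[leRHS]mulr1 ler_pM.
  + apply/measurable_EFinP; apply: measurable_funM => //.
    have mz : measurable_fun [set: T] (fun t => b t z).
      exact: (measurableT_comp mb (pair2_measurable z)).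
    exact: (measurableT_comp mz measurable_fst).
- apply/measurable_EFinP; apply: measurable_funM => //.
  exact: (measurableT_comp mbeta measurable_fst).
- apply: le_lt_trans bound_fin; apply: ge0_le_integral => //.
  + by move=> t _; exact: integral_ge0.
  + apply: (ge0_measurable_parametric (f := fun y => `|(b y.1 y.2 * beta y.1)%:E|%E)) => //.
    apply/measurable_EFinP; apply: measurableT_comp => //; apply: measurable_funM => //.
    exact: (measurableT_comp mbeta measurable_fst).
  + apply/measurable_EFinP; apply: measurable_funD => //; apply: measurable_funM => //.
    by apply: measurable_funX; exact: measurable_maxr.
  + move=> t _ /=; under eq_integral do rewrite normrM EFinM.
    rewrite ge0_integralZr//; last first.
      apply/measurable_EFinP/measurable_funTS; apply: measurableT_comp => //.
      exact: (measurableT_comp mb (pair1_measurable t)).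
    apply: (@le_trans _ _ ((Num.max (X t) 0 + m1) * (Num.max (X t) 0 + m1))%:E); last first.
      by rewrite lee_fin -expr2.
    rewrite EFinM lee_pmul//; first exact: integral_ge0.
    by rewrite lee_fin.
Qed.

(** The mass at [s] is at most [F s - F y] for every [y < s], which continuity makes arbitrarily
    small. *)
Lemma no_atom s : P (X @^-1` [set s]) = 0%E.
Proof.
apply/eqP; rewrite eq_le measure_ge0 andbT; apply/lee_addgt0Pr => e e0; rewrite add0e.
have /cvgrPdist_lt /(_ e e0)/nbhs_normP[r /= r0 Hr] := @F_cont s.
have mX y : measurable (X @^-1` `]-oo, y]%classic).
  by rewrite -[_ @^-1` _]setTI; exact: measurable_funP.
have ms : measurable (X @^-1` [set s]) by rewrite -[_ @^-1` _]setTI; exact: measurable_funP.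
pose y := s - r / 2.
have ys : y < s by rewrite /y; move: r0; lra.
have /Hr Fy : ball_ Num.norm s r y.
  by rewrite /= /y opprB addrCA subrr addr0 gtr0_norm ?divr_gt0//; move: r0; lra.
have : (P (X @^-1` [set s]) + P (X @^-1` `]-oo, y]%classic) <= P (X @^-1` `]-oo, s]%classic))%E.
  rewrite -measureU//.
    apply: le_measure; rewrite ?inE//; first exact: measurableU.
    by move=> t [/= ->|] /=; rewrite !in_itv //= => /le_trans; apply; exact: ltW.
  by apply/seteqP; split => // t /= [->]; rewrite in_itv /= leNgt ys.
have -> : P (X @^-1` `]-oo, y]%classic) = (F y)%:E by exact: cdfX.
have -> : P (X @^-1` `]-oo, s]%classic) = (F s)%:E by exact: cdfX.
rewrite -leeBrDr// => /le_trans; apply; rewrite -EFinB lee_fin ltW//.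
exact: le_lt_trans (ler_norm _) Fy.
Qed.

Lemma influence_increasing s s' : m <= s -> s < s' -> influence F v s < influence F v s'.
Proof.
move=> ms ss'; rewrite -subr_gt0 (influenceB v F0 F1 mF IF).
have s0 : 0 <= s by exact: le_trans ms.
have s0' : 0 <= s' by rewrite (le_trans s0)// ltW.
rewrite mulr_gt0 ?ltr0n ?(ltnW v_gt1)//.
have I := integrable_indicatorB s s'.
apply: (@lt_le_trans _ _ (\int[mu]_(x in D) (k * ((x < s')%R%:R - (x < s)%R%:R)))).
  rewrite RintegralZl// RintegralB//; try exact: integrable_lt_indicator.
  by rewrite !Rintegral_lt_indicator !max_l// mulr_gt0// subr_gt0.
apply: le_Rintegral => //.
- exact: (integrableZl _ k I).
- by apply: integrable_bounded_mul => //; exact: measurable_score.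
move=> x _; have [xs|sx] := ltP x s.
  by rewrite (lt_trans xs)// subrr !mulr0.
by rewrite subr0 ler_wpM2r// w_ge// (le_trans ms).
Qed.

Lemma influence_variance_gt0 : (0 < \int[P]_t (influence F v (X t) ^+ 2)%:E)%E.
Proof.
have e34 : (3 / 4 : R) < 1 by lra.
have mi := measurable_influence v F0 F1 mF IF.
have miX : measurable_fun setT (fun t => influence F v (X t)).
  exact: (measurableT_comp mi (measurable_funP X)).
rewrite lt_neqAle integral_ge0 ?andbT; last by move=> t _; rewrite lee_fin sqr_ge0.
apply/eqP => /esym var0.
have ae0 : {ae P, forall t, influence F v (X t) = 0}.
  have : ae_eq P setT (fun t => (influence F v (X t) ^+ 2)%:E) (cst 0%E).
    apply/ae_eq_integral_abs => //; first by apply/measurable_EFinP; exact: measurable_funX.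
    by under eq_integral do rewrite gee0_abs ?lee_fin ?sqr_ge0//.
  apply: filterS => t /(_ I) /= [] /eqP; rewrite sqrf_eq0 => /eqP //.
have ms (s : R) : measurable (X @^-1` [set s]).
  by rewrite -[_ @^-1` _]setTI; exact: measurable_funP.
have aes s : {ae P, forall t, X t != s}.
  exists (X @^-1` [set s]); split => //; first exact: no_atom.
  by move=> t /=; case: eqVneq.
(* By strict monotonicity [influence] has at most one zero beyond [m]. If the variance vanished, [X]
   would almost surely either be at most [m] or equal that zero, which has no mass; then [F m] would
   be 1 instead of 3/4. *)
have [s0 Hs0] : exists s0, forall s, m <= s -> influence F v s = 0 -> s = s0.
  have [[s0 [ms0 e0]]|no] := pselect (exists s0, m <= s0 /\ influence F v s0 = 0); last first.
    by exists 0 => s ms' e; exfalso; apply: no; exists s.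
  exists s0 => s ms' e; have [ss|ss|//] := ltgtP s s0.
    by have := influence_increasing ms' ss; rewrite e e0 ltxx.
  by have := influence_increasing ms0 ss; rewrite e e0 ltxx.
have aem : {ae P, forall t, X t <= m}.
  apply: filterS2 ae0 (aes s0) => t e ne; rewrite leNgt; apply/negP => /ltW mX.
  by move/eqP: ne; apply; exact: Hs0.
have := Rintegral_le_indicator cdfX m; rewrite Fm.
have -> : \int[P]_t (X t <= m)%R%:R = 1.
  rewrite -[RHS](Rintegral_prob_cst P 1) /Rintegral; congr fine.
  apply: ae_eq_integral => //.
  - by apply/measurable_EFinP; exact: measurable_indicator_le.
  - by apply: filterS aem => t h _ /=; rewrite h.
by move=> h; have h' : (1 : R) = 3 / 4 := h; move: e34; rewrite -h' ltxx.
Qed.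

End variance_of_influence.

(** * Mean of the range *)

Section mean_of_range.
Context d (T : measurableType d) (R : realType) (P : probability T R).
Variables (X : nat -> {RV P >-> R}) (F : R -> R) (v : nat).
Hypothesis X_indep : mutually_independent X.
Hypothesis cdfX : forall j x, cdf (X j) x = (F x)%:E.
Hypothesis v_gt0 : (0 < v)%N.
Local Notation mu := (@lebesgue_measure R).
Local Notation D := (`[0%R, +oo[%classic : set R).

Lemma Rintegral_indicator (A : set T) (q : T -> bool) : measurable A ->
  (forall t, q t <-> A t) -> \int[P]_t (q t)%:R = fine (P A).
Proof.
move=> mA qA; rewrite /Rintegral; congr fine.
transitivity (\int[P]_t (\1_A t)%:E)%E; last by rewrite integral_indic// ?setIT.
apply: eq_integral => t _; rewrite indicE; congr ((_ : bool)%:R%:E).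
by apply/idP/idP; [move/qA/mem_set|rewrite inE => /qA].
Qed.

Lemma independent_power (A : set R) (p : R) : measurable A ->
  (forall j, P (X j @^-1` A) = p%:E) ->
  P (\bigcap_(j in [set j | (j < v)%N]) X j @^-1` A) = (p ^+ v)%:E.
Proof.
move=> mA PA; pose J := [fset x in iota 0 v]%fset.
have -> : [set j | (j < v)%N] = [set` J].
  by apply/seteqP; split => j /=; rewrite /J !inE mem_iota add0n.
rewrite (@X_indep J (fun=> A) (fun=> mA)).
rewrite (eq_bigr (fun=> p%:E)) => [|j _]; last exact: PA.
have -> : v = size (J : seq nat) by rewrite card_fseq undup_id ?iota_uniq// size_iota.
elim: (J : seq nat) => [|j s IH]; first by rewrite big_nil expr0.
by rewrite big_cons IH exprS EFinM.
Qed.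

Let M t : R := \big[Num.max/X 0%N t]_(j < v) X j t.
Let N t : R := \big[Num.min/X 0%N t]_(j < v) X j t.

Let measurable_M : measurable_fun setT M.
Proof.
rewrite /M; elim: (index_enum 'I_v) => [|j s IH].
  by under eq_fun do rewrite big_nil; exact: measurable_funP.
by under eq_fun do rewrite big_cons; exact: measurable_maxr.
Qed.

Let measurable_N : measurable_fun setT N.
Proof.
rewrite /N; elim: (index_enum 'I_v) => [|j s IH].
  by under eq_fun do rewrite big_nil; exact: measurable_funP.
by under eq_fun do rewrite big_cons; exact: measurable_minr.
Qed.

Let measurable_preimage j (A : set R) : measurable A -> measurable (X j @^-1` A).
Proof. by move=> mA; rewrite -[_ @^-1` _]setTI; exact: measurable_funP. Qed.

Let measurable_cap (A : set R) : measurable A ->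
  measurable (\bigcap_(j in [set j | (j < v)%N]) X j @^-1` A).
Proof.
by move=> mA; apply: bigcap_measurableType => // j _; exact: measurable_preimage.
Qed.

Let max_law x : \int[P]_t (M t <= x)%R%:R = F x ^+ v.
Proof.
have mA : measurable (`]-oo, x]%classic : set R) by exact: measurable_itv.
rewrite (Rintegral_indicator (measurable_cap mA)).
  by rewrite (independent_power mA (fun j => cdfX j x)).
move=> t; split=> [/bigmax_leP[_ H] j /= jv|H].
  by rewrite in_itv /=; exact: (H (Ordinal jv)).
apply/bigmax_leP; split=> [|j _].
  by have := H 0%N v_gt0; rewrite /= in_itv.
by have := H j (ltn_ord j); rewrite /= in_itv.
Qed.

Let min_law x : \int[P]_t (x < N t)%R%:R = (1 - F x) ^+ v.
Proof.
have mA : measurable (`]x, +oo[%classic : set R) by exact: measurable_itv.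
have PA j : P (X j @^-1` `]x, +oo[%classic) = (1 - F x)%:E.
  have := cdf_ccdf_1 (X j) x; rewrite cdfX /ccdf => h.
  have -> : P (X j @^-1` `]x, +oo[%classic) = distribution P (X j) `]x, +oo[%classic by [].
  by rewrite EFinB -h addeAC subee// add0e.
rewrite (Rintegral_indicator (measurable_cap mA)).
  by rewrite (independent_power mA PA).
move=> t; split=> [/bigmin_gtP[_ H] j /= jv|H].
  by rewrite in_itv /= andbT; exact: (H (Ordinal jv)).
apply/bigmin_gtP; split=> [|j _].
  by have := H 0%N v_gt0; rewrite /= in_itv /= andbT.
by have := H j (ltn_ord j); rewrite /= in_itv /= andbT.
Qed.

Let min_le_max t : N t <= M t.
Proof.
apply: (@le_trans _ _ (X 0%N t)); last exact: bigmax_ge_id.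
exact: bigmin_le_id.
Qed.

Lemma mean_range_integral : {ae P, forall t, forall j, 0 <= X j t} ->
  mean_range X v = (\int[mu]_(x in D) (range_tail v (F x))%:E)%E.
Proof.
move=> X0; rewrite /mean_range unlock.
pose f (y : T * measurableTypeR R) : R := (y.2 < M y.1)%R%:R - (y.2 < N y.1)%R%:R.
have f0 y : 0 <= f y.
  rewrite /f subr_ge0 ler_nat; case: (ltP y.2 (N y.1)) => // h.
  by rewrite (lt_le_trans h).
have mf : measurable_fun setT f.
  have mM1 : measurable_fun [set: T * measurableTypeR R] (fun y => M y.1).
    exact: (measurableT_comp measurable_M measurable_fst).
  have mN1 : measurable_fun [set: T * measurableTypeR R] (fun y => N y.1).
    exact: (measurableT_comp measurable_N measurable_fst).
  by apply: measurable_funB; apply: measurable_indicator_lt => //; exact: measurable_snd.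
transitivity (\int[P]_(t in setT) \int[mu]_(x in D) (f (t, x))%:E)%E.
  apply: ae_eq_integral => //.
  - by apply/measurable_EFinP; exact: (measurable_funB measurable_M measurable_N).
  - by apply: (ge0_measurable_parametric (f := EFin \o f)) => //; exact/measurable_EFinP.
  - apply: filterS X0 => t X0 _; rewrite /f /=.
    have N0 : 0 <= N t by apply: le_bigmin.
    have M0 : 0 <= M t by exact: le_trans (min_le_max t).
    have I := integrable_indicatorB (N t) (M t).
    rewrite -[RHS]fineK; last by apply: integrable_fin_num => //; exact: I.
    congr EFin; rewrite -[RHS]/(Rintegral mu D (fun x => (x < M t)%R%:R - (x < N t)%R%:R)).
    rewrite RintegralB//; try exact: integrable_lt_indicator.
    by rewrite !Rintegral_lt_indicator !max_l.
rewrite (@tonelli_on _ _ T (measurableTypeR R) R P mu setT D _ _ (EFin \o f))//; last first.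
  exact/measurable_EFinP.
apply: eq_integral => x _; rewrite /f /=.
have IM : P.-integrable setT (EFin \o (fun t => (M t <= x)%R%:R)).
  apply: (@integrable_bounded _ _ _ P _ 1); first exact: measurable_indicator_le.
  by move=> t; rewrite ger0_norm// lern1 leq_b1.
have IN : P.-integrable setT (EFin \o (fun t => (x < N t)%R%:R)).
  apply: (@integrable_bounded _ _ _ P _ 1); first exact: measurable_indicator_lt.
  by move=> t; rewrite ger0_norm// lern1 leq_b1.
have Ic : P.-integrable setT (EFin \o (fun _ : T => 1 : R)).
  by apply: (@integrable_bounded _ _ _ P _ 1) => // t; rewrite normr1.
have I1 : P.-integrable setT (EFin \o (fun t => 1 - (M t <= x)%R%:R)).
  exact: (integrableB measurableT Ic IM).
have I2 : P.-integrable setT (EFin \o (fun t => 1 - (M t <= x)%R%:R - (x < N t)%R%:R)).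
  exact: (integrableB measurableT I1 IN).
transitivity (\int[P]_t (1 - (M t <= x)%R%:R - (x < N t)%R%:R)%:E)%E.
  apply: eq_integral => t _; congr EFin; congr (_ - _).
  by rewrite ltNge; case: leP; rewrite ?subrr ?subr0.
rewrite -[LHS]fineK; last by apply: integrable_fin_num => //; exact: I2.
congr EFin; apply: (etrans (RintegralB measurableT I1 IN)).
rewrite min_law; have e := RintegralB measurableT Ic IM.
by rewrite max_law Rintegral_prob_cst in e; rewrite e.
Qed.

End mean_of_range.

Section borel_law.
Context d (T : measurableType d) (R : realType) (P : probability T R).

Definition borel_of (X : {RV P >-> R}) (t : T) : measurableTypeR R := X t.

Lemma measurable_borel_of (X : {RV P >-> R}) : measurable_fun setT (borel_of X).
Proof. exact: (measurable_funP X). Qed.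

HB.instance Definition _ (X : {RV P >-> R}) :=
  isMeasurableFun.Build _ _ _ _ (borel_of X) (measurable_borel_of X).

(** Both measures give [F b - F a] to the interval from [a] excluded to [b] included, and such
    intervals determine them. Besides transporting Stieltjes integrals to [P], this shows that
    variables with the same distribution function have the same law. *)
Lemma lebesgue_stieltjes_law (F : cumulativeBounded (0 : R) (1 : R)) (X : {RV P >-> R}) A :
  (forall x, cdf X x = (F x)%:E) -> measurable A ->
  lebesgue_stieltjes_measure F A = P (X @^-1` A).
Proof.
move=> cdfX mA.
have -> : P (X @^-1` A) = distribution P (borel_of X) A by [].
apply: lebesgue_stieltjes_measure_unique => // _ [[a b] /= _ <-].
rewrite /lebesgue_stieltjes_measure /measure_extension/=.
rewrite measurable_mu_extE/=; last exact: is_ocitv.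
have [ab|ba] := leP a b; last first.
  by rewrite set_itv_ge ?wlength0 ?measure0// bnd_simp -leNgt ltW.
rewrite wlength_itv_bnd// EFinB -!cdfX.
rewrite /cdf /distribution /pushforward.
have -> : borel_of X @^-1` `]a, b] = (X @^-1` `]-oo, b]) `\` (X @^-1` `]-oo, a]).
  apply/seteqP; split => t /=; rewrite /borel_of !in_itv /=.
    by move=> /andP[aX Xb]; split => //; apply/negP; rewrite -ltNge.
  by move=> [-> /negP]; rewrite -ltNge => ->.
have mX x : measurable (X @^-1` `]-oo, x]%classic).
  by rewrite -[_ @^-1` _]setTI; exact: measurable_funP.
rewrite measureD//.
  rewrite setIidr// => t /=; rewrite !in_itv /= => /le_trans; exact.
by rewrite -ge0_fin_numE// fin_num_measure.
Qed.

End borel_law.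

(** * The tail of the range as a Stieltjes integral of the score *)

Section range_tail_derivative.
Context d (T : measurableType d) (R : realType) (P : probability T R).
Variables (X : {RV P >-> R}) (F : R -> R) (v : nat).
Hypothesis cdfX : forall x, cdf X x = (F x)%:E.
Hypothesis F_cont : continuous F.
Hypothesis F_cvg1 : F x @[x --> +oo] --> (1 : R).
Hypothesis v_gt0 : (0 < v)%N.

Let F0 x : 0 <= F x. Proof. exact: df_ge0 cdfX x. Qed.
Let F1 x : F x <= 1. Proof. exact: df_le1 cdfX x. Qed.
Let mF : measurable_fun [set: R] F. Proof. exact: df_measurable cdfX. Qed.
Let F01 x : 0 <= F x <= 1. Proof. by rewrite F0 F1. Qed.
Let w x : R := score v (F x).

Let mwX : measurable_fun setT (fun t => w (X t)).
Proof.
have mw := measurable_score v mF.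
exact: (measurableT_comp mw (measurable_funP X)).
Qed.

Let gap y : R := range_tail v (F y) - v%:R * \int[P]_t ((y < X t)%R%:R * w (X t)).

Let integrable_tail_score y : P.-integrable setT
  (EFin \o (fun t => (y < X t)%R%:R * w (X t))).
Proof.
apply: (@integrable_bounded _ _ _ P _ 1).
  by apply: measurable_funM; [exact: measurable_indicator_lt|exact: mwX].
move=> t; rewrite normrM -[leRHS]mulr1 ler_pM//.
  by rewrite ger0_norm// lern1 leq_b1.
exact: score_le1.
Qed.

(** The first term is the constant of [range_tail_second_order], the second [v] times the Lipschitz
    constant of [score]. *)
Let K : R := 2 * v%:R ^+ 2 + 4 * v%:R ^+ 3.

Let gap_bound y y' : y <= y' -> `|gap y - gap y'| <= K * (F y' - F y) ^+ 2.
Proof.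
move=> yy'.
pose q t : R := (X t <= y')%R%:R - (X t <= y)%R%:R.
have q0 t : 0 <= q t.
  by rewrite subr_ge0 ler_nat; case: (leP (X t) y) => // h; rewrite (le_trans h).
have Ii z := integrable_le_indicator X z.
have Iq : P.-integrable setT (EFin \o q) by exact: (integrableB measurableT (Ii y') (Ii y)).
have qE : \int[P]_t q t = F y' - F y.
  by rewrite RintegralB// !(Rintegral_le_indicator cdfX).
have dF0 : 0 <= F y' - F y by rewrite subr_ge0 (df_homo cdfX).
(* On the event [y < X t <= y'], whose indicator is [q], the score is frozen at [y']. The error is
   at most a multiple of [F y' - F y], on an event of that same probability, hence the square. *)
pose r t : R := q t * (w y' - w (X t)).
have mq : measurable_fun setT q by apply: measurable_funB; exact: measurable_indicator_le.
have r_le t : `|r t| <= 4 * v%:R ^+ 2 * (F y' - F y) * q t.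
  rewrite normrM (ger0_norm (q0 t)) mulrC /q.
  have [Xy'|y'X] := leP (X t) y'; last first.
    have -> : (X t <= y)%R = false by apply/negbTE; rewrite -ltNge (le_lt_trans yy').
    by rewrite subrr !mulr0.
  have [Xy|yX] := leP (X t) y; first by rewrite subrr !mulr0.
  rewrite subr0 !mulr1 (le_trans (score_lipschitz v (F01 _) (F01 _)))// ler_wpM2l ?mulr_ge0 ?sqr_ge0//.
  rewrite ger0_norm ?subr_ge0 ?(df_homo cdfX)// lerD2l lerN2 (df_homo cdfX)// ltW//.
have Irb : P.-integrable setT (EFin \o (fun t => 4 * v%:R ^+ 2 * (F y' - F y) * q t)).
  exact: (integrableZl measurableT (4 * v%:R ^+ 2 * (F y' - F y)) Iq).
have Ir : P.-integrable setT (EFin \o r).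
  apply: le_integrable Irb => //.
    apply/measurable_EFinP; apply: measurable_funM => //; exact: measurable_funB.
  by move=> t _; rewrite /= lee_fin (le_trans (r_le t))// ler_norm.
have r_bound : `|\int[P]_t r t| <= 4 * v%:R ^+ 2 * (F y' - F y) ^+ 2.
  apply: (le_trans (le_normr_Rintegral _ Ir)) => //.
  have -> : 4 * v%:R ^+ 2 * (F y' - F y) ^+ 2 = \int[P]_t (4 * v%:R ^+ 2 * (F y' - F y) * q t).
    by rewrite RintegralZl// qE; ring.
  by apply: le_Rintegral => //; exact: integrable_abse Ir.
have Iwq : P.-integrable setT (EFin \o (fun t => w y' * q t)).
  exact: (integrableZl measurableT (w y') Iq).
have dE : \int[P]_t ((y < X t)%R%:R * w (X t)) - \int[P]_t ((y' < X t)%R%:R * w (X t)) =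
    w y' * (F y' - F y) - \int[P]_t r t.
  rewrite -qE -RintegralZl// -!RintegralB//.
  apply: eq_Rintegral => t _; rewrite /r /q !ltNge.
  by case: (leP (X t) y) => _; case: (leP (X t) y') => _ /=; ring.
have := range_tail_second_order v (F01 y') (F01 y).
set s := _ + _ => hs.
have -> : gap y - gap y' = s + v%:R * \int[P]_t r t.
  have -> : gap y - gap y' = range_tail v (F y) - range_tail v (F y') -
     v%:R * (\int[P]_t ((y < X t)%R%:R * w (X t)) - \int[P]_t ((y' < X t)%R%:R * w (X t))).
    by rewrite /gap; ring.
  by rewrite dE /s /w; ring.
rewrite (le_trans (ler_normD _ _))//.
have h2 : `|v%:R * \int[P]_t r t| <= v%:R * (4 * v%:R ^+ 2 * (F y' - F y) ^+ 2).
  by rewrite normrM ger0_norm// ler_wpM2l.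
rewrite (le_trans (lerD hs h2))// le_eqVlt; apply/orP; left; apply/eqP.
by rewrite /K; ring.
Qed.

(* Splitting [y, y'] at a point where F takes its mean value halves the constant. *)
Let gap_halving n y y' : y <= y' ->
  `|gap y - gap y'| <= K / 2 ^+ n * (F y' - F y) ^+ 2.
Proof.
elim: n y y' => [|n IH] y y' yy'; first by rewrite expr0 divr1 gap_bound.
have Fyy' := df_homo cdfX yy'.
have [|c] := @IVT R F y y' ((F y + F y') / 2) yy' (continuous_subspaceT F_cont).
  by rewrite min_l// max_r//; apply/andP; split; lra.
rewrite in_itv /= => /andP[yc cy'] Fc.
rewrite -(subrKA (gap c)) (le_trans (ler_normD _ _))//.
rewrite (le_trans (lerD (IH _ _ yc) (IH _ _ cy')))// Fc [2 ^+ n.+1]exprS.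
rewrite le_eqVlt; apply/orP; left; apply/eqP; field.
by rewrite expf_neq0.
Qed.

Let gap_cst y y' : y <= y' -> gap y = gap y'.
Proof.
move=> yy'; apply/eqP; rewrite -subr_eq0 -normr_le0; apply/ler_addgt0Pr => e e0.
rewrite add0r.
pose a := K * (F y' - F y) ^+ 2.
have K0 : 0 <= K by rewrite addr_ge0// mulr_ge0// exprn_ge0.
have a0 : 0 <= a by rewrite mulr_ge0// sqr_ge0.
(* Since [2 ^ n] exceeds [n], which exceeds [a / e], this many halvings bring the bound below
   [e]. *)
pose n := (Num.trunc (a / e)).+1.
have an : a / e < n%:R by exact: truncnS_gt.
apply: (le_trans (gap_halving n yy')).
have -> : K / 2 ^+ n * (F y' - F y) ^+ 2 = a / 2 ^+ n by rewrite /a; ring.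
rewrite ler_pdivrMr ?exprn_gt0// mulrC -ler_pdivrMr// (le_trans (ltW an))//.
by rewrite -natrX ler_nat ltnW// ltn_expl.
Qed.

Let gap_small y : `|gap y| <= 4 * v%:R ^+ 2 * (1 - F y).
Proof.
have v1 : 1 <= v%:R :> R by rewrite ler1n.
have h1 := range_tail_bound v_gt0 (F01 y).
have Ii := integrable_le_indicator X y.
have Ic : P.-integrable setT (EFin \o (fun _ : T => 1 : R)).
  by apply: (@integrable_bounded _ _ _ P _ 1) => // t; rewrite normr1.
have h2 : `|\int[P]_t ((y < X t)%R%:R * w (X t))| <= 1 - F y.
  apply: (le_trans (le_normr_Rintegral _ (integrable_tail_score y))) => //.
  have <- : \int[P]_t (1 - (X t <= y)%R%:R) = 1 - F y.
    by rewrite RintegralB// Rintegral_prob_cst (Rintegral_le_indicator cdfX).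
  apply: le_Rintegral => //.
  - exact: integrable_abse (integrable_tail_score y).
  - exact: (integrableB measurableT Ic Ii).
  move=> t _; rewrite normrM ltNge; case: (leP (X t) y) => _ /=.
    by rewrite normr0 mul0r subrr.
  by rewrite normr1 mul1r subr0 score_le1.
rewrite (le_trans (ler_normB _ _))//.
have h3 : `|v%:R * \int[P]_t ((y < X t)%R%:R * w (X t))| <= v%:R ^+ 2 * (1 - F y).
  rewrite normrM ger0_norm// expr2 -mulrA ler_wpM2l// (le_trans h2)// ler_peMl//.
  by rewrite subr_ge0.
rewrite (le_trans (lerD h1 h3))// le_eqVlt; apply/orP; left; apply/eqP; ring.
Qed.

Lemma range_tailE y : v%:R * \int[P]_t ((y < X t)%R%:R * score v (F (X t))) = range_tail v (F y).
Proof.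
apply/esym/eqP; rewrite -subr_eq0 -normr_le0; apply/ler_addgt0Pr => e e0; rewrite add0r.
have v2 : 0 < 4 * v%:R ^+ 2 :> R by rewrite mulr_gt0// exprn_gt0// ltr0n.
have e'0 : 0 < e / (4 * v%:R ^+ 2) by rewrite divr_gt0.
have [y' [yy' Fy']] : exists y', y <= y' /\ 1 - F y' <= e / (4 * v%:R ^+ 2).
  move/cvgrPdist_le : F_cvg1 => /(_ _ e'0) [M [_ HM]].
  exists (Num.max y (M + 1)); split; first by rewrite le_max lexx.
  apply: le_trans (ler_norm _) (HM _ _).
  by rewrite lt_max ltrDl ltr01 orbT.
rewrite -/(w _) -/(gap y) (gap_cst yy') (le_trans (gap_small y'))//.
by rewrite mulrC -ler_pdivlMr.
Qed.

End range_tail_derivative.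

(** * Application to the i.i.d. sample *)

Section iid_sample.
Context d (T : measurableType d) (R : realType) (P : probability T R).
Variables (v : nat) (F : cumulativeBounded (0 : R) (1 : R)).
Variables (X : {RV P >-> R}) (Xs : nat -> {RV P >-> R}).
Hypothesis v_gt1 : (1 < v)%N.
Hypothesis F_ac : absolutely_continuous F.
Hypothesis cdfX : forall x, cdf X x = (F x)%:E.
Hypothesis X0 : {ae P, forall t, 0 <= X t}.
Hypothesis EX : ('E_P[X] < +oo)%E.
Hypothesis Xs_iid : iid_with_df F Xs.
Local Notation mu := (@lebesgue_measure R).
Local Notation D := (`[0%R, +oo[%classic : set R).

Let Xs_indep : mutually_independent Xs. Proof. by case: Xs_iid. Qed.
Let cdfXs : forall j x, cdf (Xs j) x = (F x)%:E. Proof. by case: Xs_iid. Qed.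
Let v_gt0 : (0 < v)%N. Proof. exact: ltnW. Qed.
Let F0 x : 0 <= F x. Proof. exact: df_ge0 cdfX x. Qed.
Let F1 x : F x <= 1. Proof. exact: df_le1 cdfX x. Qed.
Let mF : measurable_fun [set: R] F. Proof. exact: df_measurable cdfX. Qed.
Let F_cvg1 : F x @[x --> +oo] --> (1 : R). Proof. exact: cumulativey. Qed.

Let F_cont : continuous F.
Proof.
move=> x; apply/cvgrPdist_lt => e e0; have [r r0 Hr] := F_ac e0.
(* Absolute continuity applied to a family of one interval. *)
have key a b : a <= b -> b - a < r -> `|F b - F a| < e.
  move=> ab bar; have := Hr 1%N (fun=> a) (fun=> b) (fun=> ab).
  by rewrite !big_ord1; apply => // i j _ _ _; rewrite !ord1.
near=> y.
have xy : `|x - y| < r by near: y; exact: cvgr_dist_lt.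
have [h|/ltW h] := leP y x; last rewrite distrC.
  by apply: key => //; rewrite (le_lt_trans (ler_norm _)).
by apply: key => //; rewrite (le_lt_trans (ler_norm _))// distrC.
Unshelve. all: by end_near.
Qed.

Let law j A : measurable A -> P (Xs j @^-1` A) = P (X @^-1` A).
Proof.
move=> mA; rewrite -(lebesgue_stieltjes_law (cdfXs j) mA).
exact: (lebesgue_stieltjes_law cdfX mA).
Qed.

Let Xs0 : {ae P, forall t, forall j, 0 <= Xs j t}.
Proof.
apply: ae_foralln => j.
have mA : measurable (`]-oo, 0[%classic : set R) by exact: measurable_itv.
have mpre (Y : {RV P >-> R}) : measurable (Y @^-1` `]-oo, 0[%classic).
  by rewrite -[_ @^-1` _]setTI; exact: measurable_funP.
have pre0 (Y : {RV P >-> R}) t : (0 <= Y t) -> ~ (Y @^-1` `]-oo, 0[%classic) t.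
  by rewrite /= in_itv /= leNgt => /negP.
exists (Xs j @^-1` `]-oo, 0[%classic); split; first exact: mpre.
  have N : P.-negligible (X @^-1` `]-oo, 0[%classic).
    by apply: negligibleS X0 => t Xt /= /pre0; exact.
  by apply: (etrans (law j mA)); move/(negligibleP P (mpre X)) : N; exact.
by move=> t /=; rewrite in_itv /= => /negP; rewrite -ltNge.
Qed.

Let integral_max : (\int[P]_t (Num.max (X t) 0)%:E = 'E_P[X])%E.
Proof.
rewrite expectation_def; apply: ae_eq_integral => //.
- by apply/measurable_EFinP; exact: measurable_maxr.
- by apply/measurable_EFinP; exact: measurable_funP.
- by apply: filterS X0 => t Xt0 _; rewrite max_l.
Qed.

Let IF : mu.-integrable D (EFin \o (fun x => 1 - F x)).
Proof.
apply/integrableP; split.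
  by apply/measurable_EFinP/measurable_funTS; exact: measurable_funB.
under eq_integral do rewrite /= ger0_norm ?subr_ge0//.
by rewrite (integral_df_tail cdfX) integral_max.
Qed.

(** Intermediate values starting from [F 0 = 0], which combines the nonnegativity of [X] with the
    absence of an atom at 0. That [m] is nonnegative keeps the comparison of levels inside the
    half-line. *)
Let exists_quantile : exists2 m, 0 <= m & F m = 3 / 4.
Proof.
have F00 : F 0 = 0.
  have mX : measurable (X @^-1` `]-oo, 0[%classic).
    by rewrite -[_ @^-1` _]setTI; exact: measurable_funP.
  have h : P (X @^-1` `]-oo, 0[%classic) = 0%E.
    have N : P.-negligible (X @^-1` `]-oo, 0[%classic).
      apply: negligibleS X0 => t Xt /= Xt0.
      by move: Xt; rewrite /= in_itv /= ltNge Xt0.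
    by move/(negligibleP P mX) : N; exact.
  have e1 := no_atom cdfX F_cont 0.
  apply/eqP; rewrite -(inj_eq (@EFin_inj R)) -cdfX.
  have -> : cdf X 0 = P (X @^-1` `]-oo, 0[%classic `|` X @^-1` [set 0]).
    congr (P _); apply/seteqP; split => t /=; rewrite !in_itv /= le_eqVlt.
      by case/predU1P; [right|left].
    by case=> [->|->]; rewrite ?orbT ?eqxx.
  have m0 : measurable (X @^-1` [set 0]).
    by rewrite -[_ @^-1` _]setTI; exact: measurable_funP.
  by apply/eqP; apply: (etrans (measureU0 mX m0 e1)).
have q0 : (0 : R) < 1 / 4 by lra.
have [b [b0 Fb]] : exists b, 0 <= b /\ 3 / 4 <= F b.
  move/cvgrPdist_le : F_cvg1 => /(_ _ q0) [M [_ HM]].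
  exists (Num.max 0 (M + 1)); split; first by rewrite le_max lexx.
  have : M < Num.max 0 (M + 1) by rewrite lt_max ltrDl ltr01 orbT.
  by move/HM => /= h; have := le_trans (ler_norm _) h; lra.
have [|c] := @IVT R F 0 b (3 / 4) b0 (continuous_subspaceT F_cont).
  by rewrite F00 min_l// max_r//; apply/andP; split; lra.
by rewrite in_itv /= => /andP[c0 _] Fc; exists c.
Qed.

Lemma mean_range_tail : mean_range Xs v = (\int[mu]_(x in D) (range_tail v (F x))%:E)%E.
Proof. exact: (mean_range_integral Xs_indep cdfXs v_gt0 Xs0). Qed.

Let h (z : T * measurableTypeR R) : R := (z.2 < X z.1)%R%:R * score v (F (X z.1)).

Let mwX : measurable_fun setT (fun t => score v (F (X t))).
Proof.
have mw := measurable_score v mF.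
exact: (measurableT_comp mw (measurable_funP X)).
Qed.

Let score1 t : `|score v (F (X t))| <= 1.
Proof. by rewrite score_le1 ?F0 ?F1. Qed.

Let mh : measurable_fun setT (EFin \o h).
Proof.
apply/measurable_EFinP; apply: measurable_funM.
  apply: measurable_indicator_lt => //.
  exact: (measurableT_comp (measurable_funP X) measurable_fst).
exact: (measurableT_comp mwX measurable_fst).
Qed.

Let integral_indicatorM s c :
  (\int[mu]_(x in D) ((x < s)%R%:R * c)%:E = (Num.max s 0 * c)%:E)%E.
Proof.
under eq_integral do rewrite EFinM.
rewrite integralZr//; last exact: integrable_lt_indicator.
by rewrite integral_lt_indicator_max -EFinM.
Qed.

Let integrable_max_score :
  P.-integrable setT (EFin \o (fun t => Num.max (X t) 0 * score v (F (X t)))).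
Proof.
have Im : P.-integrable setT (EFin \o (fun t => Num.max (X t) 0)).
  apply/integrableP; split; first by apply/measurable_EFinP; exact: measurable_maxr.
  under eq_integral do rewrite /= ger0_norm ?le_max ?lexx ?orbT//.
  by rewrite integral_max.
apply: le_integrable Im => //.
  by apply/measurable_EFinP; apply: measurable_funM => //; exact: measurable_maxr.
by move=> t _; rewrite /= lee_fin normrM ler_piMr.
Qed.

(** Under [P], the factor [X] is written as an integral over levels and the two integrals are
    exchanged; the inner one is then given by [range_tailE]. The integrand is signed, so Fubini is
    used, justified by the bounded score and the finite mean. *)
Lemma mean_range_stieltjes : mean_range Xs v =
  (v%:R%:E * \int[lebesgue_stieltjes_measure F]_(x in `[0%R, +oo[)
               (x * weight F v x)%:E)%E.
Proof.
(* The maximum extends the integrand by zero to the whole line, where the change of measure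
   applies. *)
pose g (x : measurableTypeR R) : \bar R := (Num.max x 0 * score v (F x))%:E.
have mg : measurable_fun setT g.
  apply/measurable_EFinP; apply: measurable_funM; first exact: measurable_maxr.
  exact: measurable_score.
have -> : (\int[lebesgue_stieltjes_measure F]_(x in D) (x * weight F v x)%:E =
    \int[lebesgue_stieltjes_measure F]_x g x)%E.
  rewrite integral_mkcond; apply: eq_integral => x _; rewrite patchE /g.
  case: ifPn => [|/negP xD].
    by rewrite inE /= in_itv /= andbT => x0; rewrite max_l.
  rewrite max_r ?mul0r//; rewrite inE /= in_itv /= andbT in xD.
  by rewrite leNgt; apply/negP => x0; apply: xD; exact: ltW.
have -> : (\int[lebesgue_stieltjes_measure F]_x g x = \int[distribution P (borel_of X)]_x g x)%E.
  by apply: eq_measure_integral => A mA _; exact: (lebesgue_stieltjes_law cdfX mA).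
rewrite integral_distribution//.
have -> : (\int[P]_t (g \o borel_of X) t = \int[P]_(t in setT) \int[mu]_(x in D) (EFin \o h) (t, x))%E.
  by apply: eq_integral => t _; rewrite /h /= integral_indicatorM.
rewrite (@fubini_on _ _ T (measurableTypeR R) R P mu setT D _ _ (EFin \o h))//; last first.
  have /integrableP[_] := integrable_max_score; apply: le_lt_trans.
  rewrite le_eqVlt; apply/orP; left; apply/eqP; apply: eq_integral => t _.
  transitivity (\int[mu]_(x in D) ((x < X t)%R%:R * `|score v (F (X t))|)%:E)%E.
    by apply: eq_integral => x _; rewrite /h /= normrM normr_nat.
  by rewrite integral_indicatorM /= normrM (ger0_norm (_ : 0 <= Num.max _ _))// le_max lexx orbT.
have innerE y : (\int[P]_t (EFin \o h) (t, y) = (v%:R^-1 * range_tail v (F y))%:E)%E.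
  have Ih : P.-integrable setT (EFin \o (fun t => (y < X t)%R%:R * score v (F (X t)))).
    apply: (@integrable_bounded _ _ _ P _ 1).
      by apply: measurable_funM => //; exact: measurable_indicator_lt.
    by move=> t; rewrite normrM normr_nat mulr_ile1// ?ler_nat// lern1 leq_b1.
  rewrite -[LHS]fineK; last by apply: integrable_fin_num => //; exact: Ih.
  rewrite -(range_tailE cdfX F_cont F_cvg1 v_gt0) mulKf ?pnatr_eq0 -?lt0n//.
transitivity (v%:R%:E * \int[mu]_(y in D) (v%:R^-1 * range_tail v (F y))%:E)%E; last first.
  by congr (_ * _)%E; apply: eq_integral => y _; rewrite innerE.
have It := integrable_range_tail cdfXs v_gt0 IF.
have -> : (\int[mu]_(y in D) (v%:R^-1 * range_tail v (F y))%:E =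
    v%:R^-1%:E * \int[mu]_(y in D) (range_tail v (F y))%:E)%E.
  by under eq_integral do rewrite EFinM; rewrite integralZl.
by rewrite muleA -EFinM divff ?pnatr_eq0 -?lt0n// mul1e mean_range_tail.
Qed.

Lemma normalized_error_cvg : (sigma3_sq F v < +oo)%E ->
  cvg_in_distribution (fun n => normalized_error Xs v (sigma3 F v) n : {RV P >-> R})
    (normal_prob 0 1).
Proof.
move=> s_fin; have [m m0 Fm] := exists_quantile.
have [vE vI] := influence_variance (cdfXs 0) v_gt1 IF m0 Fm s_fin.
have v_pos := influence_variance_gt0 (cdfXs 0) F_cont v_gt1 IF m0 Fm.
set s := sigma3 F v.
have s2 : 0 < fine (sigma3_sq F v) by rewrite fine_gt0// s_fin andbT -vE.
have s0 : 0 < s by rewrite sqrtr_gt0.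
have ssqr : s ^+ 2 = \int[P]_t (influence F v (Xs 0%N t) ^+ 2).
  by rewrite sqr_sqrtr ?ltW// -vE.
have minf := measurable_influence v F0 F1 mF IF.
have mpsi : measurable_fun [set: R] (fun x => s^-1 * influence F v x).
  exact: measurable_funM.
pose psi : {mfun R >-> R} := mfun_Sub (mem_set mpsi).
have psi_std : standardized (psi_of Xs psi 0).
  split.
  - have := integrableZl measurableT (s^-1 ^+ 2) vI.
    congr (P.-integrable setT _); apply/funext => t.
    by rewrite -EFinM -exprMn.
  - have mZ : measurable_fun setT (fun t => influence F v (Xs 0%N t)).
      exact: (measurableT_comp minf (measurable_funP (Xs 0%N))).
    have I1 := integrable_of_square mZ vI.
    transitivity (s^-1 * \int[P]_t influence F v (Xs 0%N t)); last first.
      by rewrite (influence_mean _ (cdfXs 0) IF) mulr0.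
    by rewrite -RintegralZl.
  transitivity (s^-1 ^+ 2 * \int[P]_t (influence F v (Xs 0%N t) ^+ 2)).
    rewrite -RintegralZl//; apply: eq_Rintegral => t _.
    by rewrite /= exprMn.
  by rewrite -ssqr -exprMn mulVf ?gt_eqF// expr1n.
have X_law j A : measurable A -> P (Xs j @^-1` A) = P (Xs 0%N @^-1` A).
  by move=> mA; rewrite !law.
have mW n : measurable_fun setT (fun t => (Num.sqrt n%:R)^-1 * psi_sum Xs psi n t).
  by apply: measurable_funM => //; exact: measurable_psi_sum.
pose W n : {RV P >-> R} := mfun_Sub (mem_set (mW n)).
set m1 := \int[mu]_(x in D) (1 - F x).
(* The bound of [remainder_expectation], of order [1 / n], multiplied by [Num.sqrt n%:R / s]. *)
pose r n : R := 4 * v%:R ^+ 2 * m1 / s * (Num.sqrt n%:R)^-1.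
apply: smooth_cvg_in_distribution => C f sf.
apply: (@smooth_cvg_slutsky _ _ _ P _ W r C f) => //.
(* For an empty sample both variables vanish, and so does [r], because the inverse of 0 is 0. *)
- case=> [|n].
    have -> : (fun t => `|normalized_error Xs v s 0 t - W 0%N t|%:E) = cst 0%E.
      apply/funext => t; rewrite /normalized_error /W /= /psi_sum big_ord0 mulr0.
      by rewrite sqrtr0 !mul0r subrr normr0.
    by rewrite integral0 /r sqrtr0 invr0 mulr0.
  set N := n.+1; set q := Num.sqrt (N%:R : R).
  have q0 : 0 < q by rewrite sqrtr_gt0 ltr0n.
  have qq : q ^+ 2 = N%:R by rewrite sqr_sqrtr ?ler0n.
  have NE : N%:R^-1 = q^-1 * q^-1 by rewrite -qq expr2 invfM.
  have WE t : normalized_error Xs v s N t - W N t =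
      q / s * (N_hat Xs v N t - range_mean F v - linear_part Xs F v N t).
    have -> : normalized_error Xs v s N t = q * (N_hat Xs v N t - range_mean F v) / s.
      by rewrite /normalized_error mean_range_tail.
    rewrite /W /= /psi_sum -mulr_sumr -/q /linear_part NE.
    set S := \sum_(_ < _) _.
    by field; rewrite !gt_eqF.
  under eq_integral do rewrite WE normrM ger0_norm ?divr_ge0 ?ltW// EFinM.
  rewrite ge0_integralZl//; last 2 first.
  - apply/measurable_EFinP; apply: measurableT_comp => //.
    apply: measurable_funB; first by apply: measurable_funB => //; exact: measurable_N_hat.
    apply: measurable_funM => //; apply: measurable_sum => j.
    exact: (measurableT_comp minf (measurable_funP (Xs j))).
  - by rewrite lee_fin divr_ge0// ltW.
  have rem := remainder_expectation Xs_indep cdfXs v_gt0 IF (ltn0Sn n) Xs0.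
  apply: (le_trans (lee_wpmul2l _ rem)); first by rewrite lee_fin divr_ge0// ltW.
  rewrite -EFinM lee_fin /r -/m1 -/q -/N NE le_eqVlt; apply/orP; left; apply/eqP.
  by field; rewrite !gt_eqF.
- rewrite -[X in _ --> X](mulr0 (4 * v%:R ^+ 2 * m1 / s)).
  by apply: cvgM; [exact: cvg_cst|exact: cvg_sqrt_invr].
- exact: (smooth_central_limit Xs_indep X_law psi_std sf).
Qed.

End iid_sample.

Theorem corollary3 (R : realType) (d : measure_display) (T : measurableType d)
    (P : probability T R) (v : nat) (F : cumulativeBounded (0 : R) (1 : R))
    (X : {RV P >-> R}) (Xs : nat -> {RV P >-> R}) :
  (1 < v)%N ->
  absolutely_continuous F ->
  (forall x, cdf X x = (F x)%:E) ->
  {ae P, forall t, 0 <= X t} ->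
  ('E_P[X] < +oo)%E ->
  iid_with_df F Xs ->
  mean_range Xs v =
    (v%:R%:E * \int[lebesgue_stieltjes_measure F]_(x in `[0%R, +oo[)
                 (x * weight F v x)%:E)%E
  /\
  ((sigma3_sq F v < +oo)%E ->
   cvg_in_distribution
     (fun n => normalized_error Xs v (sigma3 F v) n : {RV P >-> R})
     (normal_prob 0 1)).
Proof.
move=> v_gt1 F_ac cdfX X0 EX Xs_iid; split.
  exact: (mean_range_stieltjes v_gt1 F_ac cdfX X0 EX Xs_iid).
exact: (normalized_error_cvg v_gt1 F_ac cdfX X0 EX Xs_iid).
Qed.
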